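(* Any two orientations of a (finite) tree, viewed as posets, are universally derived equivalent.
   Context: An orientation of a finite tree $T$ (a choice of direction for each edge) is viewed as a poset on the vertex set of $T$ by setting $x\le y$ if there exists an oriented path from $x$ to $y$ (including the trivial path). For a poset $P$ (viewed as a small category with a unique morphism $p\to p'$ if $p\le p'$ and none otherwise) and a category $\mathcal{A}$, $\mathcal{A}^P$ denotes the category of functors $P\to\mathcal{A}$. If $\mathcal{A}$ is abelian, so is $\mathcal{A}^P$, and $D(\mathcal{A}^P)$ denotes its (unbounded) derived category with its standard triangulated structure. Two posets $P$ and $Q$ are universally derived equivalent if for every abelian category $\mathcal{A}$ the derived categories $D(\mathcal{A}^P)$ and $D(\mathcal{A}^Q)$ are equivalent as triangulated categories. *)

(* Defs.v *)
From HB Require Import structures.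
From Stdlib Require Import Setoid Morphisms.
From Stdlib Require Import IndefiniteDescription.
From mathcomp Require Import all_boot all_order all_algebra.

Set Implicit Arguments.
Unset Strict Implicit.
Unset Printing Implicit Defensive.

Declare Scope cat_scope.
Delimit Scope cat_scope with cat.
Local Open Scope cat_scope.
Local Obligation Tactic := simpl.

(** * Categories *)

(* Hom-sets carry an explicit equality [heq] (a hom-set in the usual sense is
   [Hom X Y] modulo [heq]), so that quotients of hom-sets, as in a localization,
   need no quotient types.  Objects and morphisms live in a common universe,
   which is arbitrary: no smallness is assumed, and the localization of a
   category is again a [Category]. *)
Record Category := {
  Ob :> Type;
  Hom : Ob -> Ob -> Type;
  heq : forall X Y, Hom X Y -> Hom X Y -> Prop;
  heq_equiv : forall X Y, Equivalence (@heq X Y);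
  idm : forall X, Hom X X;
  comp : forall X Y Z, Hom Y Z -> Hom X Y -> Hom X Z;
  comp_proper : forall X Y Z (g g' : Hom Y Z) (f f' : Hom X Y),
    heq g g' -> heq f f' -> heq (comp g f) (comp g' f');
  comp_idl : forall X Y (f : Hom X Y), heq (comp (idm Y) f) f;
  comp_idr : forall X Y (f : Hom X Y), heq (comp f (idm X)) f;
  compA : forall X Y Z V (h : Hom Z V) (g : Hom Y Z) (f : Hom X Y),
    heq (comp h (comp g f)) (comp (comp h g) f)
}.

Arguments idm {C} X : rename.
Notation "X ~> Y" := (Hom X Y) (at level 70, no associativity) : cat_scope.
Notation "f ≈ g" := (heq f g) (at level 70, no associativity) : cat_scope.
Notation "g ∘ f" := (comp g f) (at level 40, left associativity) : cat_scope.

#[export] Existing Instance heq_equiv.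

#[export] Instance comp_Proper (C : Category) (X Y Z : C) :
  Proper (@heq C Y Z ==> @heq C X Y ==> @heq C X Z) (@comp C X Y Z).
Proof. by move=> g g' Hg f f' Hf; apply: comp_proper. Qed.

Definition is_iso (C : Category) (X Y : C) (f : X ~> Y) : Prop :=
  exists g : Y ~> X, g ∘ f ≈ idm X /\ f ∘ g ≈ idm Y.

Record Functor (C D : Category) := {
  fob :> C -> D;
  fmap : forall X Y : C, X ~> Y -> fob X ~> fob Y;
  fmap_proper : forall (X Y : C) (f g : X ~> Y), f ≈ g -> fmap f ≈ fmap g;
  fmap_id : forall X : C, fmap (idm X) ≈ idm (fob X);
  fmap_comp : forall (X Y Z : C) (g : Y ~> Z) (f : X ~> Y),
    fmap (g ∘ f) ≈ fmap g ∘ fmap f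
}.
Arguments fmap {C D} F {X Y} f : rename.

#[export] Instance fmap_Proper (C D : Category) (F : Functor C D) (X Y : C) :
  Proper (@heq C X Y ==> @heq D (F X) (F Y)) (@fmap C D F X Y).
Proof. by move=> f g; apply: fmap_proper. Qed.

Program Definition functor_id (C : Category) : Functor C C :=
  {| fob X := X; fmap X Y f := f |}.
Solve All Obligations with by move=> *; try reflexivity.

Program Definition functor_comp (C D E : Category) (G : Functor D E)
    (F : Functor C D) : Functor C E :=
  {| fob X := G (F X); fmap X Y f := fmap G (fmap F f) |}.
Next Obligation. by move=> *; do 2 apply: fmap_proper. Qed.
Next Obligation. by move=> *; rewrite !fmap_id; reflexivity. Qed.
Next Obligation. by move=> *; rewrite !fmap_comp; reflexivity. Qed.

Record NatTrans (C D : Category) (F G : Functor C D) := {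
  nt :> forall X : C, F X ~> G X;
  nt_nat : forall (X Y : C) (f : X ~> Y), nt Y ∘ fmap F f ≈ fmap G f ∘ nt X
}.

Definition nat_iso (C D : Category) (F G : Functor C D) : Prop :=
  exists a : NatTrans F G, forall X, is_iso (a X).

Definition is_equivalence (C D : Category) (F : Functor C D) : Prop :=
  exists G : Functor D C,
    nat_iso (functor_comp G F) (functor_id C) /\
    nat_iso (functor_comp F G) (functor_id D).

Program Definition FunctorCat (C D : Category) : Category :=
  {| Ob := Functor C D;
     Hom F G := NatTrans F G;
     heq F G a b := forall X, a X ≈ b X;
     idm F := {| nt X := idm (F X) |};
     comp F G H b a := {| nt X := b X ∘ a X |} |}.
Next Obligation.
move=> *; split.
- by move=> a X; reflexivity.
- by move=> a b H X; symmetry; apply: H.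
- by move=> a b c H K X; transitivity (b X).
Qed.
Next Obligation. by move=> *; rewrite comp_idl comp_idr; reflexivity. Qed.
Next Obligation.
by move=> *; rewrite -compA nt_nat compA nt_nat compA; reflexivity.
Qed.
Next Obligation. by move=> *; apply: comp_proper. Qed.
Next Obligation. by move=> *; rewrite comp_idl; reflexivity. Qed.
Next Obligation. by move=> *; rewrite comp_idr; reflexivity. Qed.
Next Obligation. by move=> *; rewrite compA; reflexivity. Qed.

(* The condition [heq := True] makes morphisms unique. *)
Program Definition poset_cat (d : Order.disp_t) (P : porderType d) : Category :=
  {| Ob := P;
     Hom x y := (x <= y)%O;
     heq _ _ _ _ := True;
     idm x := Order.POrderTheory.lexx x;
     comp x y z h k := Order.POrderTheory.le_trans k h |}.
Next Obligation. by move=> *; split. Qed.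
Solve All Obligations with done.

(** * Abelian categories *)

Record PreadditiveCat := {
  pcat :> Category;
  hzero : forall X Y : pcat, X ~> Y;
  hadd : forall X Y : pcat, X ~> Y -> X ~> Y -> X ~> Y;
  hopp : forall X Y : pcat, X ~> Y -> X ~> Y;
  hadd_proper : forall (X Y : pcat) (f f' g g' : X ~> Y),
    f ≈ f' -> g ≈ g' -> hadd f g ≈ hadd f' g';
  hopp_proper : forall (X Y : pcat) (f f' : X ~> Y),
    f ≈ f' -> hopp f ≈ hopp f';
  haddA : forall (X Y : pcat) (f g h : X ~> Y),
    hadd f (hadd g h) ≈ hadd (hadd f g) h;
  haddC : forall (X Y : pcat) (f g : X ~> Y), hadd f g ≈ hadd g f;
  hadd0 : forall (X Y : pcat) (f : X ~> Y), hadd (hzero X Y) f ≈ f;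
  haddN : forall (X Y : pcat) (f : X ~> Y), hadd (hopp f) f ≈ hzero X Y;
  comp_addl : forall (X Y Z : pcat) (g g' : Y ~> Z) (f : X ~> Y),
    hadd g g' ∘ f ≈ hadd (g ∘ f) (g' ∘ f);
  comp_addr : forall (X Y Z : pcat) (g : Y ~> Z) (f f' : X ~> Y),
    g ∘ hadd f f' ≈ hadd (g ∘ f) (g ∘ f')
}.
Arguments hzero {C X Y} : rename.
Notation "0" := hzero : cat_scope.
Notation "f + g" := (hadd f g) : cat_scope.
Notation "- f" := (hopp f) : cat_scope.

#[export] Instance hadd_Proper (C : PreadditiveCat) (X Y : C) :
  Proper (@heq C X Y ==> @heq C X Y ==> @heq C X Y) (@hadd C X Y).
Proof. by move=> f f' Hf g g' Hg; apply: hadd_proper. Qed.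

#[export] Instance hopp_Proper (C : PreadditiveCat) (X Y : C) :
  Proper (@heq C X Y ==> @heq C X Y) (@hopp C X Y).
Proof. by move=> f f' Hf; apply: hopp_proper. Qed.

Section PreadditiveTheory.
Context {C : PreadditiveCat}.
Implicit Types X Y Z : C.

Lemma hadd0r X Y (f : X ~> Y) : f + 0 ≈ f.
Proof. by rewrite haddC hadd0; reflexivity. Qed.

Lemma haddNr X Y (f : X ~> Y) : f + - f ≈ 0.
Proof. by rewrite haddC haddN; reflexivity. Qed.

Lemma hadd_cancel X Y (f g h : X ~> Y) : f + g ≈ f + h -> g ≈ h.
Proof.
move=> H; rewrite -(hadd0 g) -(hadd0 h) -(haddN f) -!haddA H; reflexivity.
Qed.

Lemma comp0l X Y Z (f : X ~> Y) : (0 : Y ~> Z) ∘ f ≈ 0.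
Proof.
apply: (@hadd_cancel _ _ (0 ∘ f)); rewrite -comp_addl hadd0 hadd0r; reflexivity.
Qed.

Lemma comp0r X Y Z (g : Y ~> Z) : g ∘ (0 : X ~> Y) ≈ 0.
Proof.
apply: (@hadd_cancel _ _ (g ∘ 0)); rewrite -comp_addr hadd0 hadd0r; reflexivity.
Qed.

Lemma hopp_uniq X Y (f g : X ~> Y) : f + g ≈ 0 -> g ≈ - f.
Proof. by move=> H; apply: (@hadd_cancel _ _ f); rewrite H haddNr; reflexivity. Qed.

Lemma comp_oppl X Y Z (g : Y ~> Z) (f : X ~> Y) : (- g) ∘ f ≈ - (g ∘ f).
Proof. by apply: hopp_uniq; rewrite -comp_addl haddNr comp0l; reflexivity. Qed.

Lemma comp_oppr X Y Z (g : Y ~> Z) (f : X ~> Y) : g ∘ (- f) ≈ - (g ∘ f).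
Proof. by apply: hopp_uniq; rewrite -comp_addr haddNr comp0r; reflexivity. Qed.

Lemma hoppK X Y (f : X ~> Y) : - - f ≈ f.
Proof. by symmetry; apply: hopp_uniq; rewrite haddN; reflexivity. Qed.

Lemma hopp0 X Y : - (0 : X ~> Y) ≈ 0.
Proof. by symmetry; apply: hopp_uniq; rewrite hadd0; reflexivity. Qed.

End PreadditiveTheory.

Record Kernel (C : PreadditiveCat) (X Y : C) (f : X ~> Y) := {
  ker_ob :> C;
  ker_inc : ker_ob ~> X;
  ker_zero : f ∘ ker_inc ≈ 0;
  ker_lift : forall (V : C) (g : V ~> X), f ∘ g ≈ 0 -> V ~> ker_ob;
  ker_liftK : forall (V : C) (g : V ~> X) (e : f ∘ g ≈ 0),
    ker_inc ∘ ker_lift e ≈ g;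
  ker_mono : forall (V : C) (h k : V ~> ker_ob),
    ker_inc ∘ h ≈ ker_inc ∘ k -> h ≈ k
}.
Arguments ker_inc {C X Y f} k : rename.
Arguments ker_zero {C X Y f} k : rename.
Arguments ker_lift {C X Y f} k {V g} e : rename.
Arguments ker_liftK {C X Y f} k {V g} e : rename.
Arguments ker_mono {C X Y f} k {V h k0} e : rename.

Record Cokernel (C : PreadditiveCat) (X Y : C) (f : X ~> Y) := {
  coker_ob :> C;
  coker_pr : Y ~> coker_ob;
  coker_zero : coker_pr ∘ f ≈ 0;
  coker_desc : forall (V : C) (g : Y ~> V), g ∘ f ≈ 0 -> coker_ob ~> V;
  coker_descK : forall (V : C) (g : Y ~> V) (e : g ∘ f ≈ 0),
    coker_desc e ∘ coker_pr ≈ g;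
  coker_epi : forall (V : C) (h k : coker_ob ~> V),
    h ∘ coker_pr ≈ k ∘ coker_pr -> h ≈ k
}.
Arguments coker_pr {C X Y f} k : rename.
Arguments coker_zero {C X Y f} k : rename.
Arguments coker_desc {C X Y f} k {V g} e : rename.
Arguments coker_descK {C X Y f} k {V g} e : rename.
Arguments coker_epi {C X Y f} k {V h k0} e : rename.

Record Biproduct (C : PreadditiveCat) (X Y : C) := {
  bp_ob :> C;
  bp_inl : X ~> bp_ob;
  bp_inr : Y ~> bp_ob;
  bp_prl : bp_ob ~> X;
  bp_prr : bp_ob ~> Y;
  bp_ll : bp_prl ∘ bp_inl ≈ idm X;
  bp_rr : bp_prr ∘ bp_inr ≈ idm Y;
  bp_lr : bp_prl ∘ bp_inr ≈ 0;
  bp_rl : bp_prr ∘ bp_inl ≈ 0;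
  bp_sum : bp_inl ∘ bp_prl + bp_inr ∘ bp_prr ≈ idm bp_ob
}.
Arguments bp_inl {C X Y} b : rename.
Arguments bp_inr {C X Y} b : rename.
Arguments bp_prl {C X Y} b : rename.
Arguments bp_prr {C X Y} b : rename.
Arguments bp_ll {C X Y} b : rename.
Arguments bp_rr {C X Y} b : rename.
Arguments bp_lr {C X Y} b : rename.
Arguments bp_rl {C X Y} b : rename.
Arguments bp_sum {C X Y} b : rename.

Section BiproductTheory.
Context {C : PreadditiveCat} {X Y : C} (b : Biproduct X Y) {V : C}.

Lemma bp_llK (h : V ~> X) : bp_prl b ∘ (bp_inl b ∘ h) ≈ h.
Proof. by rewrite compA bp_ll comp_idl; reflexivity. Qed.

Lemma bp_rrK (h : V ~> Y) : bp_prr b ∘ (bp_inr b ∘ h) ≈ h.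
Proof. by rewrite compA bp_rr comp_idl; reflexivity. Qed.

Lemma bp_lrK (h : V ~> Y) : bp_prl b ∘ (bp_inr b ∘ h) ≈ 0.
Proof. by rewrite compA bp_lr comp0l; reflexivity. Qed.

Lemma bp_rlK (h : V ~> X) : bp_prr b ∘ (bp_inl b ∘ h) ≈ 0.
Proof. by rewrite compA bp_rl comp0l; reflexivity. Qed.

End BiproductTheory.

Section CoimageImage.
Context {C : PreadditiveCat} {X Y : C} {f : X ~> Y}.
Context (k : Kernel f) (c : Cokernel f).
Context (coim : Cokernel (ker_inc k)) (im : Kernel (coker_pr c)).

Lemma coim_im_subproof : coker_pr c ∘ coker_desc coim (ker_zero k) ≈ 0.
Proof.
apply: (coker_epi coim).
by rewrite -compA coker_descK coker_zero comp0l; reflexivity.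
Qed.

Definition coim_im_map : coim ~> im := ker_lift im coim_im_subproof.

End CoimageImage.

Record AbelianCat := {
  acat :> PreadditiveCat;
  zob : acat;
  zob_init : forall (X : acat) (f : zob ~> X), f ≈ 0;
  zob_term : forall (X : acat) (f : X ~> zob), f ≈ 0;
  biprod : forall X Y : acat, Biproduct X Y;
  ker : forall (X Y : acat) (f : X ~> Y), Kernel f;
  coker : forall (X Y : acat) (f : X ~> Y), Cokernel f;
  coim_im : forall (X Y : acat) (f : X ~> Y),
    is_iso (coim_im_map (coker (ker_inc (ker f))) (ker (coker_pr (coker f))))
}.
Arguments zob : clear implicits.
Arguments biprod {A} X Y : rename.
Arguments ker {A X Y} f : rename.
Arguments coker {A X Y} f : rename.

(** * The abelian category of functors *)

Section FunctorAbelian.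
Context (C : Category).

Program Definition FunctorPre (A : PreadditiveCat) : PreadditiveCat :=
  {| pcat := FunctorCat C A;
     hzero F G := {| nt X := 0 |};
     hadd F G a b := {| nt X := nt a X + nt b X |};
     hopp F G a := {| nt X := - nt a X |} |}.
Next Obligation. by move=> *; rewrite comp0l comp0r; reflexivity. Qed.
Next Obligation. by move=> *; rewrite comp_addl comp_addr !nt_nat; reflexivity. Qed.
Next Obligation. by move=> *; rewrite comp_oppl comp_oppr nt_nat; reflexivity. Qed.
Next Obligation. by move=> A F G a a' b b' Ha Hb X; apply: hadd_proper. Qed.
Next Obligation. by move=> A F G a a' Ha X; apply: hopp_proper. Qed.
Next Obligation. by move=> *; apply: haddA. Qed.
Next Obligation. by move=> *; apply: haddC. Qed.
Next Obligation. by move=> *; apply: hadd0. Qed.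
Next Obligation. by move=> *; apply: haddN. Qed.
Next Obligation. by move=> *; apply: comp_addl. Qed.
Next Obligation. by move=> *; apply: comp_addr. Qed.

Context (A : AbelianCat).
Notation AC := (FunctorPre A).
Implicit Types F G : AC.

Program Definition fzob : AC := {| fob _ := zob A; fmap _ _ _ := idm (zob A) |}.
Solve All Obligations with
  by move=> *; rewrite ?comp_idl; reflexivity.

Program Definition fbiprod_ob F G : AC :=
  {| fob X := biprod (fob F X) (fob G X);
     fmap X Y f := bp_inl _ ∘ (fmap F f ∘ bp_prl _) + bp_inr _ ∘ (fmap G f ∘ bp_prr _) |}.
Next Obligation. by move=> F G X Y f g H; rewrite H; reflexivity. Qed.
Next Obligation. by move=> F G X; rewrite !fmap_id !comp_idl bp_sum; reflexivity. Qed.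
Next Obligation.
move=> F G X Y Z g f.
rewrite comp_addl !comp_addr -!compA.
rewrite ![bp_prl _ ∘ (_ ∘ _)]compA ![bp_prr _ ∘ (_ ∘ _)]compA.
rewrite bp_ll bp_rr bp_lr bp_rl !comp_idl !comp0l !comp0r hadd0 hadd0r.
by rewrite !fmap_comp -!compA; reflexivity.
Qed.

Program Definition fbiprod F G : Biproduct F G :=
  {| bp_ob := fbiprod_ob F G;
     bp_inl := {| nt X := bp_inl (biprod (fob F X) (fob G X)) |};
     bp_inr := {| nt X := bp_inr (biprod (fob F X) (fob G X)) |};
     bp_prl := {| nt X := bp_prl (biprod (fob F X) (fob G X)) |};
     bp_prr := {| nt X := bp_prr (biprod (fob F X) (fob G X)) |} |}.
Next Obligation.
by move=> *; rewrite comp_addl -!compA bp_ll bp_rl !comp0r hadd0r comp_idr; reflexivity.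
Qed.
Next Obligation.
by move=> *; rewrite comp_addl -!compA bp_lr bp_rr !comp0r hadd0 comp_idr; reflexivity.
Qed.
Next Obligation.
by move=> *; rewrite comp_addr !compA bp_ll bp_lr !comp0l hadd0r comp_idl; reflexivity.
Qed.
Next Obligation.
by move=> *; rewrite comp_addr !compA bp_rl bp_rr !comp0l hadd0 comp_idl; reflexivity.
Qed.
Next Obligation. by move=> *; apply: bp_ll. Qed.
Next Obligation. by move=> *; apply: bp_rr. Qed.
Next Obligation. by move=> *; apply: bp_lr. Qed.
Next Obligation. by move=> *; apply: bp_rl. Qed.
Next Obligation. by move=> *; apply: bp_sum. Qed.

Section Kernels.
Context {F G : AC} (a : F ~> G).

Lemma fker_map_subproof (X Y : C) (f : X ~> Y) :
  nt a Y ∘ (fmap F f ∘ ker_inc (ker (nt a X))) ≈ 0.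
Proof. by rewrite compA nt_nat -compA ker_zero comp0r; reflexivity. Qed.

Lemma fcoker_map_subproof (X Y : C) (f : X ~> Y) :
  (coker_pr (coker (nt a Y)) ∘ fmap G f) ∘ nt a X ≈ 0.
Proof. by rewrite -compA -nt_nat compA coker_zero comp0l; reflexivity. Qed.

Program Definition fker_ob : AC :=
  {| fob X := ker (nt a X);
     fmap X Y f := ker_lift _ (fker_map_subproof f) |}.
Next Obligation.
by move=> X Y f g H; apply: ker_mono; rewrite !ker_liftK H; reflexivity.
Qed.
Next Obligation.
by move=> X; apply: ker_mono; rewrite ker_liftK fmap_id comp_idl comp_idr; reflexivity.
Qed.
Next Obligation.
move=> X Y Z g f; apply: ker_mono.
by rewrite compA !ker_liftK -compA ker_liftK fmap_comp compA; reflexivity.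
Qed.

Program Definition fcoker_ob : AC :=
  {| fob X := coker (nt a X);
     fmap X Y f := coker_desc _ (fcoker_map_subproof f) |}.
Next Obligation.
by move=> X Y f g H; apply: coker_epi; rewrite !coker_descK H; reflexivity.
Qed.
Next Obligation.
by move=> X; apply: coker_epi; rewrite coker_descK fmap_id comp_idl comp_idr; reflexivity.
Qed.
Next Obligation.
move=> X Y Z g f; apply: coker_epi.
by rewrite -compA !coker_descK compA coker_descK fmap_comp compA; reflexivity.
Qed.

Program Definition fker : Kernel a :=
  {| ker_ob := fker_ob;
     ker_inc := {| nt X := ker_inc (ker (nt a X)) |};
     ker_lift V g e := {| nt X := ker_lift (ker (nt a X)) (e X) |} |}.
Next Obligation. by move=> *; rewrite ker_liftK; reflexivity. Qed.
Next Obligation. by move=> *; apply: ker_zero. Qed.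
Next Obligation.
move=> V g e X Y f; apply: ker_mono.
by rewrite compA ker_liftK nt_nat compA ker_liftK -compA ker_liftK; reflexivity.
Qed.
Next Obligation. by move=> *; apply: ker_liftK. Qed.
Next Obligation. by move=> V h k H X; apply: ker_mono; apply: H. Qed.

Program Definition fcoker : Cokernel a :=
  {| coker_ob := fcoker_ob;
     coker_pr := {| nt X := coker_pr (coker (nt a X)) |};
     coker_desc V g e := {| nt X := coker_desc (coker (nt a X)) (e X) |} |}.
Next Obligation. by move=> *; rewrite coker_descK; reflexivity. Qed.
Next Obligation. by move=> *; apply: coker_zero. Qed.
Next Obligation.
move=> V g e X Y f; apply: coker_epi.
by rewrite -!compA !coker_descK compA coker_descK nt_nat; reflexivity.
Qed.
Next Obligation. by move=> *; apply: coker_descK. Qed.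
Next Obligation. by move=> V h k H X; apply: coker_epi; apply: H. Qed.

End Kernels.

Lemma nt_is_iso F G (a : F ~> G) : (forall X, is_iso (nt a X)) -> is_iso a.
Proof.
move=> H; pose b X := constructive_indefinite_description _ (H X).
have bN (X Y : C) (f : X ~> Y) :
    sval (b Y) ∘ fmap G f ≈ fmap F f ∘ sval (b X).
  case: (b X) (b Y) => g [/= gK Kg] [h [/= hK Kh]].
  rewrite -[h ∘ fmap G f]comp_idr -Kg compA -[h ∘ _ ∘ _]compA -nt_nat.
  by rewrite compA hK comp_idl; reflexivity.
exists {| nt_nat := bN |}; split=> X /=; case: (b X) => g [/= gK Kg].
  exact: gK.
exact: Kg.
Qed.

Program Definition FunctorAb : AbelianCat :=
  {| acat := AC;
     zob := fzob;
     biprod := fbiprod;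
     ker F G a := fker a;
     coker F G a := fcoker a |}.
Next Obligation. by move=> F a X; apply: zob_init. Qed.
Next Obligation. by move=> F a X; apply: zob_term. Qed.
Next Obligation.
move=> F G a; apply: nt_is_iso => X.
have [m [mK Km]] := coim_im (nt a X).
have E : nt (coim_im_map (fcoker (ker_inc (fker a)))
           (fker (coker_pr (fcoker a)))) X ≈
  coim_im_map (coker (ker_inc (ker (nt a X))))
           (ker (coker_pr (coker (nt a X)))).
  apply: ker_mono; apply: coker_epi.
  rewrite /coim_im_map /= !ker_liftK !coker_descK; reflexivity.
by exists m; split; rewrite E.
Qed.

End FunctorAbelian.

(** * Complexes and cohomology *)

Definition isucc (n : int) : int := (n + 1)%R.

Record Complex (A : PreadditiveCat) := {
  cx :> int -> A;
  cd : forall n, cx n ~> cx (isucc n);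
  cdd : forall n, cd (isucc n) ∘ cd n ≈ 0
}.
Arguments cd {A} X n : rename.
Arguments cdd {A} X n : rename.

Record ChainMap (A : PreadditiveCat) (X Y : Complex A) := {
  cm :> forall n, X n ~> Y n;
  cm_comm : forall n, cm (isucc n) ∘ cd X n ≈ cd Y n ∘ cm n
}.

Program Definition ComplexCat (A : PreadditiveCat) : Category :=
  {| Ob := Complex A;
     Hom X Y := ChainMap X Y;
     heq X Y f g := forall n, f n ≈ g n;
     idm X := {| cm n := idm (X n) |};
     comp X Y Z g f := {| cm n := g n ∘ f n |} |}.
Next Obligation.
move=> *; split.
- by move=> a X; reflexivity.
- by move=> a b H X; symmetry; apply: H.
- by move=> a b c H K X; transitivity (b X).
Qed.
Next Obligation. by move=> *; rewrite comp_idl comp_idr; reflexivity. Qed.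
Next Obligation.
by move=> *; rewrite -compA cm_comm compA cm_comm compA; reflexivity.
Qed.
Next Obligation. by move=> *; apply: comp_proper. Qed.
Next Obligation. by move=> *; rewrite comp_idl; reflexivity. Qed.
Next Obligation. by move=> *; rewrite comp_idr; reflexivity. Qed.
Next Obligation. by move=> *; rewrite compA; reflexivity. Qed.

Section Homology.
Context {A : AbelianCat}.

Definition homology {X Y Z : A} {f : X ~> Y} {g : Y ~> Z} (e : g ∘ f ≈ 0) : A :=
  coker (ker_lift (ker g) e).

Section HomologyMap.
Context {X Y Z X' Y' Z' : A} {f : X ~> Y} {g : Y ~> Z} {f' : X' ~> Y'}
  {g' : Y' ~> Z'} (e : g ∘ f ≈ 0) (e' : g' ∘ f' ≈ 0)
  {a : X ~> X'} {b : Y ~> Y'} {c : Z ~> Z'}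
  (Hf : b ∘ f ≈ f' ∘ a) (Hg : c ∘ g ≈ g' ∘ b).

Lemma cycle_map_subproof : g' ∘ (b ∘ ker_inc (ker g)) ≈ 0.
Proof. by rewrite compA -Hg -compA ker_zero comp0r; reflexivity. Qed.

Definition cycle_map : ker g ~> ker g' := ker_lift (ker g') cycle_map_subproof.

Lemma homology_map_subproof :
  (coker_pr (coker (ker_lift (ker g') e')) ∘ cycle_map) ∘ ker_lift (ker g) e ≈ 0.
Proof.
have E : cycle_map ∘ ker_lift (ker g) e ≈ ker_lift (ker g') e' ∘ a.
  apply: ker_mono; rewrite !compA !ker_liftK -compA ker_liftK; exact: Hf.
by rewrite -compA E compA coker_zero comp0l; reflexivity.
Qed.

Definition homology_map : homology e ~> homology e' :=
  coker_desc (coker _) homology_map_subproof.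

End HomologyMap.
End Homology.

Section HomologyTheory.
Context {A : AbelianCat}.

Lemma homology_map_comp {X Y Z X' Y' Z' X'' Y'' Z'' : A}
  {f : X ~> Y} {g : Y ~> Z} {f' : X' ~> Y'} {g' : Y' ~> Z'}
  {f'' : X'' ~> Y''} {g'' : Y'' ~> Z''}
  (e : g ∘ f ≈ 0) (e' : g' ∘ f' ≈ 0) (e'' : g'' ∘ f'' ≈ 0)
  {a : X ~> X'} {b : Y ~> Y'} {c : Z ~> Z'}
  {a' : X' ~> X''} {b' : Y' ~> Y''} {c' : Z' ~> Z''}
  {a'' : X ~> X''} {b'' : Y ~> Y''} {c'' : Z ~> Z''}
  (Hf : b ∘ f ≈ f' ∘ a) (Hg : c ∘ g ≈ g' ∘ b)
  (Hf' : b' ∘ f' ≈ f'' ∘ a') (Hg' : c' ∘ g' ≈ g'' ∘ b')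
  (Hf'' : b'' ∘ f ≈ f'' ∘ a'') (Hg'' : c'' ∘ g ≈ g'' ∘ b'') :
  b' ∘ b ≈ b'' ->
  homology_map e' e'' Hf' Hg' ∘ homology_map e e' Hf Hg ≈
  homology_map e e'' Hf'' Hg''.
Proof.
move=> E; apply: coker_epi.
rewrite -compA !coker_descK compA coker_descK -compA.
apply: comp_proper; first by reflexivity.
by apply: ker_mono; rewrite compA !ker_liftK -compA ker_liftK compA E; reflexivity.
Qed.

Lemma homology_map_id {X Y Z : A} {f : X ~> Y} {g : Y ~> Z} (e : g ∘ f ≈ 0)
  {a : X ~> X} {c : Z ~> Z} (Hf : idm Y ∘ f ≈ f ∘ a) (Hg : c ∘ g ≈ g ∘ idm Y) :
  homology_map e e Hf Hg ≈ idm (homology e).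
Proof.
apply: coker_epi; rewrite coker_descK comp_idl -[X in _ ≈ X]comp_idr.
apply: comp_proper; first by reflexivity.
by apply: ker_mono; rewrite ker_liftK comp_idl comp_idr; reflexivity.
Qed.

End HomologyTheory.

(* [cohomology X n] is the cohomology of [X] in degree [n + 1]; all degrees are
   reached since [n] ranges over the integers. *)
Definition cohomology (A : AbelianCat) (X : Complex A) (n : int) : A :=
  homology (cdd X n).

Definition cohomology_map (A : AbelianCat) (X Y : Complex A) (f : ChainMap X Y)
    (n : int) : cohomology X n ~> cohomology Y n :=
  homology_map (cdd X n) (cdd Y n) (cm_comm f n) (cm_comm f (isucc n)).

Definition quasi_iso (A : AbelianCat) (X Y : ComplexCat A) (f : X ~> Y) : Prop :=
  forall n, is_iso (cohomology_map f n).

(* The shift [X[1]], with differential [- d]. *)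
Program Definition shift_complex (A : PreadditiveCat) (X : Complex A) : Complex A :=
  {| cx n := X (isucc n); cd n := - cd X (isucc n) |}.
Next Obligation.
by move=> A X n; rewrite comp_oppl comp_oppr hoppK cdd; reflexivity.
Qed.

Program Definition shift_functor (A : PreadditiveCat) :
    Functor (ComplexCat A) (ComplexCat A) :=
  {| fob X := shift_complex X;
     fmap X Y f := {| cm n := cm f (isucc n) |} |}.
Next Obligation.
by move=> A X Y f n; rewrite comp_oppl comp_oppr cm_comm; reflexivity.
Qed.
Next Obligation. by move=> A X Y f g H n; apply: H. Qed.
Next Obligation. by move=> *; reflexivity. Qed.
Next Obligation. by move=> *; reflexivity. Qed.

Lemma shift_quasi_iso (A : AbelianCat) (X Y : ComplexCat A) (f : X ~> Y) :
  quasi_iso f -> quasi_iso (fmap (shift_functor A) f).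
Proof.
move=> H n; have [h [hK Kh]] := H (isucc n).
have opp_l (V W : A) (k : V ~> W) : idm W ∘ k ≈ (- k) ∘ (- idm V).
  by rewrite comp_oppl comp_oppr hoppK comp_idl comp_idr; reflexivity.
have opp_r (V W : A) (k : V ~> W) : (- idm W) ∘ k ≈ (- k) ∘ idm V.
  by rewrite !comp_oppl comp_idl comp_idr; reflexivity.
have opp_l' (V W : A) (k : V ~> W) : idm W ∘ (- k) ≈ k ∘ (- idm V).
  by rewrite !comp_oppr comp_idl comp_idr; reflexivity.
have opp_r' (V W : A) (k : V ~> W) : (- idm W) ∘ (- k) ≈ k ∘ idm V.
  by rewrite comp_oppl comp_oppr hoppK comp_idl comp_idr; reflexivity.
pose p (Z : Complex A) := homology_map (cdd Z (isucc n)) (cdd (shift_complex Z) n)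
  (opp_l _ _ _) (opp_r _ _ _).
pose q (Z : Complex A) := homology_map (cdd (shift_complex Z) n) (cdd Z (isucc n))
  (opp_l' _ _ _) (opp_r' _ _ _).
have idl (V W : A) (k : V ~> W) : idm W ∘ k ≈ k ∘ idm V.
  by rewrite comp_idl comp_idr; reflexivity.
have pq Z : p Z ∘ q Z ≈ idm _.
  rewrite -(homology_map_id _ (idl _ _ _) (idl _ _ _)).
  by apply: homology_map_comp; rewrite comp_idl; reflexivity.
have qp Z : q Z ∘ p Z ≈ idm _.
  rewrite -(homology_map_id _ (idl _ _ _) (idl _ _ _)).
  by apply: homology_map_comp; rewrite comp_idl; reflexivity.
have E : cohomology_map (fmap (shift_functor A) f) n ∘ p X ≈
         p Y ∘ cohomology_map f (isucc n).
  have K : cm f (isucc (isucc n)) ∘ idm _ ≈ idm _ ∘ cm f (isucc (isucc n)).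
    by rewrite comp_idl comp_idr; reflexivity.
  have K1 : (idm _ ∘ cm f (isucc (isucc n))) ∘ cd X (isucc n) ≈
      (- cd Y (isucc n)) ∘ (- cm f (isucc n)).
    by rewrite comp_idl comp_oppl comp_oppr hoppK cm_comm; reflexivity.
  have K2 : (- cm f (isucc (isucc (isucc n)))) ∘ cd X (isucc (isucc n)) ≈
      (- cd Y (isucc (isucc n))) ∘ (idm _ ∘ cm f (isucc (isucc n))).
    by rewrite comp_idl !comp_oppl cm_comm; reflexivity.
  transitivity (homology_map (cdd X (isucc n)) (cdd (shift_complex Y) n) K1 K2).
    exact: homology_map_comp.
  by symmetry; apply: homology_map_comp; reflexivity.
have E' : cohomology_map (fmap (shift_functor A) f) n ≈
         p Y ∘ cohomology_map f (isucc n) ∘ q X.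
  by rewrite -E -compA pq comp_idr; reflexivity.
exists (p X ∘ h ∘ q Y); split.
  rewrite E' -!compA [q Y ∘ _]compA qp comp_idl [h ∘ _]compA hK comp_idl.
  exact: pq.
rewrite E' -!compA [q X ∘ _]compA qp comp_idl [_ ∘ (h ∘ _)]compA Kh comp_idl.
exact: pq.
Qed.

(* The mapping cone, with differential [(x, y) |-> (- d x, u x + d y)]. *)
Section Cone.
Context {A : AbelianCat} {X Y : ComplexCat A} (u : X ~> Y).

Program Definition cone : ComplexCat A :=
  {| cx n := biprod (cx X (isucc n)) (cx Y n);
     cd n := bp_inl _ ∘ (- cd X (isucc n) ∘ bp_prl _) +
             bp_inr _ ∘ (cm u (isucc n) ∘ bp_prl _ + cd Y n ∘ bp_prr _) |}.
Next Obligation.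
move=> n; rewrite !(comp_addl, comp_addr) -!compA.
rewrite !(bp_llK, bp_lrK, bp_rlK, bp_rrK).
rewrite !(comp_oppl, comp_oppr) [cd X _ ∘ (_ ∘ _)]compA cdd.
rewrite [cd Y _ ∘ (cd Y _ ∘ _)]compA cdd [cm u _ ∘ (_ ∘ _)]compA cm_comm -compA.
by rewrite !(comp0l, comp0r, hopp0, hadd0, hadd0r) haddN; reflexivity.
Qed.

Program Definition cone_in : Y ~> cone := {| cm n := bp_inr _ |}.
Next Obligation.
move=> n; rewrite comp_addl -!compA comp_addl -!compA bp_rr bp_lr.
by rewrite !comp0r !hadd0 comp_idr; reflexivity.
Qed.

Program Definition cone_out : cone ~> shift_functor A X := {| cm n := bp_prl _ |}.
Next Obligation.
move=> n; rewrite comp_addr !compA bp_ll bp_lr !comp0l hadd0r comp_idl.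
by reflexivity.
Qed.

End Cone.

(** * Localization of a category at a class of morphisms *)

Section Localization.
Context {C : Category} (W : forall X Y : C, X ~> Y -> Prop).

(* Morphisms of the localization are formal composites of morphisms of [C] and
   of inverses of morphisms in [W]. *)
Inductive loc_hom : C -> C -> Type :=
| loc_id X : loc_hom X X
| loc_mor X Y (f : X ~> Y) : loc_hom X Y
| loc_inv X Y (s : X ~> Y) (Ws : W s) : loc_hom Y X
| loc_comp X Y Z (g : loc_hom Y Z) (f : loc_hom X Y) : loc_hom X Z.

Inductive loc_eq : forall X Y, loc_hom X Y -> loc_hom X Y -> Prop :=
| loc_refl X Y (f : loc_hom X Y) : loc_eq f f
| loc_sym X Y (f g : loc_hom X Y) : loc_eq f g -> loc_eq g f
| loc_trans X Y (f g h : loc_hom X Y) : loc_eq f g -> loc_eq g h -> loc_eq f h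
| loc_comp_proper X Y Z (g g' : loc_hom Y Z) (f f' : loc_hom X Y) :
    loc_eq g g' -> loc_eq f f' -> loc_eq (loc_comp g f) (loc_comp g' f')
| loc_idl X Y (f : loc_hom X Y) : loc_eq (loc_comp (loc_id Y) f) f
| loc_idr X Y (f : loc_hom X Y) : loc_eq (loc_comp f (loc_id X)) f
| loc_compA X Y Z V (h : loc_hom Z V) (g : loc_hom Y Z) (f : loc_hom X Y) :
    loc_eq (loc_comp h (loc_comp g f)) (loc_comp (loc_comp h g) f)
| loc_mor_proper X Y (f g : X ~> Y) : f ≈ g -> loc_eq (loc_mor f) (loc_mor g)
| loc_mor_id X : loc_eq (loc_mor (idm X)) (loc_id X)
| loc_mor_comp X Y Z (g : Y ~> Z) (f : X ~> Y) :
    loc_eq (loc_mor (g ∘ f)) (loc_comp (loc_mor g) (loc_mor f))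
| loc_invl X Y (s : X ~> Y) (Ws : W s) :
    loc_eq (loc_comp (loc_inv Ws) (loc_mor s)) (loc_id X)
| loc_invr X Y (s : X ~> Y) (Ws : W s) :
    loc_eq (loc_comp (loc_mor s) (loc_inv Ws)) (loc_id Y).

Program Definition Loc : Category :=
  {| Ob := C; Hom := loc_hom; heq := loc_eq; idm := loc_id; comp := loc_comp |}.
Next Obligation.
move=> X Y; split.
- exact: loc_refl.
- exact: loc_sym.
- exact: loc_trans.
Qed.
Next Obligation. exact: loc_comp_proper. Qed.
Next Obligation. exact: loc_idl. Qed.
Next Obligation. exact: loc_idr. Qed.
Next Obligation. exact: loc_compA. Qed.

Definition loc_functor : Functor C Loc :=
  {| fob := (id : C -> Loc); fmap := loc_mor; fmap_proper := loc_mor_proper;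
     fmap_id := loc_mor_id; fmap_comp := loc_mor_comp |}.

End Localization.

Section LocalizationMap.
Context {C D : Category} (W : forall X Y : C, X ~> Y -> Prop)
  (W' : forall X Y : D, X ~> Y -> Prop) (F : Functor C D).
Context (FW : forall (X Y : C) (s : X ~> Y), W s -> W' (fmap F s)).

Fixpoint loc_fmap (X Y : C) (f : loc_hom W X Y) : loc_hom W' (F X) (F Y) :=
  match f in loc_hom _ X Y return loc_hom W' (F X) (F Y) with
  | loc_id X => loc_id W' (F X)
  | loc_mor X Y f => loc_mor W' (fmap F f)
  | loc_inv X Y s Ws => loc_inv (FW Ws)
  | loc_comp X Y Z g f => loc_comp (loc_fmap g) (loc_fmap f)
  end.

Program Definition loc_map : Functor (Loc W) (Loc W') :=
  {| fob := (F : Loc W -> Loc W'); fmap := loc_fmap |}.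
Next Obligation.
move=> X Y f g; elim=> {X Y f g} /=; intros.
- exact: loc_refl.
- exact: loc_sym.
- by apply: loc_trans; eauto.
- exact: loc_comp_proper.
- exact: loc_idl.
- exact: loc_idr.
- exact: loc_compA.
- by apply: loc_mor_proper; apply: fmap_proper.
- by apply: loc_trans (loc_mor_id _ _); apply: loc_mor_proper; apply: fmap_id.
- by apply: loc_trans (loc_mor_comp _ _ _); apply: loc_mor_proper; apply: fmap_comp.
- exact: loc_invl.
- exact: loc_invr.
Qed.
Next Obligation. by move=> X; apply: loc_refl. Qed.
Next Obligation. by move=> *; apply: loc_refl. Qed.

End LocalizationMap.

(** * Derived categories *)

(* The data of a triangulated category.  Being equivalent as triangulated
   categories involves only these data, not the axioms they satisfy. *)
Record Triangulated := {
  tcat :> Category;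
  tshift : Functor tcat tcat;
  distinguished : forall X Y Z : tcat,
    X ~> Y -> Y ~> Z -> Z ~> tshift X -> Prop
}.

(* The functor [F] together with [phi] is exact; exact functors between
   triangulated categories are additive. *)
Definition triangulated_equiv (D1 D2 : Triangulated) : Prop :=
  exists (F : Functor D1 D2)
    (phi : NatTrans (functor_comp F (tshift D1)) (functor_comp (tshift D2) F)),
    is_equivalence F /\
    (forall X, is_iso (phi X)) /\
    (forall (X Y Z : D1) (f : X ~> Y) (g : Y ~> Z) (h : Z ~> tshift D1 X),
       distinguished f g h ->
       distinguished (fmap F f) (fmap F g) (phi X ∘ fmap F h)).

(* The localization of the category of unbounded complexes at the
   quasi-isomorphisms; the distinguished triangles are those isomorphic to
   [X -> Y -> cone u -> X[1]] for a morphism of complexes [u : X -> Y]. *)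
Definition derived_cat (A : AbelianCat) : Category := Loc (@quasi_iso A).

Definition derived_shift (A : AbelianCat) :
    Functor (derived_cat A) (derived_cat A) :=
  loc_map (@shift_quasi_iso A).

Definition derived_distinguished (A : AbelianCat) (X Y Z : derived_cat A)
    (f : X ~> Y) (g : Y ~> Z) (h : Z ~> derived_shift A X) : Prop :=
  let Q := loc_functor (@quasi_iso A) in
  exists (X' Y' : ComplexCat A) (u : X' ~> Y')
    (a : Q X' ~> X) (b : Q Y' ~> Y) (c : Q (cone u) ~> Z),
    [/\ is_iso a, is_iso b & is_iso c] /\
    [/\ f ∘ a ≈ b ∘ fmap Q u,
        g ∘ b ≈ c ∘ fmap Q (cone_in u) &
        h ∘ c ≈ fmap (derived_shift A) a ∘ fmap Q (cone_out u)].

Definition derived (A : AbelianCat) : Triangulated :=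
  {| tcat := derived_cat A;
     tshift := derived_shift A;
     distinguished := @derived_distinguished A |}.

Definition universally_derived_equivalent (d1 d2 : Order.disp_t)
    (P : porderType d1) (Q : porderType d2) : Prop :=
  forall A : AbelianCat,
    triangulated_equiv (derived (FunctorAb (poset_cat P) A))
                       (derived (FunctorAb (poset_cat Q) A)).

(** * Orientations of trees *)

(* [ucycleb edge c] says that the vertices of [c] are distinct and cyclically
   adjacent; it is a cycle of the graph when [c] has at least 3 vertices. *)
Record tree := {
  vertex : finType;
  edge : rel vertex;
  edge_sym : symmetric edge;
  edge_irr : irreflexive edge;
  tree_nonempty : 0 < #|vertex|;
  tree_connected : forall x y, connect edge x y;
  tree_acyclic : forall c : seq vertex, 2 < size c -> ~~ ucycleb edge c
}.

Record orientation (G : tree) := {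
  arrow :> rel (vertex G);
  arrow_edge : forall x y, arrow x y -> edge x y;
  arrow_dir : forall x y, edge x y -> arrow x y = ~~ arrow y x
}.

Lemma orientation_anti (G : tree) (o : orientation G) :
  antisymmetric (connect o).
Proof.
move=> x y /andP[xy yx]; apply/eqP/negPn/negP => neq.
have [z xz zx] : exists2 z, o x z & connect o z x.
  case/connectP: xy neq yx => [[|z p] /= ]; first by move=> _ ->; rewrite eqxx.
  move=> /andP[xz zp] -> _ yx; exists z => //.
  by apply: connect_trans yx; apply/connectP; exists p.
have irr v : o v v = false.
  by apply/negP => vv; have := arrow_edge vv; rewrite edge_irr.
case/connectP: zx => p0 zp0 Ex; case: (shortenP zp0) Ex => p zp up _ Ex.
have cyc : cycle (edge (t := G)) (z :: p).
  rewrite /= rcons_path -Ex (arrow_edge xz) andbT.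
  by apply: sub_path zp => u v; apply: arrow_edge.
case: p zp up Ex cyc => [|v [|w p]] /= zp up Ex cyc.
- by rewrite -Ex irr in xz.
- have := arrow_dir o (arrow_edge xz); rewrite xz => /esym/negP[].
  by move: zp; rewrite andbT Ex.
- have /negP[] := @tree_acyclic G (z :: v :: w :: p) isT.
  by apply/andP; split.
Qed.

(* The vertex set, ordered by existence of an oriented path. *)
Definition orientation_poset (G : tree) (o : orientation G) : Type := vertex G.

HB.instance Definition _ (G : tree) (o : orientation G) :=
  Finite.copy (orientation_poset o) (vertex G).

HB.instance Definition _ (G : tree) (o : orientation G) :=
  Order.Le_isPOrder.Build (Order.Disp tt tt) (orientation_poset o)
    (@connect0 _ o) (@orientation_anti G o) (@connect_trans _ o).

(* Main.v *)
(* Any two orientations of a tree differ by reversals of single edges.  If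
   [x -> y] is an arrow and [D] is the component of [x] after removal of the edge,
   then turning every vertex of [D] from a source into a sink, sources first,
   reverses each edge inside [D] twice and the edge [x -> y] once.

   Since oriented paths in a tree are unique, a functor on the poset is a
   representation of the oriented graph.  For a source [v] with neighbours [y_i], a
   representation [X] is sent to the complex of representations that equals the
   cone of [X_v -> sum_i X_(y_i)] at [v] and [X] elsewhere.  This is the cone of a
   natural transformation [T -> E], with [E X] equal to the sum of the [X_(y_i)] at
   [v] and to [X] elsewhere, and [T X] concentrated at [v].  Dually, at a sink one
   takes the cone of [L -> S].  The composites of the two constructions are
   quasi-isomorphic to the shift, by the short exact sequences
   [X -> L E X + S T X -> S E X] and [T L Y -> E L Y + T S Y -> Y].

   Homological algebra is done with generalized elements [V ~> X], which lift along
   an epimorphism after an epimorphic refinement of [V]. *)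
From Stdlib Require Import Setoid Morphisms IndefiniteDescription.
From mathcomp Require Import all_boot all_order ssralg ssrint.
Require Import Defs.

Set Implicit Arguments.
Unset Strict Implicit.
Unset Printing Implicit Defensive.
Local Open Scope cat_scope.
Local Obligation Tactic := simpl.

(** * Equations in hom groups *)

(** An arbitrary abelian category need not have enough projectives or injectives, so a reflection
    functor cannot be obtained by deriving a one-sided exact functor through resolutions. The
    functors [T], [E], [S], [L] are instead built from evaluations, zero objects and finite sums.
    Applied degree by degree they preserve quasi-isomorphisms, hence so does the cone of a
    transformation between two of them, and this cone descends to the localization without any
    choice. Morphisms of the localization are formal composites, with no calculus of fractions;
    every isomorphism of functors therefore comes from a natural chain map, and naturality is then
    extended to formal inverses.

    One theorem about a pair [T -> E], [L -> S] serves twice: for a reflection, and with [T = S = 0]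
    for the passage from a poset to the free category on its oriented graph. Over the free category
    no relations have to be checked, and the reflection works for every finite graph. That the graph
    is a tree enters in two places: oriented paths are unique, and removing an edge separates its
    ends. *)

Section HomGroup.
Context {C : PreadditiveCat} {X Y : C}.
Implicit Types f g : X ~> Y.

Inductive hexp := HZero | HVar of nat | HAdd of hexp & hexp | HOpp of hexp.

Fixpoint hden (env : seq (X ~> Y)) (e : hexp) : X ~> Y :=
  match e with
  | HZero => 0
  | HVar i => nth 0 env i
  | HAdd a b => hden env a + hden env b
  | HOpp a => - hden env a
  end.

(** Positive and negative occurrences of the atoms, not cancelled against each other. Equality is
    tested after the negative occurrences are moved across, which leaves a comparison of multisets
    and still decides cancellations such as [f + - f] against [0]. *)
Fixpoint hnorm (e : hexp) : seq nat * seq nat :=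
  match e with
  | HZero => ([::], [::])
  | HVar i => ([:: i], [::])
  | HAdd a b => ((hnorm a).1 ++ (hnorm b).1, (hnorm a).2 ++ (hnorm b).2)
  | HOpp a => ((hnorm a).2, (hnorm a).1)
  end.

Definition hlsum (env : seq (X ~> Y)) (s : seq nat) : X ~> Y :=
  foldr (fun i g => nth 0 env i + g) 0 s.

Lemma hlsum_cat env s t : hlsum env (s ++ t) ≈ hlsum env s + hlsum env t.
Proof.
elim: s => [|i s IH] /=; first by rewrite hadd0; reflexivity.
by rewrite IH haddA; reflexivity.
Qed.

Lemma haddAC (f g h : X ~> Y) : f + g + h ≈ f + h + g.
Proof. by rewrite -!haddA [g + h]haddC; reflexivity. Qed.

Lemma haddACA (f g h k : X ~> Y) : (f + g) + (h + k) ≈ (f + h) + (g + k).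
Proof. by rewrite !haddA [f + g + h]haddAC; reflexivity. Qed.

Lemma hden_norm env e :
  hden env e + hlsum env (hnorm e).2 ≈ hlsum env (hnorm e).1.
Proof.
elim: e => [|i|a IHa b IHb|a IHa] /=.
- by rewrite hadd0; reflexivity.
- by reflexivity.
- by rewrite !hlsum_cat haddACA IHa IHb; reflexivity.
- by rewrite -IHa haddA haddN hadd0; reflexivity.
Qed.

Lemma hlsum_perm env s t : perm_eq s t -> hlsum env s ≈ hlsum env t.
Proof.
move=> st; apply: (@catCA_perm_ind _ (fun u => hlsum env s ≈ hlsum env u) _ s t st).
  move=> s1 s2 s3 ->; rewrite !hlsum_cat !haddA; apply: hadd_proper.
    exact: haddC.
  by reflexivity.
by reflexivity.
Qed.

Lemma hexp_eq env a b :
  perm_eq ((hnorm a).1 ++ (hnorm b).2) ((hnorm b).1 ++ (hnorm a).2) ->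
  hden env a ≈ hden env b.
Proof.
move/(hlsum_perm env); rewrite !hlsum_cat -!hden_norm => E.
apply: (@hadd_cancel _ _ _ (hlsum env (hnorm a).2 + hlsum env (hnorm b).2)).
rewrite haddC haddA E -haddA haddC; apply: hadd_proper; last by reflexivity.
by rewrite haddC; reflexivity.
Qed.

End HomGroup.

Ltac hindex x env :=
  lazymatch env with
  | nil => constr:(O)
  | cons ?y ?r =>
    match constr:(Set) with
    | _ => let _ := match constr:(Set) with _ => constr_eq x y end in constr:(O)
    | _ => let n := hindex x r in constr:(S n)
    end
  end.

Ltac hatoms env t :=
  lazymatch t with
  | hzero => env
  | hadd ?a ?b => let env := hatoms env a in hatoms env b
  | hopp ?a => hatoms env a
  | ?x =>
    let rec mem e :=
      lazymatch e with
      | nil => constr:(false)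
      | cons ?y ?r =>
        match constr:(Set) with
        | _ => let _ := match constr:(Set) with _ => constr_eq x y end in constr:(true)
        | _ => mem r
        end
      end in
    lazymatch mem env with
    | true => env
    | false => constr:(cons x env)
    end
  end.

Ltac hreify env t :=
  lazymatch t with
  | hzero => constr:(HZero)
  | hadd ?a ?b =>
    let a := hreify env a in let b := hreify env b in constr:(HAdd a b)
  | hopp ?a => let a := hreify env a in constr:(HOpp a)
  | ?x => let n := hindex x env in constr:(HVar n)
  end.

Ltac abel_core :=
  lazymatch goal with
  | |- @heq ?D ?X ?Y ?s ?t =>
    let env := hatoms (@nil (@Hom D X Y)) s in
    let env := hatoms env t in
    let a := hreify env s in
    let b := hreify env t in
    exact: (@hexp_eq _ _ _ env a b isT)
  end.

(* Decides equations that hold in every abelian group; atoms are compared up to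
   unfolding of functor composition. *)
Ltac abel :=
  first [abel_core | cbn [fob fmap functor_comp functor_id]; abel_core].

Ltac push := rewrite ?(comp_addl, comp_addr, comp_oppl, comp_oppr, comp0l, comp0r) -?compA.


(** Use of a hypothesis in a linear combination: [f - g = l - r] is rearranged so that no
    subtraction occurs, and the remaining goal is an identity for [abel] or for a further use of
    [lin]. *)
Lemma lin (C : PreadditiveCat) (X Y : C) (l r f g : X ~> Y) :
  l ≈ r -> f + r ≈ g + l -> f ≈ g.
Proof.
move=> -> E; apply: (@hadd_cancel _ _ _ r).
by rewrite haddC E haddC; reflexivity.
Qed.

Lemma precomp (C : Category) (X Y Z : C) (f g : Y ~> Z) (e : X ~> Y) :
  f ≈ g -> f ∘ e ≈ g ∘ e.
Proof. by move=> ->; reflexivity. Qed.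

Lemma postcomp (C : Category) (X Y Z : C) (h : Y ~> Z) (f g : X ~> Y) :
  f ≈ g -> h ∘ f ≈ h ∘ g.
Proof. by move=> ->; reflexivity. Qed.

(** * Generalized elements in abelian categories *)

Section Iso.
Context {C : Category}.

Lemma is_iso_id (X : C) : is_iso (idm X).
Proof. by exists (idm X); rewrite comp_idl; split; reflexivity. Qed.

Lemma is_iso_comp (X Y Z : C) (g : Y ~> Z) (f : X ~> Y) :
  is_iso g -> is_iso f -> is_iso (g ∘ f).
Proof.
move=> [g' [gK Kg]] [f' [fK Kf]]; exists (f' ∘ g'); split.
- by rewrite -compA [g' ∘ _]compA gK comp_idl fK; reflexivity.
- by rewrite -compA [f ∘ _]compA Kf comp_idl Kg; reflexivity.
Qed.

Lemma is_iso_heq (X Y : C) (f g : X ~> Y) : f ≈ g -> is_iso f -> is_iso g.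
Proof. by move=> E [h [hK Kh]]; exists h; rewrite -E. Qed.

Lemma is_iso_fmap (D : Category) (F : Functor C D) (X Y : C) (f : X ~> Y) :
  is_iso f -> is_iso (fmap F f).
Proof.
move=> [g [gK Kg]]; exists (fmap F g).
by rewrite -!fmap_comp gK Kg !fmap_id; split; reflexivity.
Qed.

End Iso.

Section Epi.
Context {C : PreadditiveCat}.

Definition is_epi (X Y : C) (e : X ~> Y) : Prop :=
  forall (Z : C) (h : Y ~> Z), h ∘ e ≈ 0 -> h ≈ 0.

Definition is_mono (X Y : C) (m : X ~> Y) : Prop :=
  forall (Z : C) (h : Z ~> X), m ∘ h ≈ 0 -> h ≈ 0.

Lemma hsub0 (X Y : C) (f g : X ~> Y) : f + - g ≈ 0 -> f ≈ g.
Proof.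
move=> H; apply: (@hadd_cancel _ _ _ (- g)).
by rewrite haddN haddC H; reflexivity.
Qed.

Lemma hsub0r (X Y : C) (f g : X ~> Y) : f ≈ g -> f + - g ≈ 0.
Proof. by move=> ->; rewrite haddNr; reflexivity. Qed.

Lemma monoP (X Y : C) (m : X ~> Y) : is_mono m ->
  forall (Z : C) (h k : Z ~> X), m ∘ h ≈ m ∘ k -> h ≈ k.
Proof.
move=> Hm Z h k E; apply: hsub0; apply: Hm.
by rewrite comp_addr comp_oppr; apply: hsub0r.
Qed.

Lemma epi_id (X : C) : is_epi (idm X).
Proof. by move=> Z h; rewrite comp_idr. Qed.

Lemma epi_comp (X Y Z : C) (f : Y ~> Z) (g : X ~> Y) :
  is_epi f -> is_epi g -> is_epi (f ∘ g).
Proof. by move=> Hf Hg V h; rewrite compA => /Hg /Hf. Qed.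

Lemma coker_pr_epi (X Y : C) (f : X ~> Y) (c : Cokernel f) : is_epi (coker_pr c).
Proof. by move=> Z h E; apply: (coker_epi c); rewrite E comp0l; reflexivity. Qed.

Lemma is_iso_epi (X Y : C) (f : X ~> Y) : is_iso f -> is_epi f.
Proof.
move=> [g [gK Kg]] Z h E.
by rewrite -[h]comp_idr -Kg compA E comp0l; reflexivity.
Qed.

Lemma is_iso_mono (X Y : C) (f : X ~> Y) : is_iso f -> is_mono f.
Proof.
move=> [g [gK Kg]] Z h E.
by rewrite -[h]comp_idl -gK -compA E comp0r; reflexivity.
Qed.

End Epi.

Section AbelianTheory.
Context {A : AbelianCat}.

Lemma im_factor (X Y : A) (f : X ~> Y) :
  f ≈ ker_inc (ker (coker_pr (coker f))) ∘
      (coim_im_map (coker (ker_inc (ker f))) (ker (coker_pr (coker f))) ∘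
       coker_pr (coker (ker_inc (ker f)))).
Proof. by rewrite compA ker_liftK coker_descK; reflexivity. Qed.

Lemma coker_pr_iso (X Y : A) (f : X ~> Y) (c : Cokernel f) :
  f ≈ 0 -> is_iso (coker_pr c).
Proof.
move=> f0; have E : idm Y ∘ f ≈ 0 by rewrite comp_idl.
exists (coker_desc c E); split; first exact: coker_descK.
apply: (coker_epi c); rewrite -compA coker_descK comp_idl comp_idr; reflexivity.
Qed.

Lemma ker_inc_iso (X Y : A) (f : X ~> Y) (k : Kernel f) :
  f ≈ 0 -> is_iso (ker_inc k).
Proof.
move=> f0; have E : f ∘ idm X ≈ 0 by rewrite comp_idr.
exists (ker_lift k E); split; last exact: ker_liftK.
apply: (ker_mono k); rewrite compA ker_liftK comp_idl comp_idr; reflexivity.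
Qed.

(** In the factorization through coimage and image, the outer maps are a cokernel and a kernel of
    zero morphisms, hence isomorphisms. *)
Lemma mono_epi_iso (X Y : A) (f : X ~> Y) : is_mono f -> is_epi f -> is_iso f.
Proof.
move=> Hm He; apply: is_iso_heq (symmetry (im_factor f)) _.
apply: is_iso_comp; first by apply: ker_inc_iso; apply: He; exact: coker_zero.
apply: is_iso_comp; first exact: coim_im.
by apply: coker_pr_iso; apply: Hm; exact: ker_zero.
Qed.

(** An epimorphism is the cokernel of its kernel: its image inclusion is invertible, so its target
    is identified with its coimage. *)
Lemma epi_desc (X Y Z : A) (q : X ~> Y) (h : X ~> Z) :
  is_epi q -> h ∘ ker_inc (ker q) ≈ 0 -> exists m : Y ~> Z, m ∘ q ≈ h.
Proof.
move=> Hq Hh.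
have Hi : is_iso (ker_inc (ker (coker_pr (coker q)))).
  by apply: ker_inc_iso; apply: Hq; exact: coker_zero.
have [g [gK _]] := is_iso_comp Hi (coim_im q).
exists (coker_desc (coker (ker_inc (ker q))) Hh ∘ g).
apply: (transitivity (comp_proper (reflexivity _) (im_factor q))).
rewrite -compA [ker_inc _ ∘ _]compA [g ∘ _]compA gK comp_idl coker_descK.
by reflexivity.
Qed.

(* Epimorphisms are stable under pullback: a generalized element of the target
   lifts after refinement of its domain along an epimorphism. *)
Lemma epi_lift (X Y V : A) (p : X ~> Y) (z : V ~> Y) : is_epi p ->
  exists (W : A) (e : W ~> V) (y : W ~> X), is_epi e /\ p ∘ y ≈ z ∘ e.
Proof.
move=> Hp; pose b := biprod X V.
(* The kernel of [q] is the pullback of [p] and [z], and [q] is epi because [p] is. *)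
pose q := p ∘ bp_prl b + - (z ∘ bp_prr b).
have qr : q ∘ bp_inr b ≈ - z.
  by rewrite /q; push; rewrite bp_lr bp_rr comp_idr comp0r hadd0; reflexivity.
have ql : q ∘ bp_inl b ≈ p.
  rewrite /q; push; rewrite bp_ll bp_rl comp_idr comp0r hopp0 hadd0r.
  by reflexivity.
have Hq : is_epi q.
  by move=> Z h E; apply: Hp; rewrite -ql compA E comp0l; reflexivity.
exists (ker q : A), (bp_prr b ∘ ker_inc (ker q)), (bp_prl b ∘ ker_inc (ker q)).
split; last first.
  have := ker_zero (ker q); rewrite {1}/q; push => E.
  exact: hsub0.
(* The projection to [V] is epi: if [h] kills it, then [h ∘ bp_prr b] descends along [q] to some [m]
   with [m ∘ p] zero, so [m] vanishes, and with it [h], which is [h ∘ bp_prr b] restricted to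
   [V]. *)
move=> Z h; rewrite compA => /(epi_desc Hq) [m E].
have m0 : m ≈ 0.
  apply: Hp; rewrite -ql compA E -compA bp_rl comp0r; reflexivity.
rewrite -[h]comp_idr -(bp_rr b) compA -E m0 !comp0l; reflexivity.
Qed.

(** Exactness at the target of [f]: [y] factors through the image, onto which the source of [f] maps
    epimorphically. *)
Lemma coker_exact (X Y V : A) (f : X ~> Y) (y : V ~> Y) :
  coker_pr (coker f) ∘ y ≈ 0 ->
  exists (W : A) (e : W ~> V) (x : W ~> X), is_epi e /\ f ∘ x ≈ y ∘ e.
Proof.
move=> E; pose k := ker (coker_pr (coker f)).
have Hp := epi_comp (is_iso_epi (coim_im f))
  (@coker_pr_epi _ _ _ _ (coker (ker_inc (ker f)))).
have [W [e [x [He Ex]]]] := epi_lift (ker_lift k E) Hp.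
exists W, e, x; split=> //.
apply: (transitivity (comp_proper (im_factor f) (reflexivity _))).
by rewrite -compA Ex compA ker_liftK; reflexivity.
Qed.

End AbelianTheory.

(** * Quasi-isomorphisms in terms of generalized elements *)

Section HomologyElements.
Context {A : AbelianCat}.

(* Injectivity and surjectivity on cohomology, in terms of generalized elements. *)
Definition homology_inj (X Y Z X' Y' : A) (f : X ~> Y) (g : Y ~> Z)
    (f' : X' ~> Y') (b : Y ~> Y') : Prop :=
  forall (V : A) (y : V ~> Y) (x' : V ~> X'), g ∘ y ≈ 0 -> b ∘ y ≈ f' ∘ x' ->
  exists (W : A) (e : W ~> V) (x : W ~> X), is_epi e /\ f ∘ x ≈ y ∘ e.

Definition homology_surj (Y Z X' Y' Z' : A) (g : Y ~> Z)
    (f' : X' ~> Y') (g' : Y' ~> Z') (b : Y ~> Y') : Prop :=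
  forall (V : A) (y' : V ~> Y'), g' ∘ y' ≈ 0 ->
  exists (W : A) (e : W ~> V) (y : W ~> Y) (x' : W ~> X'),
    [/\ is_epi e, g ∘ y ≈ 0 & b ∘ y ≈ y' ∘ e + f' ∘ x'].

(** Cocycles map epimorphically onto homology, and a cocycle of class zero is a boundary after
    refinement. The criterion depends neither on [a] and [c] nor on the proofs [e] and [e'], so it
    carries over between homology objects that are built differently. *)
Lemma homology_isoP (X Y Z X' Y' Z' : A) (f : X ~> Y) (g : Y ~> Z)
    (f' : X' ~> Y') (g' : Y' ~> Z') (e : g ∘ f ≈ 0) (e' : g' ∘ f' ≈ 0)
    (a : X ~> X') (b : Y ~> Y') (c : Z ~> Z')
    (Hf : b ∘ f ≈ f' ∘ a) (Hg : c ∘ g ≈ g' ∘ b) :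
  is_iso (homology_map e e' Hf Hg) <->
  homology_inj f g f' b /\ homology_surj g f' g' b.
Proof.
pose p := coker_pr (coker (ker_lift (ker g) e)).
pose p' := coker_pr (coker (ker_lift (ker g') e')).
have Hp : is_epi p by apply: coker_pr_epi.
have Hp' : is_epi p' by apply: coker_pr_epi.
have HE : homology_map e e' Hf Hg ∘ p ≈ p' ∘ cycle_map Hg by apply: coker_descK.
have iK : ker_inc (ker g') ∘ cycle_map Hg ≈ b ∘ ker_inc (ker g) by apply: ker_liftK.
split.
  move=> Hiso; split.
    move=> V y x' gy by_.
    pose z := ker_lift (ker g) gy.
    have zE : cycle_map Hg ∘ z ≈ ker_lift (ker g') e' ∘ x'.
      apply: ker_mono; rewrite !compA iK ker_liftK -by_ -compA ker_liftK.
      by reflexivity.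
    have : p ∘ z ≈ 0.
      apply: (is_iso_mono Hiso); rewrite compA HE -compA zE compA.
      by rewrite /p' coker_zero comp0l; reflexivity.
    move/coker_exact => [W [d [x [Hd Ex]]]]; exists W, d, x; split=> //.
    rewrite -(ker_liftK (ker g) e) -compA Ex compA ker_liftK; reflexivity.
  move=> V y' gy'; pose z' := ker_lift (ker g') gy'.
  case: (Hiso) => h [hK Kh].
  have [W [d [z [Hd Ez]]]] := epi_lift (h ∘ (p' ∘ z')) Hp.
  (* [z] represents the preimage of the class of [y']; its image and [y'] have the same class, so
     they differ by a boundary. *)
  have : p' ∘ (cycle_map Hg ∘ z + - (z' ∘ d)) ≈ 0.
    push; rewrite compA -HE -compA Ez !compA Kh comp_idl haddNr; reflexivity.
  move/coker_exact => [W' [d' [x' [Hd' Ex']]]].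
  exists W', (d ∘ d'), (ker_inc (ker g) ∘ (z ∘ d')), x'; split.
  - exact: epi_comp.
  - by rewrite compA ker_zero comp0l; reflexivity.
  - rewrite -{1}(ker_liftK (ker g') e') -compA Ex' compA -iK.
    rewrite -[y'](ker_liftK (ker g') gy') -/z'; push; abel.
move=> [Hi Hs]; apply: mono_epi_iso.
- move=> V h Eh; have [W [d [z [Hd Ez]]]] := epi_lift h Hp.
  have : p' ∘ (cycle_map Hg ∘ z) ≈ 0.
    by rewrite compA -HE -compA Ez compA Eh comp0l; reflexivity.
  move/coker_exact => [W' [d' [x' [Hd' Ex']]]].
  have [] := Hi W' (ker_inc (ker g) ∘ (z ∘ d')) x'.
  + by rewrite compA ker_zero comp0l; reflexivity.
  + rewrite compA -iK -!compA [cycle_map _ ∘ _]compA -Ex' compA ker_liftK.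
    by reflexivity.
  move=> W'' [d'' [x [Hd'' Ex]]].
  apply: (Hd); apply: (Hd'); apply: (Hd'').
  have E : ker_lift (ker g) e ∘ x ≈ z ∘ d' ∘ d''.
    by apply: ker_mono; rewrite !compA ker_liftK Ex !compA; reflexivity.
  by rewrite -Ez -!compA [z ∘ _]compA -E compA /p coker_zero comp0l; reflexivity.
- move=> V h Eh; apply: Hp'.
  (* Surjectivity is applied to the universal cocycle, the inclusion of the kernel of [g']. *)
  have [W [d [y [x' [Hd Ey Eb]]]]] := Hs _ (ker_inc (ker g')) (ker_zero _).
  apply: Hd.
  have E : cycle_map Hg ∘ ker_lift (ker g) Ey ≈ d + ker_lift (ker g') e' ∘ x'.
    apply: ker_mono; rewrite compA iK -compA ker_liftK Eb; push.
    by rewrite [ker_inc _ ∘ (ker_lift _ _ ∘ _)]compA ker_liftK; reflexivity.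
  have : h ∘ (p' ∘ (d + ker_lift (ker g') e' ∘ x')) ≈ 0.
    by rewrite -E [p' ∘ _]compA -HE !compA Eh !comp0l; reflexivity.
  push; rewrite [p' ∘ (ker_lift _ _ ∘ _)]compA /p' coker_zero comp0l comp0r hadd0r.
  by [].
Qed.

Definition cohomology_inj (X Y : ComplexCat A) (f : X ~> Y) : Prop :=
  forall n, homology_inj (cd X n) (cd X (isucc n)) (cd Y n) (cm f (isucc n)).

Definition cohomology_surj (X Y : ComplexCat A) (f : X ~> Y) : Prop :=
  forall n, homology_surj (cd X (isucc n)) (cd Y n) (cd Y (isucc n)) (cm f (isucc n)).

Lemma quasi_isoP (X Y : ComplexCat A) (f : X ~> Y) :
  quasi_iso f <-> cohomology_inj f /\ cohomology_surj f.
Proof.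
split=> [H|[Hi Hs] n]; last by apply/homology_isoP; split; [apply: Hi|apply: Hs].
by split=> n; have /homology_isoP[] := H n.
Qed.

End HomologyElements.

(** * Mapping cones *)

Section Pairs.
Context {A : PreadditiveCat} {X Y : A} (b : Biproduct X Y).

Definition bp_pair (V : A) (f : V ~> X) (g : V ~> Y) : V ~> b :=
  bp_inl b ∘ f + bp_inr b ∘ g.

Lemma bp_fst (V : A) (f : V ~> X) (g : V ~> Y) : bp_prl b ∘ bp_pair f g ≈ f.
Proof. by rewrite comp_addr bp_llK bp_lrK hadd0r; reflexivity. Qed.

Lemma bp_snd (V : A) (f : V ~> X) (g : V ~> Y) : bp_prr b ∘ bp_pair f g ≈ g.
Proof. by rewrite comp_addr bp_rlK bp_rrK hadd0; reflexivity. Qed.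

Lemma bp_ext (V : A) (h k : V ~> b) :
  bp_prl b ∘ h ≈ bp_prl b ∘ k -> bp_prr b ∘ h ≈ bp_prr b ∘ k -> h ≈ k.
Proof.
move=> El Er; rewrite -[h]comp_idl -[k]comp_idl -(bp_sum b) !comp_addl -!compA.
by rewrite El Er; reflexivity.
Qed.

Lemma bp_coext (V : A) (h k : b ~> V) :
  h ∘ bp_inl b ≈ k ∘ bp_inl b -> h ∘ bp_inr b ≈ k ∘ bp_inr b -> h ≈ k.
Proof.
move=> El Er; rewrite -[h]comp_idr -[k]comp_idr -(bp_sum b) !comp_addr !compA.
by rewrite El Er; reflexivity.
Qed.

End Pairs.

Section ComplexTheory.
Context {A : PreadditiveCat}.

Lemma cm_commK (X Y : ComplexCat A) (f : X ~> Y) n (V : A) (x : V ~> cx X n) :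
  cd Y n ∘ (cm f n ∘ x) ≈ cm f (isucc n) ∘ (cd X n ∘ x).
Proof. by rewrite !compA cm_comm; reflexivity. Qed.

Lemma complex_iso (X Y : ComplexCat A) (f : X ~> Y) :
  (forall n, is_iso (cm f n)) -> is_iso f.
Proof.
move=> H; pose g n := constructive_indefinite_description _ (H n).
have gC n : sval (g (isucc n)) ∘ cd Y n ≈ cd X n ∘ sval (g n).
  case: (g n) (g (isucc n)) => h [/= hK Kh] [k [/= kK Kk]].
  rewrite -[k ∘ _]comp_idr -Kh -compA cm_commK !compA kK comp_idl.
  by reflexivity.
exists {| cm_comm := gC |}; split=> n /=; case: (g n) => h [/= hK Kh].
  exact: hK.
exact: Kh.
Qed.

End ComplexTheory.

Section ConeElements.
Context {A : AbelianCat} {X Y : ComplexCat A} (u : X ~> Y).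

(** Named copies of the structure maps of the biproduct, made opaque after this section:
    computations in a cone then use only the equations for components and for the differential. *)
Definition cone_fst n : cx (cone u) n ~> cx X (isucc n) := bp_prl _.
Definition cone_snd n : cx (cone u) n ~> cx Y n := bp_prr _.
Definition cone_pair n (V : A) (x : V ~> cx X (isucc n)) (y : V ~> cx Y n) :
  V ~> cx (cone u) n := bp_pair _ x y.

Lemma cone_fst_pair n (V : A) (x : V ~> cx X (isucc n)) (y : V ~> cx Y n) :
  cone_fst n ∘ cone_pair x y ≈ x.
Proof. exact: bp_fst. Qed.

Lemma cone_snd_pair n (V : A) (x : V ~> cx X (isucc n)) (y : V ~> cx Y n) :
  cone_snd n ∘ cone_pair x y ≈ y.
Proof. exact: bp_snd. Qed.

Lemma cone_ext n (V : A) (h k : V ~> cx (cone u) n) :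
  cone_fst n ∘ h ≈ cone_fst n ∘ k -> cone_snd n ∘ h ≈ cone_snd n ∘ k -> h ≈ k.
Proof. exact: bp_ext. Qed.

Lemma cone_fst_d n (V : A) (x : V ~> cx (cone u) n) :
  cone_fst (isucc n) ∘ (cd (cone u) n ∘ x) ≈ - (cd X (isucc n) ∘ (cone_fst n ∘ x)).
Proof.
rewrite /= comp_addl comp_addr -!compA bp_llK bp_lrK comp_oppl hadd0r.
by reflexivity.
Qed.

Lemma cone_snd_d n (V : A) (x : V ~> cx (cone u) n) :
  cone_snd (isucc n) ∘ (cd (cone u) n ∘ x) ≈
  cm u (isucc n) ∘ (cone_fst n ∘ x) + cd Y n ∘ (cone_snd n ∘ x).
Proof.
rewrite /= comp_addl comp_addr -!compA bp_rlK bp_rrK hadd0 comp_addl -!compA.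
by reflexivity.
Qed.

Definition cone_inl n : cx X (isucc n) ~> cx (cone u) n := bp_inl _.
Definition cone_inr n : cx Y n ~> cx (cone u) n := bp_inr _.

Lemma cone_fst_inl n : cone_fst n ∘ cone_inl n ≈ idm _.
Proof. exact: bp_ll. Qed.

Lemma cone_snd_inl n : cone_snd n ∘ cone_inl n ≈ 0.
Proof. exact: bp_rl. Qed.

Lemma cone_fst_inr n : cone_fst n ∘ cone_inr n ≈ 0.
Proof. exact: bp_lr. Qed.

Lemma cone_snd_inr n : cone_snd n ∘ cone_inr n ≈ idm _.
Proof. exact: bp_rr. Qed.

Lemma cone_fst_inlK n (V : A) (x : V ~> cx X (isucc n)) :
  cone_fst n ∘ (cone_inl n ∘ x) ≈ x.
Proof. exact: bp_llK. Qed.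

Lemma cone_snd_inlK n (V : A) (x : V ~> cx X (isucc n)) :
  cone_snd n ∘ (cone_inl n ∘ x) ≈ 0.
Proof. exact: bp_rlK. Qed.

Lemma cone_fst_inrK n (V : A) (x : V ~> cx Y n) : cone_fst n ∘ (cone_inr n ∘ x) ≈ 0.
Proof. exact: bp_lrK. Qed.

Lemma cone_snd_inrK n (V : A) (x : V ~> cx Y n) : cone_snd n ∘ (cone_inr n ∘ x) ≈ x.
Proof. exact: bp_rrK. Qed.

Lemma cone_inl_inr n : cone_inl n ∘ cone_fst n + cone_inr n ∘ cone_snd n ≈ idm _.
Proof. exact: bp_sum. Qed.

Lemma cone_inE n : cm (cone_in u) n ≈ cone_inr n.
Proof. by reflexivity. Qed.

Lemma cone_outE n : cm (cone_out u) n ≈ cone_fst n.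
Proof. by reflexivity. Qed.

Lemma cone_d_inl n : cd (cone u) n ∘ cone_inl n ≈
  - (cone_inl (isucc n) ∘ cd X (isucc n)) + cone_inr (isucc n) ∘ cm u (isucc n).
Proof.
rewrite /= comp_addl -!compA comp_addl -!compA bp_ll bp_rl !comp0r.
by rewrite !comp_idr hadd0r comp_oppr; reflexivity.
Qed.

Lemma cone_d_inr n : cd (cone u) n ∘ cone_inr n ≈ cone_inr (isucc n) ∘ cd Y n.
Proof. by symmetry; exact: (cm_comm (cone_in u) n). Qed.

End ConeElements.

#[local] Opaque cone_fst cone_snd cone_pair cone_inl cone_inr.

Section ConeMap.
Context {A : AbelianCat} {X Y X' Y' : ComplexCat A} (u : X ~> Y) (u' : X' ~> Y')
  (a : X ~> X') (b : Y ~> Y') (H : b ∘ u ≈ u' ∘ a).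

Definition cone_map_cm n : cx (cone u) n ~> cx (cone u') n :=
  cone_pair u' (cm a (isucc n) ∘ cone_fst u n) (cm b n ∘ cone_snd u n).

Lemma cone_map_fst n : cone_fst u' n ∘ cone_map_cm n ≈ cm a (isucc n) ∘ cone_fst u n.
Proof. exact: cone_fst_pair. Qed.

Lemma cone_map_snd n : cone_snd u' n ∘ cone_map_cm n ≈ cm b n ∘ cone_snd u n.
Proof. exact: cone_snd_pair. Qed.

Lemma cone_map_fstK n (V : A) (x : V ~> cx (cone u) n) :
  cone_fst u' n ∘ (cone_map_cm n ∘ x) ≈ cm a (isucc n) ∘ (cone_fst u n ∘ x).
Proof. by rewrite !compA cone_map_fst; reflexivity. Qed.

Lemma cone_map_sndK n (V : A) (x : V ~> cx (cone u) n) :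
  cone_snd u' n ∘ (cone_map_cm n ∘ x) ≈ cm b n ∘ (cone_snd u n ∘ x).
Proof. by rewrite !compA cone_map_snd; reflexivity. Qed.

Lemma cone_map_sqK n (V : A) (x : V ~> cx X n) :
  cm b n ∘ (cm u n ∘ x) ≈ cm u' n ∘ (cm a n ∘ x).
Proof. by have E := H n; rewrite !compA; apply: comp_proper; [exact: E | reflexivity]. Qed.

Lemma cone_map_comm n :
  cone_map_cm (isucc n) ∘ cd (cone u) n ≈ cd (cone u') n ∘ cone_map_cm n.
Proof.
rewrite -[cd (cone u) n]comp_idr; apply: cone_ext.
- rewrite cone_map_fstK !cone_fst_d cone_map_fst !comp_idr comp_oppr cm_commK.
  by reflexivity.
- rewrite cone_map_sndK !cone_snd_d cone_map_fst cone_map_snd !comp_idr comp_addr.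
  rewrite cm_commK cone_map_sqK; reflexivity.
Qed.

Definition cone_map : cone u ~> cone u' := Build_ChainMap cone_map_comm.

(** The five lemma for the long exact sequences of the two cones, unrolled into a chase of
    generalized elements. *)
Lemma cone_map_quasi_iso : quasi_iso a -> quasi_iso b -> quasi_iso cone_map.
Proof.
move=> /quasi_isoP[ia sa] /quasi_isoP[ib sb]; apply/quasi_isoP; split=> n.
- move=> V x p dx Ex.
  pose x1 := cone_fst u _ ∘ x; pose x2 := cone_snd u _ ∘ x.
  pose p1 := cone_fst u' _ ∘ p; pose p2 := cone_snd u' _ ∘ p.
  have [e1 e2] : cone_fst u _ ∘ x ≈ x1 /\ cone_snd u _ ∘ x ≈ x2 by split; reflexivity.
  have h1 : cd X _ ∘ x1 ≈ 0.
    by rewrite -[cd X _ ∘ _]hoppK -cone_fst_d dx comp0r hopp0; reflexivity.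
  have h2 : cm u _ ∘ x1 + cd Y _ ∘ x2 ≈ 0.
    by rewrite -cone_snd_d dx comp0r; reflexivity.
  have h3 : cm a _ ∘ x1 ≈ cd X' _ ∘ (- p1).
    rewrite comp_oppr -cone_fst_d -Ex cone_map_fstK; reflexivity.
  have h4 : cm b _ ∘ x2 ≈ cm u' _ ∘ p1 + cd Y' _ ∘ p2.
    rewrite -cone_snd_d -Ex cone_map_sndK; reflexivity.
  clearbody x1 x2 p1 p2.
  have [W [e [x' [He Ex']]]] := ia _ _ _ _ h1 h3.
  (* [x'] bounds the first component of [x], but its image under [a] need not be [- p1]. The
     discrepancy is a cocycle, which surjectivity of [a] on cohomology removes up to the boundary of
     [q]. *)
  have [|W2 [f [x'' [q [Hf dx'' Ex'']]]]] := sa n _ (cm a _ ∘ x' + p1 ∘ e).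
    by rewrite comp_addr cm_commK Ex'; apply: (lin (precomp e h3)); push; abel.
  pose x3 := x' ∘ f + - x''.
  have dx3 : cd X _ ∘ x3 ≈ x1 ∘ (e ∘ f).
    by rewrite /x3; push; rewrite dx'' compA Ex' -compA; abel.
  have ax3 : cm a _ ∘ x3 ≈ - (p1 ∘ (e ∘ f)) + - (cd X' _ ∘ q).
    by rewrite /x3; push; rewrite Ex''; push; abel.
  clearbody x3.
  (* Once [x3] bounds the first component, [x2 + u x3] is a cocycle whose image bounds [p2 - u' q];
     injectivity of [b] supplies the second component of the bounding element. *)
  have [||W3 [g [y' [Hg Ey']]]] :=
      ib n _ (x2 ∘ (e ∘ f) + cm u _ ∘ x3) (p2 ∘ (e ∘ f) + - (cm u' _ ∘ q)).
  + rewrite comp_addr cm_commK dx3.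
    by apply: (lin (precomp (e ∘ f) h2)); push; abel.
  + rewrite !comp_addr cone_map_sqK ax3.
    by apply: (lin (precomp (e ∘ f) h4)); push; rewrite cm_commK; abel.
  exists W3, (e ∘ (f ∘ g)), (cone_pair u (- (x3 ∘ g)) y'); split.
    by do 2 ?apply: epi_comp.
  apply: cone_ext.
  + rewrite cone_fst_d cone_fst_pair compA e1.
    by apply: (lin (precomp g dx3)); push; abel.
  + by rewrite cone_snd_d cone_fst_pair cone_snd_pair Ey' [cone_snd _ _ ∘ _]compA e2; push; abel.
- move=> V p dp.
  pose p1 := cone_fst u' _ ∘ p; pose p2 := cone_snd u' _ ∘ p.
  have [e1 e2] : cone_fst u' _ ∘ p ≈ p1 /\ cone_snd u' _ ∘ p ≈ p2 by split; reflexivity.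
  have h1 : cd X' _ ∘ p1 ≈ 0.
    by rewrite -[cd X' _ ∘ _]hoppK -cone_fst_d dp comp0r hopp0; reflexivity.
  have h2 : cm u' _ ∘ p1 + cd Y' _ ∘ p2 ≈ 0.
    by rewrite -cone_snd_d dp comp0r; reflexivity.
  clearbody p1 p2.
  have [W [e [x [p' [He dx Ex]]]]] := sa _ _ _ h1.
  (* [b] sends the cocycle [u x] to a boundary, so [u x] is itself the boundary of some [y1], and
     [(x, - y1)] is a cocycle of the cone that lifts the first component. *)
  have [||W1 [f [y1 [Hf Ey1]]]] := ib (isucc n) _ (cm u _ ∘ x) (- (p2 ∘ e) + cm u' _ ∘ p').
  + by rewrite cm_commK dx comp0r; reflexivity.
  + rewrite cone_map_sqK Ex; apply: (lin (precomp e h2)); push.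
    by rewrite cm_commK; abel.
  (* What remains of the second component is a cocycle of [Y'], hence comes from [Y] up to a
     boundary. *)
  have [|W2 [g [y [q [Hg dy Ey]]]]] :=
      sb n _ (p2 ∘ (e ∘ f) + - (cm u' _ ∘ (p' ∘ f)) + cm b _ ∘ y1).
    push; rewrite !cm_commK Ey1 -[_ ∘ x ∘ f]compA cone_map_sqK [cm a _ ∘ _]compA Ex.
    by apply: (lin (precomp (e ∘ f) h2)); push; abel.
  exists W2, (e ∘ (f ∘ g)), (cone_pair u (x ∘ (f ∘ g)) (y + - (y1 ∘ g))).
  exists (cone_pair u' (- (p' ∘ (f ∘ g))) q); split.
  + by do 2 ?apply: epi_comp.
  + apply: cone_ext.
    * by rewrite cone_fst_d cone_fst_pair; push; rewrite compA dx; push; abel.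
    * rewrite cone_snd_d cone_fst_pair cone_snd_pair comp_addr dy.
      by apply: (lin (symmetry (precomp g Ey1))); push; abel.
  + apply: cone_ext.
    * rewrite cone_map_fstK cone_fst_pair comp_addr cone_fst_d cone_fst_pair.
      rewrite [cone_fst _ _ ∘ _]compA e1.
      by apply: (lin (precomp (f ∘ g) Ex)); push; abel.
    * rewrite cone_map_sndK cone_snd_pair [cone_snd _ _ ∘ _]comp_addr.
      rewrite cone_snd_d cone_fst_pair cone_snd_pair [cone_snd _ _ ∘ _]compA e2.
      by rewrite comp_addr Ey; push; abel.
Qed.

End ConeMap.

(** * Equivalences and localizations *)

Section NatIso.

Lemma nat_iso_inv (C D : Category) (F G : Functor C D) : nat_iso F G -> nat_iso G F.
Proof.
move=> [a Ha]; pose b X := constructive_indefinite_description _ (Ha X).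
have bN (X Y : C) (f : X ~> Y) :
    sval (b Y) ∘ fmap G f ≈ fmap F f ∘ sval (b X).
  case: (b X) (b Y) => g [/= gK Kg] [h [/= hK Kh]].
  rewrite -[h ∘ fmap G f]comp_idr -Kg compA -[h ∘ _ ∘ _]compA -nt_nat.
  by rewrite compA hK comp_idl; reflexivity.
exists {| nt_nat := bN |} => X /=; exists (a X).
by case: (b X) => g [/= gK Kg].
Qed.

Lemma nat_iso_trans (C D : Category) (F G H : Functor C D) :
  nat_iso F G -> nat_iso G H -> nat_iso F H.
Proof.
move=> [a Ha] [b Hb].
by exists (comp (c := FunctorCat C D) b a) => X; apply: is_iso_comp.
Qed.

Program Definition whisker_left (C D E : Category) (H : Functor D E)
    (F G : Functor C D) (a : NatTrans F G) :
    NatTrans (functor_comp H F) (functor_comp H G) :=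
  {| nt X := fmap H (a X) |}.
Next Obligation. by move=> *; rewrite -!fmap_comp nt_nat; reflexivity. Qed.

Program Definition whisker_right (C D E : Category) (F G : Functor D E)
    (a : NatTrans F G) (H : Functor C D) :
    NatTrans (functor_comp F H) (functor_comp G H) :=
  {| nt X := a (H X) |}.
Next Obligation. by move=> *; apply: nt_nat. Qed.

Lemma nat_iso_whisker_left (C D E : Category) (H : Functor D E) (F G : Functor C D) :
  nat_iso F G -> nat_iso (functor_comp H F) (functor_comp H G).
Proof. by move=> [a Ha]; exists (whisker_left H a) => X; exact: (is_iso_fmap H (Ha X)). Qed.

Lemma nat_iso_whisker_right (C D E : Category) (F G : Functor D E) (H : Functor C D) :
  nat_iso F G -> nat_iso (functor_comp F H) (functor_comp G H).
Proof. by move=> [a Ha]; exists (whisker_right a H) => X; apply: Ha. Qed.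

Program Definition nat_assoc (B C D E : Category) (H : Functor D E)
    (G : Functor C D) (F : Functor B C) :
    NatTrans (functor_comp H (functor_comp G F)) (functor_comp (functor_comp H G) F) :=
  {| nt X := idm _ |}.
Next Obligation. by move=> *; rewrite comp_idl comp_idr; reflexivity. Qed.

Lemma nat_iso_assoc (B C D E : Category) (H : Functor D E)
    (G : Functor C D) (F : Functor B C) :
  nat_iso (functor_comp H (functor_comp G F)) (functor_comp (functor_comp H G) F).
Proof. by exists (nat_assoc H G F) => X; apply: is_iso_id. Qed.

Program Definition nat_idl (C D : Category) (F : Functor C D) :
    NatTrans (functor_comp (functor_id D) F) F := {| nt X := idm _ |}.
Next Obligation. by move=> *; rewrite comp_idl comp_idr; reflexivity. Qed.

Program Definition nat_idr (C D : Category) (F : Functor C D) :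
    NatTrans (functor_comp F (functor_id C)) F := {| nt X := idm _ |}.
Next Obligation. by move=> *; rewrite comp_idl comp_idr; reflexivity. Qed.

Lemma nat_iso_idl (C D : Category) (F : Functor C D) :
  nat_iso (functor_comp (functor_id D) F) F.
Proof. by exists (nat_idl F) => X; apply: is_iso_id. Qed.

Lemma nat_iso_idr (C D : Category) (F : Functor C D) :
  nat_iso (functor_comp F (functor_id C)) F.
Proof. by exists (nat_idr F) => X; apply: is_iso_id. Qed.

(** As for one-sided inverses in a monoid: [L] is isomorphic to [L F R], and this to [R]. *)
Lemma equivalence_of_inverses (C D : Category) (F : Functor C D) (L R : Functor D C) :
  nat_iso (functor_comp L F) (functor_id C) ->
  nat_iso (functor_comp F R) (functor_id D) -> is_equivalence F.
Proof.
move=> LF FR; exists R; split=> //; apply: nat_iso_trans (LF).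
apply: nat_iso_whisker_right; apply: nat_iso_trans (nat_iso_idr L).
apply: nat_iso_trans (nat_iso_whisker_left L FR).
apply: nat_iso_inv; apply: nat_iso_trans (nat_iso_assoc _ _ _) _.
apply: nat_iso_trans (nat_iso_whisker_right R LF) (nat_iso_idl R).
Qed.

Lemma equivalence_comp (C D E : Category) (G : Functor D E) (F : Functor C D) :
  is_equivalence G -> is_equivalence F -> is_equivalence (functor_comp G F).
Proof.
have aux (C' D' E' : Category) (K : Functor D' E') (K' : Functor E' D')
    (H : Functor C' D') (H' : Functor D' C') :
    nat_iso (functor_comp K' K) (functor_id D') ->
    nat_iso (functor_comp H' H) (functor_id C') ->
    nat_iso (functor_comp (functor_comp H' K') (functor_comp K H)) (functor_id C').
  move=> KK HH; apply: nat_iso_trans HH.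
  apply: nat_iso_trans (nat_iso_inv (nat_iso_assoc _ _ _)) _.
  apply: nat_iso_whisker_left; apply: nat_iso_trans (nat_iso_assoc _ _ _) _.
  by apply: nat_iso_trans (nat_iso_whisker_right H KK) (nat_iso_idl H).
move=> [G' [GG GG']] [F' [FF FF']]; exists (functor_comp F' G'); split.
  exact: aux.
exact: aux.
Qed.

End NatIso.

Section LocalizationNat.
Context {C : Category} (W : forall X Y : C, X ~> Y -> Prop).

Lemma loc_mor_iso (X Y : C) (f : X ~> Y) : W f -> is_iso (fmap (loc_functor W) f).
Proof.
by move=> Wf; exists (loc_inv Wf); split; [apply: loc_invl | apply: loc_invr].
Qed.

(* Naturality in the localization only has to be checked on morphisms of [C]. *)
Lemma loc_nat (D : Category) (H K : Functor (Loc W) D)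
    (a : forall X : C, H X ~> K X) :
  (forall (X Y : C) (f : X ~> Y),
     a Y ∘ fmap H (loc_mor W f) ≈ fmap K (loc_mor W f) ∘ a X) ->
  forall (X Y : Loc W) (f : X ~> Y), a Y ∘ fmap H f ≈ fmap K f ∘ a X.
Proof.
move=> Ha X Y; elim=> {X Y} [X|X Y f|X Y s Ws|X Y Z g IHg f IHf].
- by rewrite !(fmap_id _ (X : Loc W)) comp_idl comp_idr; reflexivity.
- exact: Ha.
- have EH : fmap H (loc_mor W s) ∘ fmap H (loc_inv Ws : Hom (c := Loc W) Y X) ≈ idm _.
    by rewrite -fmap_comp -fmap_id; apply: fmap_proper; apply: loc_invr.
  have EK : fmap K (loc_inv Ws : Hom (c := Loc W) Y X) ∘ fmap K (loc_mor W s) ≈ idm _.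
    by rewrite -fmap_comp -fmap_id; apply: fmap_proper; apply: loc_invl.
  rewrite -[X in X ≈ _]comp_idl -EK -compA [fmap K (loc_mor W s) ∘ _]compA -Ha.
  by rewrite -[a Y ∘ _ ∘ _]compA EH comp_idr; reflexivity.
- rewrite (fmap_comp H (g : Hom (c := Loc W) Y Z) f) compA IHg -compA IHf.
  by rewrite (fmap_comp K (g : Hom (c := Loc W) Y Z) f) compA; reflexivity.
Qed.

Definition loc_nat_trans (D : Category) (H K : Functor (Loc W) D)
    (a : forall X : C, H X ~> K X)
    (Ha : forall (X Y : C) (f : X ~> Y),
     a Y ∘ fmap H (loc_mor W f) ≈ fmap K (loc_mor W f) ∘ a X) : NatTrans H K :=
  {| nt := (a : forall X : Loc W, H X ~> K X); nt_nat := loc_nat Ha |}.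

End LocalizationNat.

(** * Functors on complexes *)

Section Additive.
Context {C D : PreadditiveCat} (F : Functor C D).

Definition additive : Prop :=
  forall (X Y : C) (f g : X ~> Y), fmap F (f + g) ≈ fmap F f + fmap F g.

Hypothesis HF : additive.

Lemma additive0 (X Y : C) : fmap F (0 : X ~> Y) ≈ 0.
Proof.
apply: (@hadd_cancel _ _ _ (fmap F 0)).
by rewrite -HF hadd0 hadd0r; reflexivity.
Qed.

Lemma additiveN (X Y : C) (f : X ~> Y) : fmap F (- f) ≈ - fmap F f.
Proof. by apply: hopp_uniq; rewrite -HF haddNr additive0; reflexivity. Qed.

Program Definition map_complex (X : Complex C) : Complex D :=
  {| cx n := F (X n); cd n := fmap F (cd X n) |}.
Next Obligation. by move=> X n; rewrite -fmap_comp cdd additive0; reflexivity. Qed.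

Program Definition map_chain (X Y : Complex C) (f : ChainMap X Y) :
    ChainMap (map_complex X) (map_complex Y) := {| cm n := fmap F (cm f n) |}.
Next Obligation. by move=> X Y f n; rewrite -!fmap_comp cm_comm; reflexivity. Qed.

Program Definition complex_functor : Functor (ComplexCat C) (ComplexCat D) :=
  {| fob := map_complex : ComplexCat C -> ComplexCat D; fmap := map_chain |}.
Next Obligation. by move=> X Y f g H n; apply: fmap_proper; apply: H. Qed.
Next Obligation. by move=> X n; apply: fmap_id. Qed.
Next Obligation. by move=> X Y Z g f n; apply: fmap_comp. Qed.

End Additive.

Lemma additive_comp (C D E : PreadditiveCat) (G : Functor D E) (F : Functor C D) :
  additive G -> additive F -> additive (functor_comp G F).
Proof. by move=> HG HF X Y f g; rewrite /= HF HG; reflexivity. Qed.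

Program Definition complex_nat (C D : PreadditiveCat) (F G : Functor C D)
    (HF : additive F) (HG : additive G) (t : NatTrans F G) (X : ComplexCat C) :
    (complex_functor HF X : ComplexCat D) ~> complex_functor HG X :=
  {| cm n := t (cx X n) |}.
Next Obligation. by move=> *; apply: nt_nat. Qed.

Section Cohomology.
Context (A : AbelianCat).

Program Definition cohomology_functor (n : ssrint.int) : Functor (ComplexCat A) A :=
  {| fob X := cohomology X n; fmap X Y f := cohomology_map f n |}.
Next Obligation.
move=> n X Y f g E; apply: coker_epi; rewrite !coker_descK.
apply: postcomp; apply: ker_mono; rewrite !ker_liftK; apply: precomp; apply: E.
Qed.
Next Obligation.
move=> n X.
have E m : idm _ ∘ cd X m ≈ cd X m ∘ idm _ by rewrite comp_idl comp_idr; reflexivity.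
exact: homology_map_id.
Qed.
Next Obligation.
by move=> n X Y Z g f; symmetry; apply: homology_map_comp; reflexivity.
Qed.

Lemma iso_quasi_iso (X Y : ComplexCat A) (f : X ~> Y) : is_iso f -> quasi_iso f.
Proof. by move=> Hf n; apply: (is_iso_fmap (cohomology_functor n)). Qed.

Lemma quasi_iso_comp (X Y Z : ComplexCat A) (g : Y ~> Z) (f : X ~> Y) :
  quasi_iso g -> quasi_iso f -> quasi_iso (g ∘ f).
Proof.
move=> Hg Hf n.
apply: is_iso_heq (symmetry (fmap_comp (cohomology_functor n) g f)) _.
by apply: is_iso_comp; [apply: Hg | apply: Hf].
Qed.

Lemma quasi_iso_heq (X Y : ComplexCat A) (f g : X ~> Y) :
  f ≈ g -> quasi_iso f -> quasi_iso g.
Proof.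
move=> E Hf n; apply: is_iso_heq (Hf n).
exact: (fmap_proper (cohomology_functor n) E).
Qed.

Lemma quasi_iso_unshift (X Y : ComplexCat A) (f : X ~> Y) :
  quasi_iso (fmap (shift_functor A) f) -> quasi_iso f.
Proof.
have predK n : isucc (n + -1)%R = n by rewrite /isucc; apply: GRing.subrK.
move=> /quasi_isoP[Hi Hs]; apply/quasi_isoP.
(* Cohomology of [f] at [n] is that of its shift at [n - 1], so [n] is written as a successor. The
   sign of the shifted differential is absorbed by negating the boundary witness. *)
split=> n; rewrite -(predK n); move: (n + -1)%R => m.
- move=> V x y dx Ex.
  have [||W [e [x' [He Ex']]]] := Hi m V x (- y).
  + by rewrite /= comp_oppl dx hopp0; reflexivity.
  + by rewrite /= comp_oppl comp_oppr hoppK; exact: Ex.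
  exists W, e, (- x'); split=> //.
  by rewrite comp_oppr -comp_oppl; exact: Ex'.
- move=> V y dy.
  have [|W [e [x [y' [He dx Ex]]]]] := Hs m V y.
    by rewrite /= comp_oppl dy hopp0; reflexivity.
  exists W, e, x, (- y'); split=> //.
    by rewrite -[_ ∘ _]hoppK -comp_oppl (dx : - _ ∘ _ ≈ _) hopp0; reflexivity.
  by rewrite comp_oppr -comp_oppl; exact: Ex.
Qed.

End Cohomology.

Definition ipred (n : ssrint.int) : ssrint.int := (n + -1)%R.

Lemma ipredK n : isucc (ipred n) = n.
Proof. exact: GRing.subrK. Qed.

Lemma isuccK n : ipred (isucc n) = n.
Proof. exact: GRing.addrK. Qed.

(** * The inverse of the shift *)

Section Unshift.
Context {A : PreadditiveCat}.
Implicit Types X Y : ComplexCat A.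

(** [isucc (ipred n)] is equal but not convertible to [n]; differentials and comparison maps of the
    inverse shift therefore pass through this transport along an equality of degrees. *)
Definition cx_cast X m n (e : m = n) : cx X m ~> cx X n :=
  match e with erefl => idm _ end.

Lemma cx_cast_d X m n (e : m = n) (e' : isucc m = isucc n) :
  cx_cast X e' ∘ cd X m ≈ cd X n ∘ cx_cast X e.
Proof.
case: n / e e' => e'; rewrite (eq_irrelevance e' erefl) comp_idl comp_idr.
by reflexivity.
Qed.

Lemma cx_cast_cm X Y (f : X ~> Y) m n (e : m = n) :
  cx_cast Y e ∘ cm f m ≈ cm f n ∘ cx_cast X e.
Proof. by case: n / e; rewrite comp_idl comp_idr; reflexivity. Qed.

Lemma cx_cast_iso X m n (e : m = n) : is_iso (cx_cast X e).
Proof. by case: n / e; apply: is_iso_id. Qed.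

Lemma cx_cast_comp X m n p (e : m = n) (e' : n = p) (e'' : m = p) :
  cx_cast X e' ∘ cx_cast X e ≈ cx_cast X e''.
Proof.
case: p / e' e'' => e''; case: n / e e'' => e''.
by rewrite (eq_irrelevance e'' erefl) comp_idl; reflexivity.
Qed.

Lemma cx_cast_shift X m n (e : m = n) (e' : isucc m = isucc n) :
  cx_cast (shift_functor A X) e ≈ cx_cast X e'.
Proof. by case: n / e e' => e'; rewrite (eq_irrelevance e' erefl); reflexivity. Qed.

Lemma isucc_ipred n : isucc (ipred n) = ipred (isucc n).
Proof. by rewrite ipredK isuccK. Qed.

Program Definition unshift_complex (X : Complex A) : Complex A :=
  {| cx n := X (ipred n); cd n := - (cx_cast X (isucc_ipred n) ∘ cd X (ipred n)) |}.
Next Obligation.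
move=> X n; rewrite comp_oppl comp_oppr hoppK.
have E := cx_cast_d X (isucc_ipred n) (f_equal isucc (isucc_ipred n)).
rewrite -compA [cd X _ ∘ _]compA -E -[_ ∘ cd X _ ∘ _]compA cdd !comp0r.
by reflexivity.
Qed.

Program Definition unshift_functor : Functor (ComplexCat A) (ComplexCat A) :=
  {| fob := unshift_complex : ComplexCat A -> ComplexCat A;
     fmap X Y f := {| cm n := cm f (ipred n) |} |}.
Next Obligation.
move=> X Y f n; rewrite comp_oppl comp_oppr.
rewrite -compA -cm_comm compA -cx_cast_cm -compA; reflexivity.
Qed.
Next Obligation. by move=> X Y f g H n; apply: H. Qed.
Next Obligation. by move=> *; reflexivity. Qed.
Next Obligation. by move=> *; reflexivity. Qed.

Program Definition unshiftK : NatTrans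
    (functor_comp unshift_functor (shift_functor A)) (functor_id (ComplexCat A)) :=
  {| nt X := {| cm n := cx_cast X (ipredK n) |} |}.
Next Obligation.
move=> X n.
have E := f_equal isucc (isucc_ipred n).
have E' := f_equal isucc (ipredK n).
rewrite (cx_cast_shift X _ E) !comp_oppr hoppK compA -(cx_cast_d X (ipredK n) E').
by apply: precomp; apply: cx_cast_comp.
Qed.
Next Obligation. by move=> X Y f n; apply: cx_cast_cm. Qed.

Program Definition shiftK : NatTrans
    (functor_comp (shift_functor A) unshift_functor) (functor_id (ComplexCat A)) :=
  {| nt X := {| cm n := cx_cast X (isuccK n) |} |}.
Next Obligation.
move=> X n.
have E := f_equal isucc (isuccK n).
rewrite hoppK compA -(cx_cast_d X (isuccK n) E).
by apply: precomp; apply: cx_cast_comp.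
Qed.
Next Obligation. by move=> X Y f n; apply: cx_cast_cm. Qed.

End Unshift.

Section DerivedShift.
Context (A : AbelianCat).

Lemma unshiftK_iso (X : ComplexCat A) : is_iso (unshiftK X).
Proof. by apply: complex_iso => n; apply: cx_cast_iso. Qed.

Lemma shiftK_iso (X : ComplexCat A) : is_iso (shiftK X).
Proof. by apply: complex_iso => n; apply: cx_cast_iso. Qed.

(** Up to the isomorphism [shiftK], shifting [unshift f] gives back [f], and the shift reflects
    quasi-isomorphisms. *)
Lemma unshift_quasi_iso (X Y : ComplexCat A) (f : X ~> Y) :
  quasi_iso f -> quasi_iso (fmap (unshift_functor (A := A)) f).
Proof.
move=> Hf; apply: quasi_iso_unshift.
have [g [gK Kg]] := shiftK_iso Y.
apply: (@quasi_iso_heq _ _ _ (g ∘ (f ∘ shiftK X))).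
  rewrite -[X in _ ≈ X]comp_idl -gK -compA (nt_nat shiftK f).
  by reflexivity.
apply: quasi_iso_comp; first by apply: iso_quasi_iso; exists (shiftK Y).
by apply: quasi_iso_comp => //; apply: iso_quasi_iso; apply: shiftK_iso.
Qed.

Definition derived_unshift : Functor (derived_cat A) (derived_cat A) :=
  loc_map unshift_quasi_iso.

Lemma derived_unshiftK :
  nat_iso (functor_comp derived_unshift (derived_shift A)) (functor_id _).
Proof.
pose a (X : ComplexCat A) := fmap (loc_functor (@quasi_iso A)) (unshiftK X).
unshelve eexists (@loc_nat_trans _ _ _ (functor_comp derived_unshift (derived_shift A))
  (functor_id _) a _).
  move=> X Y f; rewrite /a -!(fmap_comp (loc_functor (@quasi_iso A))).
  exact: (fmap_proper (loc_functor _) (nt_nat unshiftK f)).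
by move=> X; exact: (is_iso_fmap (loc_functor _) (unshiftK_iso X)).
Qed.

Lemma derived_shiftK :
  nat_iso (functor_comp (derived_shift A) derived_unshift) (functor_id _).
Proof.
pose a (X : ComplexCat A) := fmap (loc_functor (@quasi_iso A)) (shiftK X).
unshelve eexists (@loc_nat_trans _ _ _ (functor_comp (derived_shift A) derived_unshift)
  (functor_id _) a _).
  move=> X Y f; rewrite /a -!(fmap_comp (loc_functor (@quasi_iso A))).
  exact: (fmap_proper (loc_functor _) (nt_nat shiftK f)).
by move=> X; exact: (is_iso_fmap (loc_functor _) (shiftK_iso X)).
Qed.

End DerivedShift.

Local Obligation Tactic := idtac.

(** * Functoriality of the mapping cone *)

Section ConeMapFunctor.
Context {A : AbelianCat}.

Lemma cone_map_proper (X Y X' Y' : ComplexCat A) (u : X ~> Y) (u' : X' ~> Y')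
    (a a2 : X ~> X') (b b2 : Y ~> Y') (H : b ∘ u ≈ u' ∘ a) (H2 : b2 ∘ u ≈ u' ∘ a2) :
  a ≈ a2 -> b ≈ b2 -> cone_map H ≈ cone_map H2.
Proof.
move=> Ea Eb n; apply: cone_ext.
  by rewrite !cone_map_fst; apply: precomp; apply: Ea.
by rewrite !cone_map_snd; apply: precomp; apply: Eb.
Qed.

Lemma cone_map_id (X Y : ComplexCat A) (u : X ~> Y)
    (a : X ~> X) (b : Y ~> Y) (H : b ∘ u ≈ u ∘ a) :
  a ≈ idm X -> b ≈ idm Y -> cone_map H ≈ idm (cone u).
Proof.
move=> Ea Eb n; apply: cone_ext.
  by rewrite cone_map_fst (Ea (isucc n)) comp_idl comp_idr; reflexivity.
by rewrite cone_map_snd (Eb n) comp_idl comp_idr; reflexivity.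
Qed.

Lemma cone_map_comp (X Y X' Y' X'' Y'' : ComplexCat A)
    (u : X ~> Y) (u' : X' ~> Y') (u'' : X'' ~> Y'')
    (a : X ~> X') (b : Y ~> Y') (a' : X' ~> X'') (b' : Y' ~> Y'')
    (a'' : X ~> X'') (b'' : Y ~> Y'') (H : b ∘ u ≈ u' ∘ a)
    (H' : b' ∘ u' ≈ u'' ∘ a') (H'' : b'' ∘ u ≈ u'' ∘ a'') :
  a'' ≈ a' ∘ a -> b'' ≈ b' ∘ b -> cone_map H'' ≈ cone_map H' ∘ cone_map H.
Proof.
move=> Ea Eb n; apply: cone_ext.
  by rewrite cone_map_fst cone_map_fstK cone_map_fst (Ea (isucc n)) compA; reflexivity.
by rewrite cone_map_snd cone_map_sndK cone_map_snd (Eb n) compA; reflexivity.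
Qed.

End ConeMapFunctor.

Definition preserves_quasi_iso (A B : AbelianCat) (F : Functor (ComplexCat A) (ComplexCat B)) :=
  forall (X Y : ComplexCat A) (s : X ~> Y), quasi_iso s -> quasi_iso (fmap F s).

(** * The cone of a natural transformation as a functor on complexes *)

Section ConeFunctor.
Context {A B : AbelianCat} {T E : Functor A B}.
Context (HT : additive T) (HE : additive E) (t : NatTrans T E).
Notation T' := (complex_functor HT).
Notation E' := (complex_functor HE).
Notation t' := (complex_nat HT HE t).

Lemma complex_nat_nat (X Y : ComplexCat A) (f : X ~> Y) :
  fmap E' f ∘ t' X ≈ t' Y ∘ fmap T' f.
Proof. by move=> n; symmetry; apply: nt_nat. Qed.

Program Definition cone_functor : Functor (ComplexCat A) (ComplexCat B) :=
  {| fob X := cone (t' X); fmap X Y f := cone_map (complex_nat_nat f) |}.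
Next Obligation. by move=> X Y f g H; apply: cone_map_proper; apply: fmap_proper. Qed.
Next Obligation. by move=> X; apply: cone_map_id; apply: fmap_id. Qed.
Next Obligation. by move=> X Y Z g f; apply: cone_map_comp; apply: fmap_comp. Qed.

Lemma cone_functor_quasi_iso :
  preserves_quasi_iso T' -> preserves_quasi_iso E' -> preserves_quasi_iso cone_functor.
Proof.
by move=> qT qE X Y s Hs; apply: cone_map_quasi_iso; [apply: qT | apply: qE].
Qed.

Section Shift.
Context (X : ComplexCat A).
Notation SX := (shift_functor A X).

(** The differential of the cone of [t] at [X[1]] and that of the shifted cone agree except for the
    sign of the off-diagonal entry [t]; negating the first summand corrects this. *)
Definition cone_functor_shift_cm n : cx (cone (t' SX)) n ~> cx (cone (t' X)) (isucc n) :=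
  cone_pair (t' X) (- cone_fst (t' SX) n) (cone_snd (t' SX) n).

Lemma cone_functor_shift_fst n :
  cone_fst (t' X) (isucc n) ∘ cone_functor_shift_cm n ≈ - cone_fst (t' SX) n.
Proof. exact: cone_fst_pair. Qed.

Lemma cone_functor_shift_snd n :
  cone_snd (t' X) (isucc n) ∘ cone_functor_shift_cm n ≈ cone_snd (t' SX) n.
Proof. exact: cone_snd_pair. Qed.

Lemma cone_functor_shift_fstK n V (x : V ~> cx (cone (t' SX)) n) :
  cone_fst (t' X) (isucc n) ∘ (cone_functor_shift_cm n ∘ x) ≈ - (cone_fst (t' SX) n ∘ x).
Proof. by rewrite compA cone_functor_shift_fst comp_oppl; reflexivity. Qed.

Lemma cone_functor_shift_sndK n V (x : V ~> cx (cone (t' SX)) n) :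
  cone_snd (t' X) (isucc n) ∘ (cone_functor_shift_cm n ∘ x) ≈ cone_snd (t' SX) n ∘ x.
Proof. by rewrite compA cone_functor_shift_snd; reflexivity. Qed.

Lemma cone_functor_shift_comm n :
  cone_functor_shift_cm (isucc n) ∘ cd (cone (t' SX)) n ≈
  (- cd (cone (t' X)) (isucc n)) ∘ cone_functor_shift_cm n.
Proof.
rewrite -[cd (cone (t' SX)) n]comp_idr; apply: (cone_ext (u := t' X)).
  rewrite cone_functor_shift_fstK (cone_fst_d (u := t' SX)).
  rewrite comp_oppl comp_oppr (cone_fst_d (u := t' X)) cone_functor_shift_fst.
  by rewrite comp_idr /= (additiveN HT); push; abel.
rewrite cone_functor_shift_sndK (cone_snd_d (u := t' SX)).
rewrite comp_oppl comp_oppr (cone_snd_d (u := t' X)).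
rewrite cone_functor_shift_fst cone_functor_shift_snd.
by rewrite !comp_idr /= (additiveN HE); push; abel.
Qed.

Definition cone_functor_shift :
    (cone_functor SX : ComplexCat B) ~> shift_functor B (cone_functor X) :=
  Build_ChainMap (X := cone (t' SX)) (Y := shift_complex (cone (t' X)))
    cone_functor_shift_comm.

Lemma cone_functor_shift_iso : is_iso cone_functor_shift.
Proof.
apply: complex_iso => n.
exists (cone_pair (t' SX) (- cone_fst (t' X) (isucc n))
               (cone_snd (t' X) (isucc n))).
split.
  apply: (cone_ext (u := t' SX)).
    rewrite compA cone_fst_pair comp_oppl cone_functor_shift_fst hoppK comp_idr.
    by reflexivity.
  by rewrite compA cone_snd_pair cone_functor_shift_snd comp_idr; reflexivity.
apply: (cone_ext (u := t' X)).
  rewrite cone_functor_shift_fstK cone_fst_pair hoppK comp_idr; reflexivity.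
by rewrite cone_functor_shift_sndK cone_snd_pair comp_idr; reflexivity.
Qed.

End Shift.

Lemma fmap_compK (C D : Category) (G : Functor C D) (P Q R : C) (V : D)
    (g : Q ~> R) (f : P ~> Q) (x : V ~> G P) :
  fmap G g ∘ (fmap G f ∘ x) ≈ fmap G (g ∘ f) ∘ x.
Proof. by rewrite fmap_comp compA; reflexivity. Qed.

Lemma nt_natK (C D : Category) (G H : Functor C D) (a : NatTrans G H) (P Q : C)
    (f : P ~> Q) (V : D) (x : V ~> G P) :
  a Q ∘ (fmap G f ∘ x) ≈ fmap H f ∘ (a P ∘ x).
Proof. by rewrite compA nt_nat -compA; reflexivity. Qed.

Lemma fmap_nt_natK (C D M : Category) (G H : Functor C D) (r : NatTrans G H)
    (K' : Functor D M) (P Q : C) (f : P ~> Q) (V : M) (x : V ~> K' (G P)) :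
  fmap K' (r Q) ∘ (fmap K' (fmap G f) ∘ x) ≈ fmap K' (fmap H f) ∘ (fmap K' (r P) ∘ x).
Proof. by rewrite !fmap_compK nt_nat; reflexivity. Qed.

Lemma map_dd (C D : AbelianCat) (G : Functor C D) (HG : additive G) (X : ComplexCat C)
    n V (x : V ~> G (cx X n)) :
  fmap G (cd X (isucc n)) ∘ (fmap G (cd X n) ∘ x) ≈ 0.
Proof. by rewrite fmap_compK cdd (additive0 HG) comp0l; reflexivity. Qed.

Lemma cone_functor_fst (X Y : ComplexCat A) (u : X ~> Y) n V (x : V ~> cx (cone (t' X)) n) :
  cone_fst (t' Y) n ∘ (cm (fmap cone_functor u) n ∘ x) ≈
  fmap T (cm u (isucc n)) ∘ (cone_fst (t' X) n ∘ x).
Proof. exact: cone_map_fstK. Qed.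

Lemma cone_functor_snd (X Y : ComplexCat A) (u : X ~> Y) n V (x : V ~> cx (cone (t' X)) n) :
  cone_snd (t' Y) n ∘ (cm (fmap cone_functor u) n ∘ x) ≈
  fmap E (cm u n) ∘ (cone_snd (t' X) n ∘ x).
Proof. exact: cone_map_sndK. Qed.

(** * Cone functors and standard triangles *)

Section Triangle.
Context {X Y : ComplexCat A} (u : X ~> Y).
Notation F := cone_functor.

Lemma map_cone_d_inl (G : Functor A B) (HG : additive G) n V
    (x : V ~> G (cx X (isucc n))) :
  cd (complex_functor HG (cone u)) n ∘ (fmap G (cone_inl u n) ∘ x) ≈
  - (fmap G (cone_inl u (isucc n)) ∘ (cd (complex_functor HG X) (isucc n) ∘ x)) +
  fmap G (cone_inr u (isucc n)) ∘ (fmap G (cm u (isucc n)) ∘ x).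
Proof.
rewrite !fmap_compK cone_d_inl HG (additiveN HG) comp_addl comp_oppl.
by reflexivity.
Qed.

Lemma map_cone_d_inr (G : Functor A B) (HG : additive G) n V
    (x : V ~> G (cx Y n)) :
  cd (complex_functor HG (cone u)) n ∘ (fmap G (cone_inr u n) ∘ x) ≈
  fmap G (cone_inr u (isucc n)) ∘ (cd (complex_functor HG Y) n ∘ x).
Proof. by rewrite !fmap_compK cone_d_inr; reflexivity. Qed.

Lemma complex_nat_natK (Z Z' : ComplexCat A) m m' (f : cx Z m ~> cx Z' m') V
    (x : V ~> cx (T' Z) m) :
  cm (t' Z') m' ∘ (fmap T f ∘ x) ≈ fmap E f ∘ (cm (t' Z) m ∘ x).
Proof. by rewrite compA (nt_nat t) -compA; reflexivity. Qed.

(** Both sides are, in degree [n], the sum of [T X^(n+2)], [E X^(n+1)], [T Y^(n+1)] and [E Y^n]. The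
    summand [T X^(n+2)] is shifted twice, once for each cone, and the two orders of shifting differ
    by the sign. *)
Definition cone_functor_cone_cm n : cx (cone (fmap F u)) n ~> cx (cone (t' (cone u))) n :=
  cone_pair (t' (cone u))
    (- (fmap T (cone_inl u (isucc n)) ∘ (cone_fst (t' X) (isucc n) ∘ cone_fst (fmap F u) n)) +
     fmap T (cone_inr u (isucc n)) ∘ (cone_fst (t' Y) n ∘ cone_snd (fmap F u) n))
    (fmap E (cone_inl u n) ∘ (cone_snd (t' X) (isucc n) ∘ cone_fst (fmap F u) n) +
     fmap E (cone_inr u n) ∘ (cone_snd (t' Y) n ∘ cone_snd (fmap F u) n)).

Lemma cone_functor_cone_fst n V (x : V ~> cx (cone (fmap F u)) n) :
  cone_fst (t' (cone u)) n ∘ (cone_functor_cone_cm n ∘ x) ≈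
  - (fmap T (cone_inl u (isucc n)) ∘ (cone_fst (t' X) (isucc n) ∘ (cone_fst (fmap F u) n ∘ x))) +
     fmap T (cone_inr u (isucc n)) ∘ (cone_fst (t' Y) n ∘ (cone_snd (fmap F u) n ∘ x)).
Proof. by rewrite compA cone_fst_pair comp_addl comp_oppl -!compA; reflexivity. Qed.

Lemma cone_functor_cone_snd n V (x : V ~> cx (cone (fmap F u)) n) :
  cone_snd (t' (cone u)) n ∘ (cone_functor_cone_cm n ∘ x) ≈
  fmap E (cone_inl u n) ∘ (cone_snd (t' X) (isucc n) ∘ (cone_fst (fmap F u) n ∘ x)) +
  fmap E (cone_inr u n) ∘ (cone_snd (t' Y) n ∘ (cone_snd (fmap F u) n ∘ x)).
Proof. by rewrite compA cone_snd_pair comp_addl -!compA; reflexivity. Qed.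

Lemma cone_functor_cone_comm n :
  cone_functor_cone_cm (isucc n) ∘ cd (cone (fmap F u)) n ≈
  cd (cone (t' (cone u))) n ∘ cone_functor_cone_cm n.
Proof.
rewrite -[cd (cone (fmap F u)) n]comp_idr -[cone_functor_cone_cm n]comp_idr.
move: (idm (cx (cone (fmap F u)) n)) => x.
pose a := cone_fst (t' X) (isucc n) ∘ (cone_fst (fmap F u) n ∘ x).
pose b := cone_snd (t' X) (isucc n) ∘ (cone_fst (fmap F u) n ∘ x).
pose c := cone_fst (t' Y) n ∘ (cone_snd (fmap F u) n ∘ x).
pose e := cone_snd (t' Y) n ∘ (cone_snd (fmap F u) n ∘ x).
apply: (cone_ext (u := t' (cone u))).
- rewrite cone_functor_cone_fst (cone_fst_d (u := t' (cone u))) cone_functor_cone_fst.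
  rewrite (cone_fst_d (u := fmap F u)) (cone_snd_d (u := fmap F u)).
  rewrite !(comp_addr, comp_oppr) (cone_fst_d (u := t' X)) cone_functor_fst.
  rewrite (cone_fst_d (u := t' Y)) -/a -/c !(comp_addr, comp_oppr).
  rewrite map_cone_d_inl map_cone_d_inr.
  by abel.
- rewrite cone_functor_cone_snd (cone_snd_d (u := t' (cone u))).
  rewrite cone_functor_cone_fst cone_functor_cone_snd.
  rewrite (cone_fst_d (u := fmap F u)) (cone_snd_d (u := fmap F u)).
  rewrite !(comp_addr, comp_oppr) (cone_snd_d (u := t' X)) cone_functor_snd.
  rewrite (cone_snd_d (u := t' Y)) -/a -/b -/c -/e !(comp_addr, comp_oppr).
  rewrite map_cone_d_inl map_cone_d_inr.
  rewrite !complex_nat_natK.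
  abel.
Qed.

Definition cone_functor_cone : (cone (fmap F u) : ComplexCat B) ~> F (cone u) :=
  Build_ChainMap (Y := cone (t' (cone u))) cone_functor_cone_comm.

Lemma cone_functor_cone_in :
  cone_functor_cone ∘ cone_in (fmap F u) ≈ fmap F (cone_in u).
Proof.
move=> n; rewrite -[cm (fmap F (cone_in u)) n]comp_idr.
rewrite -[X in X ≈ _]/(cone_functor_cone_cm n ∘ cm (cone_in (fmap F u)) n).
rewrite (cone_inE (fmap F u)).
apply: (cone_ext (u := t' (cone u))).
- rewrite cone_functor_cone_fst (cone_fst_inr (fmap F u)) (cone_snd_inr (fmap F u)).
  rewrite !comp0r hopp0 hadd0 (cone_functor_fst (cone_in u)) (cone_inE u).
  by reflexivity.
- rewrite cone_functor_cone_snd (cone_fst_inr (fmap F u)) (cone_snd_inr (fmap F u)).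
  rewrite !comp0r hadd0 (cone_functor_snd (cone_in u)) (cone_inE u).
  by reflexivity.
Qed.

(** The signs on the [T] summands in [cone_functor_shift] and [cone_functor_cone] cancel. With
    [cone_functor_cone_in], this carries the standard triangle of [fmap F u] to the image of that of
    [u]. *)
Lemma cone_functor_cone_out :
  cone_functor_shift X ∘ (fmap F (cone_out u) ∘ cone_functor_cone) ≈
  cone_out (fmap F u).
Proof.
move=> n.
rewrite -[X in X ≈ _]/(cone_functor_shift_cm X n ∘
  (cm (fmap F (cone_out u)) n ∘ cone_functor_cone_cm n)).
rewrite (cone_outE (fmap F u)) -[cone_functor_cone_cm n]comp_idr.
rewrite -[X in _ ≈ X]comp_idr.
apply: (cone_ext (u := t' X)).
- rewrite cone_functor_shift_fstK (cone_functor_fst (cone_out u)).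
  rewrite cone_functor_cone_fst (cone_outE u) comp_addr comp_oppr !fmap_compK.
  rewrite (cone_fst_inl u) (cone_fst_inr u) fmap_id (additive0 HT) comp0l comp_idl.
  by abel.
- rewrite cone_functor_shift_sndK (cone_functor_snd (cone_out u)).
  rewrite cone_functor_cone_snd (cone_outE u) comp_addr !fmap_compK.
  rewrite (cone_fst_inl u) (cone_fst_inr u) fmap_id (additive0 HE) comp0l comp_idl.
  by abel.
Qed.

Lemma cone_functor_cone_iso : is_iso cone_functor_cone.
Proof.
apply: complex_iso => n.
pose p := cone_fst (t' (cone u)) n; pose q := cone_snd (t' (cone u)) n.
exists (cone_pair (fmap F u)
  (cone_pair (t' X) (- (fmap T (cone_fst u (isucc n)) ∘ p)) (fmap E (cone_fst u n) ∘ q))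
  (cone_pair (t' Y) (fmap T (cone_snd u (isucc n)) ∘ p) (fmap E (cone_snd u n) ∘ q))).
rewrite -[cm cone_functor_cone n]/(cone_functor_cone_cm n); split.
  rewrite -[cone_functor_cone_cm n]comp_idr; apply: (cone_ext (u := fmap F u)).
    rewrite [cone_fst (fmap F u) n ∘ _]compA cone_fst_pair.
    apply: (cone_ext (u := t' X)).
      rewrite [cone_fst (t' X) _ ∘ _]compA cone_fst_pair comp_oppl -compA.
      rewrite cone_functor_cone_fst comp_addr comp_oppr !fmap_compK.
      rewrite (cone_fst_inl u) (cone_fst_inr u) fmap_id (additive0 HT) comp0l comp_idl.
      by abel.
    rewrite [cone_snd (t' X) _ ∘ _]compA cone_snd_pair -compA.
    rewrite cone_functor_cone_snd comp_addr !fmap_compK.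
    rewrite (cone_fst_inl u) (cone_fst_inr u) fmap_id (additive0 HE) comp0l comp_idl.
    by abel.
  rewrite [cone_snd (fmap F u) n ∘ _]compA cone_snd_pair.
  apply: (cone_ext (u := t' Y)).
    rewrite [cone_fst (t' Y) _ ∘ _]compA cone_fst_pair -compA.
    rewrite cone_functor_cone_fst comp_addr comp_oppr !fmap_compK.
    rewrite (cone_snd_inl u) (cone_snd_inr u) fmap_id (additive0 HT) comp0l comp_idl.
    by abel.
  rewrite [cone_snd (t' Y) _ ∘ _]compA cone_snd_pair -compA.
  rewrite cone_functor_cone_snd comp_addr !fmap_compK.
  rewrite (cone_snd_inl u) (cone_snd_inr u) fmap_id (additive0 HE) comp0l comp_idl.
  by abel.
apply: (cone_ext (u := t' (cone u))).
  rewrite cone_functor_cone_fst (cone_fst_pair (fmap F u)).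
  rewrite (cone_snd_pair (fmap F u)) !cone_fst_pair comp_oppr !fmap_compK hoppK.
  rewrite -comp_addl -HT (cone_inl_inr u) fmap_id comp_idl comp_idr.
  by reflexivity.
rewrite cone_functor_cone_snd (cone_fst_pair (fmap F u)).
rewrite (cone_snd_pair (fmap F u)) !cone_snd_pair !fmap_compK.
rewrite -comp_addl -HE (cone_inl_inr u) fmap_id comp_idl comp_idr.
by reflexivity.
Qed.

End Triangle.

End ConeFunctor.

(** * Equivalences given by cones *)

(* Squares that give rise to a short exact sequence [X -> P + Q -> R]; hence they
   commute up to sign. *)
Definition bicartesian (A : AbelianCat) (X P Q R : A) (i : X ~> P) (j : X ~> Q)
    (p : P ~> R) (q : Q ~> R) : Prop :=
  [/\ p ∘ i + q ∘ j ≈ 0,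
      forall (V : A) (x : V ~> X), i ∘ x ≈ 0 -> j ∘ x ≈ 0 -> x ≈ 0,
      forall (V : A) (a : V ~> P) (b : V ~> Q), p ∘ a + q ∘ b ≈ 0 ->
        exists x : V ~> X, i ∘ x ≈ a /\ j ∘ x ≈ b &
      forall (V : A) (h : R ~> V), h ∘ p ≈ 0 -> h ∘ q ≈ 0 -> h ≈ 0].

Section Bicartesian.
Context {A : AbelianCat} {X P Q R : A} {i : X ~> P} {j : X ~> Q} {p : P ~> R}
  {q : Q ~> R}.

Lemma bicartesian_epi : bicartesian i j p q ->
  forall (V : A) (r : V ~> R), exists (W : A) (e : W ~> V) (a : W ~> P) (b : W ~> Q),
    is_epi e /\ p ∘ a + q ∘ b ≈ r ∘ e.
Proof.
move=> [_ _ _ H] V r; pose b := biprod P Q.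
have [|W [e [y [He Ey]]]] := epi_lift (p := p ∘ bp_prl b + q ∘ bp_prr b) r.
  move=> Z h E; apply: H.
    rewrite -(_ : (p ∘ bp_prl b + q ∘ bp_prr b) ∘ bp_inl b ≈ p).
      by rewrite compA E comp0l; reflexivity.
    by push; rewrite bp_ll bp_rl comp_idr comp0r hadd0r; reflexivity.
  rewrite -(_ : (p ∘ bp_prl b + q ∘ bp_prr b) ∘ bp_inr b ≈ q).
    by rewrite compA E comp0l; reflexivity.
  by push; rewrite bp_lr bp_rr comp_idr comp0r hadd0; reflexivity.
exists W, e, (bp_prl b ∘ y), (bp_prr b ∘ y); split=> //.
by rewrite -Ey; push; reflexivity.
Qed.

Lemma bicartesian_sym : bicartesian i j p q -> bicartesian j i q p.
Proof.
move=> [E M L H]; split.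
- by rewrite haddC.
- by move=> V x Hj Hi; apply: M.
- by move=> V a b; rewrite haddC => /L[x [? ?]]; exists x.
- by move=> V h Hq Hp; apply: H.
Qed.

(** Two opposite invertible sides suffice. Every square used below has this form, up to exchanging
    [P] and [Q], either as a whole or at each vertex. *)
Lemma bicartesian_iso : p ∘ i + q ∘ j ≈ 0 -> is_iso i -> is_iso q -> bicartesian i j p q.
Proof.
move=> E Hi Hq; split=> //.
- by move=> V x /(is_iso_mono Hi).
- move=> V a b Eab; have [g [gK Kg]] := Hi; exists (g ∘ a).
  have Ea : i ∘ (g ∘ a) ≈ a by rewrite compA Kg comp_idl; reflexivity.
  split=> //; apply: (monoP (is_iso_mono Hq)).
  apply: (lin (precomp (g ∘ a) E)); rewrite comp_addl -!compA Ea comp0l.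
  by apply: (lin (symmetry Eab)); abel.
- by move=> V h _ /(is_iso_epi Hq).
Qed.

End Bicartesian.

Section ConeEquivalence.
Context {A B : AbelianCat} {T E : Functor A B} {S L : Functor B A}.
Context (HT : additive T) (HE : additive E) (HS : additive S) (HL : additive L).
Context (t : NatTrans T E) (s : NatTrans L S).
Notation T' := (complex_functor HT).
Notation E' := (complex_functor HE).
Notation S' := (complex_functor HS).
Notation L' := (complex_functor HL).
Notation t' := (complex_nat HT HE t).
Notation s' := (complex_nat HL HS s).
Notation F := (cone_functor HT HE t).
Notation K := (cone_functor HL HS s).

(** * The composite [K F] compared with the shift *)

Section LeftInverse.
Context (alpha : NatTrans (functor_id A) (functor_comp L E)).
Context (beta : NatTrans (functor_id A) (functor_comp S T)).
Hypothesis LT0 : forall X, idm (L (T X)) ≈ 0.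
Hypothesis Hbc : forall X, bicartesian (alpha X) (beta X) (s (E X)) (fmap S (t X)).

Section Elements.
Context (X : ComplexCat A).
Notation KF := (cone (s' (F X))).

(* As [L T = 0], the complex [K (F X)] is in degree [n] the sum of
   [L E X^(n+1)], [S T X^(n+1)] and [S E X^n]; these are the projections. *)
Definition kf_a n : cx KF n ~> L (E (cx X (isucc n))) :=
  fmap L (cone_snd (t' X) (isucc n)) ∘ cone_fst (s' (F X)) n.
Definition kf_b n : cx KF n ~> S (T (cx X (isucc n))) :=
  fmap S (cone_fst (t' X) n) ∘ cone_snd (s' (F X)) n.
Definition kf_c n : cx KF n ~> S (E (cx X n)) :=
  fmap S (cone_snd (t' X) n) ∘ cone_snd (s' (F X)) n.

Lemma LT_zero (P : A) (V : A) (x : V ~> L (T P)) : x ≈ 0.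
Proof. by rewrite -[x]comp_idl LT0 comp0l; reflexivity. Qed.

Definition kf_mk n (V : A) (a : V ~> L (E (cx X (isucc n))))
    (b : V ~> S (T (cx X (isucc n)))) (c : V ~> S (E (cx X n))) : V ~> cx KF n :=
  cone_pair (s' (F X)) (fmap L (cone_inr (t' X) (isucc n)) ∘ a)
    (fmap S (cone_inl (t' X) n) ∘ b + fmap S (cone_inr (t' X) n) ∘ c).

Lemma kf_a_mk n V a b c : kf_a n ∘ kf_mk (n := n) (V := V) a b c ≈ a.
Proof.
rewrite -compA (cone_fst_pair (s' (F X))) fmap_compK (cone_snd_inr (t' X)).
by rewrite fmap_id comp_idl; reflexivity.
Qed.

Lemma kf_b_mk n V a b c : kf_b n ∘ kf_mk (n := n) (V := V) a b c ≈ b.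
Proof.
rewrite -compA (cone_snd_pair (s' (F X))) comp_addr !fmap_compK.
rewrite (cone_fst_inl (t' X)) (cone_fst_inr (t' X)) fmap_id (additive0 HS).
by rewrite comp0l comp_idl hadd0r; reflexivity.
Qed.

Lemma kf_c_mk n V a b c : kf_c n ∘ kf_mk (n := n) (V := V) a b c ≈ c.
Proof.
rewrite -compA (cone_snd_pair (s' (F X))) comp_addr !fmap_compK.
rewrite (cone_snd_inl (t' X)) (cone_snd_inr (t' X)) fmap_id (additive0 HS).
by rewrite comp0l comp_idl hadd0; reflexivity.
Qed.

Lemma kf_fst n V (x : V ~> cx KF n) :
  cone_fst (s' (F X)) n ∘ x ≈ fmap L (cone_inr (t' X) (isucc n)) ∘ (kf_a n ∘ x).
Proof.
rewrite -compA fmap_compK -[X in X ≈ _]comp_idl -fmap_id.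
rewrite -(cone_inl_inr (t' X)) HL comp_addl [fmap L (_ ∘ cone_fst _ _)]fmap_comp.
rewrite -compA [fmap L (cone_fst _ _) ∘ _]LT_zero comp0r hadd0.
by reflexivity.
Qed.

Lemma kf_snd n V (x : V ~> cx KF n) :
  cone_snd (s' (F X)) n ∘ x ≈ fmap S (cone_inl (t' X) n) ∘ (kf_b n ∘ x) +
    fmap S (cone_inr (t' X) n) ∘ (kf_c n ∘ x).
Proof.
rewrite -!compA !fmap_compK -comp_addl -HS (cone_inl_inr (t' X)) fmap_id comp_idl.
by reflexivity.
Qed.

Lemma kf_ext n V (x y : V ~> cx KF n) :
  kf_a n ∘ x ≈ kf_a n ∘ y -> kf_b n ∘ x ≈ kf_b n ∘ y -> kf_c n ∘ x ≈ kf_c n ∘ y ->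
  x ≈ y.
Proof.
move=> Ha Hb Hc; apply: (cone_ext (u := s' (F X))).
  by rewrite !kf_fst Ha; reflexivity.
by rewrite !kf_snd Hb Hc; reflexivity.
Qed.

Lemma kf_aE n V (x : V ~> cx KF n) :
  kf_a n ∘ x ≈ fmap L (cone_snd (t' X) (isucc n)) ∘ (cone_fst (s' (F X)) n ∘ x).
Proof. by rewrite -compA; reflexivity. Qed.

Lemma kf_bE n V (x : V ~> cx KF n) :
  kf_b n ∘ x ≈ fmap S (cone_fst (t' X) n) ∘ (cone_snd (s' (F X)) n ∘ x).
Proof. by rewrite -compA; reflexivity. Qed.

Lemma kf_cE n V (x : V ~> cx KF n) :
  kf_c n ∘ x ≈ fmap S (cone_snd (t' X) n) ∘ (cone_snd (s' (F X)) n ∘ x).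
Proof. by rewrite -compA; reflexivity. Qed.

#[local] Opaque kf_a kf_b kf_c kf_mk.

Lemma cone_functor_d_inl n : cd (F X) n ∘ cone_inl (t' X) n ≈
  - (cone_inl (t' X) (isucc n) ∘ fmap T (cd X (isucc n))) +
  cone_inr (t' X) (isucc n) ∘ t (cx X (isucc n)).
Proof. exact: cone_d_inl. Qed.

Lemma cone_functor_d_inr n : cd (F X) n ∘ cone_inr (t' X) n ≈
  cone_inr (t' X) (isucc n) ∘ fmap E (cd X n).
Proof. exact: cone_d_inr. Qed.

Lemma kf_a_d n V (x : V ~> cx KF n) : kf_a (isucc n) ∘ (cd KF n ∘ x) ≈
  - (fmap L (fmap E (cd X (isucc n))) ∘ (kf_a n ∘ x)).
Proof.
rewrite kf_aE (cone_fst_d (u := s' (F X))) kf_fst comp_oppr !fmap_compK.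
by rewrite -compA cone_functor_d_inr (cone_snd_inrK (t' X)); reflexivity.
Qed.

Lemma kf_b_d n V (x : V ~> cx KF n) : kf_b (isucc n) ∘ (cd KF n ∘ x) ≈
  - (fmap S (fmap T (cd X (isucc n))) ∘ (kf_b n ∘ x)).
Proof.
rewrite kf_bE (cone_snd_d (u := s' (F X))) kf_snd !comp_addr.
rewrite -[cm (s' (F X)) (isucc n)]/(s (cx (F X) (isucc n))).
rewrite -(nt_natK s) [fmap L _ ∘ _]LT_zero comp0r hadd0 !fmap_compK.
rewrite -!compA cone_functor_d_inl cone_functor_d_inr comp_addr comp_oppr.
rewrite !(cone_fst_inlK (t' X)) !(cone_fst_inrK (t' X)).
rewrite hadd0r (additiveN HS) (additive0 HS) comp0l hadd0r comp_oppl.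
by reflexivity.
Qed.

(** With [kf_a_d] and [kf_b_d], this exhibits [K F X] as the cone of the map
    [L E X + S T X -> S E X] given by [s] and [S t]. *)
Lemma kf_c_d n V (x : V ~> cx KF n) : kf_c (isucc n) ∘ (cd KF n ∘ x) ≈
  s (E (cx X (isucc n))) ∘ (kf_a n ∘ x) + fmap S (t (cx X (isucc n))) ∘ (kf_b n ∘ x)
  + fmap S (fmap E (cd X n)) ∘ (kf_c n ∘ x).
Proof.
rewrite kf_cE (cone_snd_d (u := s' (F X))) kf_snd !comp_addr.
rewrite -[cm (s' (F X)) (isucc n)]/(s (cx (F X) (isucc n))).
rewrite -(nt_natK s) -kf_aE !fmap_compK.
rewrite -!compA cone_functor_d_inl cone_functor_d_inr comp_addr comp_oppr.
rewrite !(cone_snd_inlK (t' X)) !(cone_snd_inrK (t' X)).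
by rewrite hopp0 hadd0 haddA; reflexivity.
Qed.

(** By [Hbc], the complex [X] is the kernel of the epimorphism whose cone is [K F X]; its shift
    enters that cone with third component zero. *)
Definition left_inverse_cm n : cx X (isucc n) ~> cx KF n :=
  kf_mk (alpha (cx X (isucc n))) (beta (cx X (isucc n))) 0.

Lemma left_inverse_comm n :
  left_inverse_cm (isucc n) ∘ (- cd X (isucc n)) ≈ cd KF n ∘ left_inverse_cm n.
Proof.
have [R _ _ _] := Hbc (cx X (isucc n)).
rewrite comp_oppr; apply: kf_ext.
- rewrite kf_a_d comp_oppr compA !kf_a_mk (nt_nat alpha); reflexivity.
- rewrite kf_b_d comp_oppr compA !kf_b_mk (nt_nat beta); reflexivity.
- rewrite kf_c_d comp_oppr compA !kf_c_mk kf_a_mk kf_b_mk R comp0r comp0l.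
  by abel.
Qed.

Definition left_inverse_map : (shift_functor A X : ComplexCat A) ~> K (F X) :=
  Build_ChainMap (X := shift_complex X) (Y := KF) left_inverse_comm.

Lemma left_inverse_a n V (x : V ~> cx X (isucc n)) :
  kf_a n ∘ (left_inverse_cm n ∘ x) ≈ alpha (cx X (isucc n)) ∘ x.
Proof. by rewrite compA kf_a_mk; reflexivity. Qed.

Lemma left_inverse_b n V (x : V ~> cx X (isucc n)) :
  kf_b n ∘ (left_inverse_cm n ∘ x) ≈ beta (cx X (isucc n)) ∘ x.
Proof. by rewrite compA kf_b_mk; reflexivity. Qed.

Lemma left_inverse_c n V (x : V ~> cx X (isucc n)) :
  kf_c n ∘ (left_inverse_cm n ∘ x) ≈ 0.
Proof. by rewrite compA kf_c_mk comp0l; reflexivity. Qed.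

#[local] Opaque left_inverse_cm.

Lemma alpha_d n V (x : V ~> cx X n) :
  alpha _ ∘ (cd X n ∘ x) ≈ fmap L (fmap E (cd X n)) ∘ (alpha _ ∘ x).
Proof. exact: (nt_natK alpha). Qed.

Lemma beta_d n V (x : V ~> cx X n) :
  beta _ ∘ (cd X n ∘ x) ≈ fmap S (fmap T (cd X n)) ∘ (beta _ ∘ x).
Proof. exact: (nt_natK beta). Qed.

Lemma left_inverse_surj : cohomology_surj left_inverse_map.
Proof.
move=> n V z; rewrite -[cd (K (F X)) (isucc n)]/(cd KF (isucc n)) => dz.
pose a := kf_a _ ∘ z; pose b := kf_b _ ∘ z; pose c := kf_c _ ∘ z.
have [ea eb ec] : [/\ kf_a _ ∘ z ≈ a, kf_b _ ∘ z ≈ b & kf_c _ ∘ z ≈ c].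
  by split; reflexivity.
have da : fmap L (fmap E (cd X _)) ∘ a ≈ 0.
  by rewrite -[fmap L _ ∘ _]hoppK -kf_a_d dz comp0r hopp0; reflexivity.
have db : fmap S (fmap T (cd X _)) ∘ b ≈ 0.
  by rewrite -[fmap S _ ∘ _]hoppK -kf_b_d dz comp0r hopp0; reflexivity.
have dc : s _ ∘ a + fmap S (t _) ∘ b + fmap S (fmap E (cd X _)) ∘ c ≈ 0.
  by rewrite -kf_c_d dz comp0r; reflexivity.
clearbody a b c.
(* [c] is lifted along the epimorphism onto [S E X]. Adding the boundary of [(- a', - b', 0)] to the
   cocycle kills its third component, so that the result comes from [X]. *)
have [W [e [a' [b' [He Ec]]]]] := bicartesian_epi (Hbc _) c.
have [_ M Lf _] := Hbc (cx X (isucc (isucc n))).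
have [|x [Ea Eb]] := Lf _ (a ∘ e + fmap L (fmap E (cd X _)) ∘ a')
                       (b ∘ e + fmap S (fmap T (cd X _)) ∘ b').
  rewrite !comp_addr (nt_natK s) (fmap_nt_natK t).
  apply: (lin (precomp e dc)); push.
  by apply: (lin (postcomp (fmap S (fmap E (cd X _))) Ec)); push; abel.
exists W, e, x, (kf_mk (- a') (- b') 0); split=> //.
  rewrite -[cd (shift_functor A X) _]/(- cd X _) comp_oppl.
  rewrite -[X in _ ≈ X]hopp0; apply: hopp_proper.
  have [_ M' _ _] := Hbc (cx X (isucc (isucc (isucc n)))).
  apply: M'.
    rewrite alpha_d Ea comp_addr (map_dd (G := functor_comp L E) (additive_comp HL HE)) hadd0r.
    by rewrite compA da comp0l; reflexivity.
  rewrite beta_d Eb comp_addr (map_dd (G := functor_comp S T) (additive_comp HS HT)) hadd0r.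
  by rewrite compA db comp0l; reflexivity.
rewrite -[cm left_inverse_map _]/(left_inverse_cm (isucc n)).
rewrite -[cd (K (F X)) n]/(cd KF n).
apply: kf_ext.
- rewrite left_inverse_a Ea comp_addr kf_a_d kf_a_mk compA ea; push; abel.
- rewrite left_inverse_b Eb comp_addr kf_b_d kf_b_mk compA eb; push; abel.
- rewrite left_inverse_c comp_addr kf_c_d kf_a_mk kf_b_mk kf_c_mk compA ec.
  by apply: (lin Ec); push; abel.
Qed.

Lemma left_inverse_inj : cohomology_inj left_inverse_map.
Proof.
move=> n V y z; rewrite -[cm left_inverse_map _]/(left_inverse_cm (isucc n)).
rewrite -[cd (K (F X)) n]/(cd KF n) => _ Ez.
pose a := kf_a _ ∘ z; pose b := kf_b _ ∘ z; pose c := kf_c _ ∘ z.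
have ha : alpha _ ∘ y ≈ - (fmap L (fmap E (cd X _)) ∘ a).
  by rewrite -left_inverse_a Ez kf_a_d; reflexivity.
have hb : beta _ ∘ y ≈ - (fmap S (fmap T (cd X _)) ∘ b).
  by rewrite -left_inverse_b Ez kf_b_d; reflexivity.
have hc : s _ ∘ a + fmap S (t _) ∘ b + fmap S (fmap E (cd X _)) ∘ c ≈ 0.
  by rewrite -kf_c_d -Ez left_inverse_c; reflexivity.
clearbody a b c.
(* The bounding element [(a, b, c)] is changed by a boundary, as for surjectivity, until its third
   component vanishes and it comes from [X]. *)
have [W [e [a' [b' [He Ec]]]]] := bicartesian_epi (Hbc _) c.
have [_ _ Lf _] := Hbc (cx X (isucc n)).
have [|x [Ea Eb]] := Lf _ (a ∘ e + fmap L (fmap E (cd X _)) ∘ a')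
                       (b ∘ e + fmap S (fmap T (cd X _)) ∘ b').
  rewrite !comp_addr (nt_natK s) (fmap_nt_natK t).
  apply: (lin (precomp e hc)); push.
  by apply: (lin (postcomp (fmap S (fmap E (cd X _))) Ec)); push; abel.
exists W, e, x; split=> //.
rewrite -[cd (shift_functor A X) _]/(- cd X _) comp_oppl.
have [_ M _ _] := Hbc (cx X (isucc (isucc n))).
apply: hsub0; apply: M; rewrite comp_addr !comp_oppr.
  rewrite alpha_d Ea compA ha !comp_addr (map_dd (G := functor_comp L E) (additive_comp HL HE)).
  by push; abel.
rewrite beta_d Eb compA hb !comp_addr (map_dd (G := functor_comp S T) (additive_comp HS HT)).
by push; abel.
Qed.

Lemma left_inverse_quasi_iso : quasi_iso left_inverse_map.
Proof. by apply/quasi_isoP; split; [exact: left_inverse_inj|exact: left_inverse_surj]. Qed.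

End Elements.

#[local] Opaque kf_a kf_b kf_c kf_mk left_inverse_cm.

Lemma cone_functor_fst1 (X Y : ComplexCat A) (f : X ~> Y) n :
  cone_fst (t' Y) n ∘ cm (fmap F f) n ≈ fmap T (cm f (isucc n)) ∘ cone_fst (t' X) n.
Proof. exact: cone_map_fst. Qed.

Lemma cone_functor_snd1 (X Y : ComplexCat A) (f : X ~> Y) n :
  cone_snd (t' Y) n ∘ cm (fmap F f) n ≈ fmap E (cm f n) ∘ cone_snd (t' X) n.
Proof. exact: cone_map_snd. Qed.

Section Naturality.
Context (X Y : ComplexCat A) (f : X ~> Y).

Lemma kf_a_nat n V (x : V ~> cx (K (F X)) n) :
  kf_a Y n ∘ (cm (fmap K (fmap F f)) n ∘ x) ≈
  fmap L (fmap E (cm f (isucc n))) ∘ (kf_a X n ∘ x).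
Proof.
rewrite !kf_aE (cone_functor_fst (fmap F f)) !fmap_compK (cone_functor_snd1 f).
by reflexivity.
Qed.

Lemma kf_b_nat n V (x : V ~> cx (K (F X)) n) :
  kf_b Y n ∘ (cm (fmap K (fmap F f)) n ∘ x) ≈
  fmap S (fmap T (cm f (isucc n))) ∘ (kf_b X n ∘ x).
Proof.
rewrite !kf_bE (cone_functor_snd (fmap F f)) !fmap_compK (cone_functor_fst1 f).
by reflexivity.
Qed.

Lemma kf_c_nat n V (x : V ~> cx (K (F X)) n) :
  kf_c Y n ∘ (cm (fmap K (fmap F f)) n ∘ x) ≈
  fmap S (fmap E (cm f n)) ∘ (kf_c X n ∘ x).
Proof.
rewrite !kf_cE (cone_functor_snd (fmap F f)) !fmap_compK (cone_functor_snd1 f).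
by reflexivity.
Qed.

Lemma left_inverse_nat :
  left_inverse_map Y ∘ fmap (shift_functor A) f ≈ fmap K (fmap F f) ∘ left_inverse_map X.
Proof.
move=> n.
rewrite -[X in X ≈ _]/(left_inverse_cm Y n ∘ cm f (isucc n)).
rewrite -[X in _ ≈ X]/(cm (fmap K (fmap F f)) n ∘ left_inverse_cm X n).
rewrite -[left_inverse_cm X n]comp_idr.
apply: kf_ext.
- by rewrite left_inverse_a kf_a_nat left_inverse_a comp_idr (nt_nat alpha); reflexivity.
- by rewrite left_inverse_b kf_b_nat left_inverse_b comp_idr (nt_nat beta); reflexivity.
- by rewrite left_inverse_c kf_c_nat left_inverse_c comp0r; reflexivity.
Qed.

End Naturality.
End LeftInverse.

(** * The composite [F K] compared with the shift *)

Section RightInverse.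
Context (gamma : NatTrans (functor_comp T S) (functor_id B)).
Context (delta : NatTrans (functor_comp E L) (functor_id B)).
Hypothesis ES0 : forall Y, idm (E (S Y)) ≈ 0.
Hypothesis Hbc : forall Y, bicartesian (t (L Y)) (fmap T (s Y)) (delta Y) (gamma Y).

Section Elements.
Context (Y : ComplexCat B).
Notation FK := (cone (t' (K Y))).

(* As [E S = 0], the complex [F (K Y)] is in degree [n] the sum of
   [T L Y^(n+2)], [T S Y^(n+1)] and [E L Y^(n+1)]; these are the projections. *)
Definition fk_a n : cx FK n ~> T (L (cx Y (isucc (isucc n)))) :=
  fmap T (cone_fst (s' Y) (isucc n)) ∘ cone_fst (t' (K Y)) n.
Definition fk_b n : cx FK n ~> T (S (cx Y (isucc n))) :=
  fmap T (cone_snd (s' Y) (isucc n)) ∘ cone_fst (t' (K Y)) n.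
Definition fk_c n : cx FK n ~> E (L (cx Y (isucc n))) :=
  fmap E (cone_fst (s' Y) n) ∘ cone_snd (t' (K Y)) n.

Lemma ES_zero (P : B) (V : B) (x : V ~> E (S P)) : x ≈ 0.
Proof. by rewrite -[x]comp_idl ES0 comp0l; reflexivity. Qed.

Definition fk_mk n (V : B) (a : V ~> T (L (cx Y (isucc (isucc n)))))
    (b : V ~> T (S (cx Y (isucc n)))) (c : V ~> E (L (cx Y (isucc n)))) : V ~> cx FK n :=
  cone_pair (t' (K Y))
    (fmap T (cone_inl (s' Y) (isucc n)) ∘ a + fmap T (cone_inr (s' Y) (isucc n)) ∘ b)
    (fmap E (cone_inl (s' Y) n) ∘ c).

Lemma fk_aE n V (x : V ~> cx FK n) :
  fk_a n ∘ x ≈ fmap T (cone_fst (s' Y) (isucc n)) ∘ (cone_fst (t' (K Y)) n ∘ x).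
Proof. by rewrite -compA; reflexivity. Qed.

Lemma fk_bE n V (x : V ~> cx FK n) :
  fk_b n ∘ x ≈ fmap T (cone_snd (s' Y) (isucc n)) ∘ (cone_fst (t' (K Y)) n ∘ x).
Proof. by rewrite -compA; reflexivity. Qed.

Lemma fk_cE n V (x : V ~> cx FK n) :
  fk_c n ∘ x ≈ fmap E (cone_fst (s' Y) n) ∘ (cone_snd (t' (K Y)) n ∘ x).
Proof. by rewrite -compA; reflexivity. Qed.

Lemma fk_a_mk n V a b c : fk_a n ∘ fk_mk (n := n) (V := V) a b c ≈ a.
Proof.
rewrite fk_aE (cone_fst_pair (t' (K Y))) comp_addr !fmap_compK.
rewrite (cone_fst_inl (s' Y)) (cone_fst_inr (s' Y)) fmap_id (additive0 HT).
by rewrite comp0l comp_idl hadd0r; reflexivity.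
Qed.

Lemma fk_b_mk n V a b c : fk_b n ∘ fk_mk (n := n) (V := V) a b c ≈ b.
Proof.
rewrite fk_bE (cone_fst_pair (t' (K Y))) comp_addr !fmap_compK.
rewrite (cone_snd_inl (s' Y)) (cone_snd_inr (s' Y)) fmap_id (additive0 HT).
by rewrite comp0l comp_idl hadd0; reflexivity.
Qed.

Lemma fk_c_mk n V a b c : fk_c n ∘ fk_mk (n := n) (V := V) a b c ≈ c.
Proof.
rewrite fk_cE (cone_snd_pair (t' (K Y))) fmap_compK (cone_fst_inl (s' Y)).
by rewrite fmap_id comp_idl; reflexivity.
Qed.

Lemma fk_fst n V (x : V ~> cx FK n) :
  cone_fst (t' (K Y)) n ∘ x ≈ fmap T (cone_inl (s' Y) (isucc n)) ∘ (fk_a n ∘ x) +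
    fmap T (cone_inr (s' Y) (isucc n)) ∘ (fk_b n ∘ x).
Proof.
rewrite fk_aE fk_bE !fmap_compK -comp_addl -HT (cone_inl_inr (s' Y)) fmap_id comp_idl.
by reflexivity.
Qed.

Lemma fk_snd n V (x : V ~> cx FK n) :
  cone_snd (t' (K Y)) n ∘ x ≈ fmap E (cone_inl (s' Y) n) ∘ (fk_c n ∘ x).
Proof.
rewrite fk_cE fmap_compK -[X in X ≈ _]comp_idl -fmap_id.
rewrite -(cone_inl_inr (s' Y)) HE comp_addl [fmap E (_ ∘ cone_snd _ _)]fmap_comp.
rewrite -[fmap E (cone_inr _ _) ∘ _ ∘ _]compA [fmap E (cone_snd _ _) ∘ _]ES_zero comp0r hadd0r.
by reflexivity.
Qed.

Lemma fk_ext n V (x y : V ~> cx FK n) :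
  fk_a n ∘ x ≈ fk_a n ∘ y -> fk_b n ∘ x ≈ fk_b n ∘ y -> fk_c n ∘ x ≈ fk_c n ∘ y ->
  x ≈ y.
Proof.
move=> Ha Hb Hc; apply: (cone_ext (u := t' (K Y))).
  by rewrite !fk_fst Ha Hb; reflexivity.
by rewrite !fk_snd Hc; reflexivity.
Qed.

#[local] Opaque fk_a fk_b fk_c fk_mk.

Lemma cone_functor_d_inl' n : cd (K Y) n ∘ cone_inl (s' Y) n ≈
  - (cone_inl (s' Y) (isucc n) ∘ fmap L (cd Y (isucc n))) +
  cone_inr (s' Y) (isucc n) ∘ s (cx Y (isucc n)).
Proof. exact: cone_d_inl. Qed.

Lemma cone_functor_d_inr' n : cd (K Y) n ∘ cone_inr (s' Y) n ≈
  cone_inr (s' Y) (isucc n) ∘ fmap S (cd Y n).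
Proof. exact: cone_d_inr. Qed.

Lemma fk_a_d n V (x : V ~> cx FK n) : fk_a (isucc n) ∘ (cd FK n ∘ x) ≈
  fmap T (fmap L (cd Y (isucc (isucc n)))) ∘ (fk_a n ∘ x).
Proof.
rewrite fk_aE (cone_fst_d (u := t' (K Y))) fk_fst comp_oppr !comp_addr !fmap_compK.
rewrite -!compA cone_functor_d_inl' cone_functor_d_inr' comp_addr comp_oppr.
rewrite !(cone_fst_inlK (s' Y)) !(cone_fst_inrK (s' Y)).
rewrite hadd0r (additiveN HT) (additive0 HT) comp0l hadd0r comp_oppl hoppK.
by reflexivity.
Qed.

Lemma fk_b_d n V (x : V ~> cx FK n) : fk_b (isucc n) ∘ (cd FK n ∘ x) ≈
  - (fmap T (s (cx Y (isucc (isucc n)))) ∘ (fk_a n ∘ x) +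
     fmap T (fmap S (cd Y (isucc n))) ∘ (fk_b n ∘ x)).
Proof.
rewrite fk_bE (cone_fst_d (u := t' (K Y))) fk_fst comp_oppr !comp_addr !fmap_compK.
rewrite -!compA cone_functor_d_inl' cone_functor_d_inr' comp_addr comp_oppr.
rewrite !(cone_snd_inlK (s' Y)) !(cone_snd_inrK (s' Y)).
by rewrite hopp0 hadd0; reflexivity.
Qed.

Lemma fk_c_d n V (x : V ~> cx FK n) : fk_c (isucc n) ∘ (cd FK n ∘ x) ≈
  t (L (cx Y (isucc (isucc n)))) ∘ (fk_a n ∘ x) +
  - (fmap E (fmap L (cd Y (isucc n))) ∘ (fk_c n ∘ x)).
Proof.
rewrite fk_cE (cone_snd_d (u := t' (K Y))) fk_snd !comp_addr.
rewrite -[cm (t' (K Y)) (isucc n)]/(t (cx (K Y) (isucc n))).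
rewrite -(nt_natK t) -fk_aE !fmap_compK.
rewrite -compA cone_functor_d_inl' comp_addr comp_oppr.
rewrite !(cone_fst_inlK (s' Y)) !(cone_fst_inrK (s' Y)).
by rewrite hadd0r (additiveN HE) comp_oppl; reflexivity.
Qed.

(** The map from [E L Y + T S Y] to its quotient [Y], ignoring [T L Y]. The sign before [gamma]
    compensates the sign with which [T s] enters in [fk_b_d]; the contributions of [T L Y] then
    cancel by the first clause of [Hbc]. *)
Definition right_inverse_cm n : cx FK n ~> cx Y (isucc n) :=
  delta (cx Y (isucc n)) ∘ fk_c n + - (gamma (cx Y (isucc n)) ∘ fk_b n).

Lemma right_inverseE n V (x : V ~> cx FK n) : right_inverse_cm n ∘ x ≈
  delta (cx Y (isucc n)) ∘ (fk_c n ∘ x) + - (gamma (cx Y (isucc n)) ∘ (fk_b n ∘ x)).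
Proof. by rewrite /right_inverse_cm; push; reflexivity. Qed.

Lemma delta_d n V (x : V ~> E (L (cx Y n))) :
  delta _ ∘ (fmap E (fmap L (cd Y n)) ∘ x) ≈ cd Y n ∘ (delta _ ∘ x).
Proof. exact: (nt_natK delta). Qed.

Lemma gamma_d n V (x : V ~> T (S (cx Y n))) :
  gamma _ ∘ (fmap T (fmap S (cd Y n)) ∘ x) ≈ cd Y n ∘ (gamma _ ∘ x).
Proof. exact: (nt_natK gamma). Qed.

#[local] Opaque right_inverse_cm.

Lemma right_inverse_comm n :
  right_inverse_cm (isucc n) ∘ cd FK n ≈ (- cd Y (isucc n)) ∘ right_inverse_cm n.
Proof.
have [R _ _ _] := Hbc (cx Y (isucc (isucc n))).
rewrite -[cd FK n]comp_idr -[right_inverse_cm n]comp_idr comp_oppl.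
move: (idm _) => x; rewrite !right_inverseE fk_c_d fk_b_d.
rewrite !(comp_addr, comp_oppr) delta_d gamma_d.
by apply: (lin (precomp (fk_a n ∘ x) R)); push; abel.
Qed.

Definition right_inverse_map : F (K Y) ~> (shift_functor B Y : ComplexCat B) :=
  Build_ChainMap (X := FK) (Y := shift_complex Y) right_inverse_comm.

Lemma right_inverse_surj : cohomology_surj right_inverse_map.
Proof.
move=> n V y; rewrite -[cd (shift_functor B Y) _]/(- cd Y _) comp_oppl => dy.
have {}dy : cd Y _ ∘ y ≈ 0 by rewrite -[_ ∘ _]hoppK dy hopp0; reflexivity.
have [W [e [c [b [He Ey]]]]] := bicartesian_epi (Hbc (cx Y (isucc (isucc n)))) y.
have [_ M Lf _] := Hbc (cx Y (isucc (isucc (isucc n)))).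
(* A lift [(c, b)] of [y] need not be a cocycle, but its differential maps to zero in [Y], hence
   comes from some [w] in [T L Y], which completes the lift to a cocycle of [F K Y]. *)
have [|w [Ew Ew']] := Lf _ (fmap E (fmap L (cd Y _)) ∘ c) (fmap T (fmap S (cd Y _)) ∘ b).
  rewrite delta_d gamma_d.
  apply: (lin (precomp e dy)).
  by apply: (lin (postcomp (cd Y _) Ey)); push; abel.
exists W, e, (fk_mk w (- b) c), 0; split=> //.
  rewrite -[cd (F (K Y)) _]/(cd FK _).
  apply: fk_ext.
  - rewrite fk_a_d fk_a_mk comp0r.
    (* [w] is closed since its images in [E L Y] and [T S Y] are differentials and these two maps
       are jointly mono. *)
    have [_ M' _ _] := Hbc (cx Y (isucc (isucc (isucc (isucc n))))).
    apply: M'.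
      rewrite (nt_natK t) Ew.
      by rewrite (map_dd (G := functor_comp E L) (additive_comp HE HL)); reflexivity.
    rewrite (fmap_nt_natK s) Ew'.
    by rewrite (map_dd (G := functor_comp T S) (additive_comp HT HS)); reflexivity.
  - by rewrite fk_b_d fk_a_mk fk_b_mk Ew'; push; abel.
  - by rewrite fk_c_d fk_a_mk fk_c_mk Ew; push; abel.
rewrite -[cm right_inverse_map _]/(right_inverse_cm (isucc n)).
by rewrite right_inverseE fk_b_mk fk_c_mk -Ey; push; abel.
Qed.

Lemma right_inverse_inj : cohomology_inj right_inverse_map.
Proof.
move=> n V z y; rewrite -[cm right_inverse_map _]/(right_inverse_cm (isucc n)).
rewrite -[cd (F (K Y)) _]/(cd FK _) -[cd (F (K Y)) _]/(cd FK _).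
rewrite -[cd (shift_functor B Y) _]/(- cd Y _) comp_oppl => dz Ez.
pose a := fk_a _ ∘ z; pose b := fk_b _ ∘ z; pose c := fk_c _ ∘ z.
have [ea eb ec] : [/\ fk_a _ ∘ z ≈ a, fk_b _ ∘ z ≈ b & fk_c _ ∘ z ≈ c].
  by split; reflexivity.
have hb : fmap T (s _) ∘ a + fmap T (fmap S (cd Y _)) ∘ b ≈ 0.
  by rewrite -[X in X ≈ _]hoppK -fk_b_d dz comp0r hopp0; reflexivity.
have hc : t _ ∘ a + - (fmap E (fmap L (cd Y _)) ∘ c) ≈ 0.
  by rewrite -fk_c_d dz comp0r; reflexivity.
have hy : delta _ ∘ c + - (gamma _ ∘ b) ≈ - (cd Y _ ∘ y).
  by rewrite -right_inverseE Ez; reflexivity.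
clearbody a b c.
(* A local lift of [y] to [E L Y + T S Y] supplies the last two components of the bounding element,
   up to sign; the failure of these to bound [(b, c)] maps to zero in [Y] and so is accounted for by
   [w] in [T L Y]. *)
have [W [e [c' [b' [He Ey]]]]] := bicartesian_epi (Hbc (cx Y (isucc n))) y.
have [_ _ Lf _] := Hbc (cx Y (isucc (isucc n))).
have [|w [Ew Ew']] := Lf _ (c ∘ e + fmap E (fmap L (cd Y _)) ∘ c')
                           (- (b ∘ e) + fmap T (fmap S (cd Y _)) ∘ b').
  rewrite !comp_addr delta_d gamma_d.
  apply: (lin (precomp e hy)).
  by apply: (lin (postcomp (cd Y _) Ey)); push; abel.
exists W, e, (fk_mk w (- b') c'); split=> //.
apply: fk_ext.
- rewrite fk_a_d fk_a_mk compA ea.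
  have [_ M _ _] := Hbc (cx Y (isucc (isucc (isucc n)))).
  apply: hsub0; apply: M; rewrite comp_addr comp_oppr.
    rewrite (nt_natK t) Ew comp_addr.
    rewrite (map_dd (G := functor_comp E L) (additive_comp HE HL)).
    by apply: (lin (symmetry (precomp e hc))); push; abel.
  rewrite (fmap_nt_natK s) Ew' comp_addr.
  rewrite (map_dd (G := functor_comp T S) (additive_comp HT HS)).
  by apply: (lin (symmetry (precomp e hb))); push; abel.
- by rewrite fk_b_d fk_a_mk fk_b_mk Ew' compA eb; push; abel.
- by rewrite fk_c_d fk_a_mk fk_c_mk Ew compA ec; push; abel.
Qed.

Lemma right_inverse_quasi_iso : quasi_iso right_inverse_map.
Proof. by apply/quasi_isoP; split; [exact: right_inverse_inj|exact: right_inverse_surj]. Qed.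

End Elements.

#[local] Opaque fk_a fk_b fk_c fk_mk right_inverse_cm.

Section Naturality.
Context (X Y : ComplexCat B) (f : X ~> Y).

Lemma fk_b_nat n V (x : V ~> cx (F (K X)) n) :
  fk_b Y n ∘ (cm (fmap F (fmap K f)) n ∘ x) ≈
  fmap T (fmap S (cm f (isucc n))) ∘ (fk_b X n ∘ x).
Proof.
rewrite !fk_bE (cone_functor_fst (fmap K f)) !fmap_compK.
by rewrite (_ : cone_snd _ _ ∘ cm (fmap K f) _ ≈ _); [reflexivity | exact: cone_map_snd].
Qed.

Lemma fk_c_nat n V (x : V ~> cx (F (K X)) n) :
  fk_c Y n ∘ (cm (fmap F (fmap K f)) n ∘ x) ≈
  fmap E (fmap L (cm f (isucc n))) ∘ (fk_c X n ∘ x).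
Proof.
rewrite !fk_cE (cone_functor_snd (fmap K f)) !fmap_compK.
by rewrite (_ : cone_fst _ _ ∘ cm (fmap K f) _ ≈ _); [reflexivity | exact: cone_map_fst].
Qed.

Lemma right_inverse_nat :
  right_inverse_map Y ∘ fmap F (fmap K f) ≈
  fmap (shift_functor B) f ∘ right_inverse_map X.
Proof.
move=> n.
rewrite -[X in X ≈ _]/(right_inverse_cm Y n ∘ cm (fmap F (fmap K f)) n).
rewrite -[X in _ ≈ X]/(cm f (isucc n) ∘ right_inverse_cm X n).
rewrite -[cm (fmap F (fmap K f)) n]comp_idr -[right_inverse_cm X n]comp_idr.
rewrite !right_inverseE fk_b_nat fk_c_nat comp_addr comp_oppr.
by rewrite (nt_natK delta) (nt_natK gamma); reflexivity.
Qed.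

End Naturality.
End RightInverse.
End ConeEquivalence.

(** * Passage to derived categories *)

Section ConeFunctorDerived.
Context {A B : AbelianCat} {T E : Functor A B}.
Context (HT : additive T) (HE : additive E) (t : NatTrans T E).
Notation F := (cone_functor HT HE t).
Notation t' := (complex_nat HT HE t).

Lemma cone_functor_shift_nat (X Y : ComplexCat A) (f : X ~> Y) :
  cone_functor_shift HT HE t Y ∘ fmap F (fmap (shift_functor A) f) ≈
  fmap (shift_functor B) (fmap F f) ∘ cone_functor_shift HT HE t X.
Proof.
move=> n.
rewrite -[X in X ≈ _]/(cone_functor_shift_cm HT HE t Y n ∘
  cm (fmap F (fmap (shift_functor A) f)) n).
rewrite -[X in _ ≈ X]/(cm (fmap F f) (isucc n) ∘ cone_functor_shift_cm HT HE t X n).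
rewrite -[cone_functor_shift_cm HT HE t X n]comp_idr.
rewrite -[cm (fmap F (fmap (shift_functor A) f)) n]comp_idr.
apply: (cone_ext (u := t' Y)).
  rewrite cone_functor_shift_fstK (cone_functor_fst (fmap (shift_functor A) f)).
  rewrite (cone_functor_fst f) cone_functor_shift_fstK comp_oppr.
  by reflexivity.
rewrite cone_functor_shift_sndK (cone_functor_snd (fmap (shift_functor A) f)).
rewrite (cone_functor_snd f) cone_functor_shift_sndK.
by reflexivity.
Qed.

Hypothesis qT : preserves_quasi_iso (complex_functor HT).
Hypothesis qE : preserves_quasi_iso (complex_functor HE).

Definition derived_cone_functor : Functor (derived_cat A) (derived_cat B) :=
  loc_map (cone_functor_quasi_iso t qT qE).
Notation DF := derived_cone_functor.
Notation QA := (loc_functor (@quasi_iso A)).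
Notation QB := (loc_functor (@quasi_iso B)).

Definition derived_cone_functor_shift :
    NatTrans (functor_comp DF (derived_shift A)) (functor_comp (derived_shift B) DF).
Proof.
unshelve refine (@loc_nat_trans _ _ _ (functor_comp DF (derived_shift A))
  (functor_comp (derived_shift B) DF)
  (fun X => fmap QB (cone_functor_shift HT HE t X)) _).
move=> X Y f.
transitivity (fmap QB (cone_functor_shift HT HE t Y ∘ fmap F (fmap (shift_functor A) f))).
  by symmetry; apply: (fmap_comp QB).
transitivity (fmap QB (fmap (shift_functor B) (fmap F f) ∘ cone_functor_shift HT HE t X)).
  by apply: (fmap_proper QB); apply: cone_functor_shift_nat.
exact: (fmap_comp QB).
Defined.

(** If a triangle is identified with the standard one of [u], its image is identified with that of
    [fmap F u]; the third identification is preceded by the isomorphism of [cone (fmap F u)] with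
    [F (cone u)]. *)
Lemma derived_cone_functor_distinguished (X Y Z : derived_cat A)
    (f : X ~> Y) (g : Y ~> Z) (h : Z ~> derived_shift A X) :
  derived_distinguished f g h ->
  derived_distinguished (fmap DF f) (fmap DF g)
    (derived_cone_functor_shift X ∘ fmap DF h).
Proof.
move=> [X' [Y' [u [a [b [c [[Ha Hb Hc] [Ef Eg Eh]]]]]]]].
exists (F X'), (F Y'), (fmap F u), (fmap DF a), (fmap DF b).
exists (fmap DF c ∘ fmap QB (cone_functor_cone HT HE t u)).
split.
  split; try exact: is_iso_fmap.
  apply: is_iso_comp; first exact: is_iso_fmap.
  by apply: is_iso_fmap; apply: cone_functor_cone_iso.
split.
- transitivity (fmap DF (f ∘ a)); first by symmetry; exact: (fmap_comp DF).
  transitivity (fmap DF (b ∘ fmap QA u)); first exact: (fmap_proper DF).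
  exact: (fmap_comp DF).
- transitivity (fmap DF (g ∘ b)); first by symmetry; exact: (fmap_comp DF).
  transitivity (fmap DF (c ∘ fmap QA (cone_in u))); first exact: (fmap_proper DF).
  transitivity (fmap DF c ∘ fmap DF (fmap QA (cone_in u))); first exact: (fmap_comp DF).
  apply: (transitivity (y := fmap DF c ∘
    (fmap QB (cone_functor_cone HT HE t u) ∘ fmap QB (cone_in (fmap F u))))).
    apply: (postcomp (C := derived_cat B)).
    apply: (transitivity (y := fmap QB (cone_functor_cone HT HE t u ∘ cone_in (fmap F u)))).
      by apply: (fmap_proper QB); symmetry; apply: cone_functor_cone_in.
    exact: (fmap_comp QB).
  exact: (compA (c := derived_cat B)).
- set th := fmap QB _; set ph := nt _ _.
  transitivity (ph ∘ (fmap DF (h ∘ c) ∘ th)).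
    transitivity (ph ∘ (fmap DF h ∘ (fmap DF c ∘ th))).
      by symmetry; exact: (compA (c := derived_cat B)).
    apply: (postcomp (C := derived_cat B)).
    transitivity (fmap DF h ∘ fmap DF c ∘ th); first exact: (compA (c := derived_cat B)).
    by apply: (precomp (C := derived_cat B)); symmetry; apply: (fmap_comp DF).
  transitivity (ph ∘ (fmap DF (fmap (derived_shift A) a) ∘
     (fmap DF (fmap QA (cone_out u)) ∘ th))).
    apply: (postcomp (C := derived_cat B)).
    transitivity (fmap DF (fmap (derived_shift A) a) ∘ fmap DF (fmap QA (cone_out u)) ∘ th).
      apply: (precomp (C := derived_cat B)).
      transitivity (fmap DF (fmap (derived_shift A) a ∘ fmap QA (cone_out u))).
        exact: (fmap_proper DF).
      exact: (fmap_comp DF).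
    by symmetry; exact: (compA (c := derived_cat B)).
  transitivity (ph ∘ fmap DF (fmap (derived_shift A) a) ∘
     (fmap DF (fmap QA (cone_out u)) ∘ th)).
    exact: (compA (c := derived_cat B)).
  transitivity (fmap (derived_shift B) (fmap DF a) ∘ derived_cone_functor_shift X' ∘
     (fmap DF (fmap QA (cone_out u)) ∘ th)).
    by apply: (precomp (C := derived_cat B)); exact: (nt_nat derived_cone_functor_shift a).
  transitivity (fmap (derived_shift B) (fmap DF a) ∘ (derived_cone_functor_shift X' ∘
     (fmap DF (fmap QA (cone_out u)) ∘ th))).
    by symmetry; exact: (compA (c := derived_cat B)).
  apply: (postcomp (C := derived_cat B)).
  transitivity (fmap QB (cone_functor_shift HT HE t X' ∘
    (fmap F (cone_out u) ∘ cone_functor_cone HT HE t u))).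
    transitivity (fmap QB (cone_functor_shift HT HE t X') ∘
      fmap QB (fmap F (cone_out u) ∘ cone_functor_cone HT HE t u)).
      apply: (postcomp (C := derived_cat B)); symmetry; exact: (fmap_comp QB).
    by symmetry; exact: (fmap_comp QB).
  by apply: (fmap_proper QB); apply: cone_functor_cone_out.
Qed.

End ConeFunctorDerived.

Section ConeEquivalenceDerived.
Context {A B : AbelianCat} {T E : Functor A B} {S L : Functor B A}.
Context (HT : additive T) (HE : additive E) (HS : additive S) (HL : additive L).
Context (t : NatTrans T E) (s : NatTrans L S).
Hypothesis qT : preserves_quasi_iso (complex_functor HT).
Hypothesis qE : preserves_quasi_iso (complex_functor HE).
Hypothesis qS : preserves_quasi_iso (complex_functor HS).
Hypothesis qL : preserves_quasi_iso (complex_functor HL).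
Context (alpha : NatTrans (functor_id A) (functor_comp L E)).
Context (beta : NatTrans (functor_id A) (functor_comp S T)).
Hypothesis LT0 : forall X, idm (L (T X)) ≈ 0.
Hypothesis Hbc : forall X, bicartesian (alpha X) (beta X) (s (E X)) (fmap S (t X)).
Context (gamma : NatTrans (functor_comp T S) (functor_id B)).
Context (delta : NatTrans (functor_comp E L) (functor_id B)).
Hypothesis ES0 : forall Y, idm (E (S Y)) ≈ 0.
Hypothesis Hbc' : forall Y, bicartesian (t (L Y)) (fmap T (s Y)) (delta Y) (gamma Y).

Notation F := (cone_functor HT HE t).
Notation K := (cone_functor HL HS s).
Notation DF := (derived_cone_functor t qT qE).
Notation DK := (derived_cone_functor s qL qS).
Notation QA := (loc_functor (@quasi_iso A)).
Notation QB := (loc_functor (@quasi_iso B)).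

Lemma derived_left_inverse : nat_iso (derived_shift A) (functor_comp DK DF).
Proof.
unshelve eexists (@loc_nat_trans _ _ _ (derived_shift A) (functor_comp DK DF)
  (fun X => fmap QA (left_inverse_map HT HE HS HL LT0 Hbc X)) _).
  move=> X Y f.
  transitivity (fmap QA (left_inverse_map HT HE HS HL LT0 Hbc Y ∘
    fmap (shift_functor A) f)); first by symmetry; exact: (fmap_comp QA).
  transitivity (fmap QA (fmap K (fmap F f) ∘ left_inverse_map HT HE HS HL LT0 Hbc X)).
    by apply: (fmap_proper QA); apply: left_inverse_nat.
  exact: (fmap_comp QA).
by move=> X; apply: loc_mor_iso; apply: left_inverse_quasi_iso.
Qed.

Lemma derived_right_inverse : nat_iso (functor_comp DF DK) (derived_shift B).
Proof.
unshelve eexists (@loc_nat_trans _ _ _ (functor_comp DF DK) (derived_shift B)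
  (fun Y => fmap QB (right_inverse_map HT HE HS HL ES0 Hbc' Y)) _).
  move=> X Y f.
  transitivity (fmap QB (right_inverse_map HT HE HS HL ES0 Hbc' Y ∘ fmap F (fmap K f))).
    by symmetry; exact: (fmap_comp QB).
  transitivity (fmap QB (fmap (shift_functor B) f ∘
    right_inverse_map HT HE HS HL ES0 Hbc' X)).
    by apply: (fmap_proper QB); apply: right_inverse_nat.
  exact: (fmap_comp QB).
by move=> X; apply: loc_mor_iso; apply: right_inverse_quasi_iso.
Qed.

(** [K] inverts [F] up to the shift, which is invertible. The inverse shift is applied after [K] on
    one side and before it on the other, so the left and right inverses are formally different
    functors. *)
Theorem cone_triangulated_equiv : triangulated_equiv (derived A) (derived B).
Proof.
exists DF, (derived_cone_functor_shift t qT qE); split; last split.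
- apply: (equivalence_of_inverses (L := functor_comp (derived_unshift A) DK)
    (R := functor_comp DK (derived_unshift B))).
    apply: nat_iso_trans (nat_iso_inv (nat_iso_assoc _ _ _)) _.
    apply: nat_iso_trans (derived_unshiftK A).
    exact: (nat_iso_whisker_left _ (nat_iso_inv derived_left_inverse)).
  apply: nat_iso_trans (nat_iso_assoc _ _ _) _.
  apply: nat_iso_trans (derived_shiftK B).
  exact: (nat_iso_whisker_right _ derived_right_inverse).
- by move=> X; apply: (is_iso_fmap QB); apply: cone_functor_shift_iso.
- exact: derived_cone_functor_distinguished.
Qed.

End ConeEquivalenceDerived.

Lemma derived_equiv_trans (A1 A2 A3 : AbelianCat) :
  triangulated_equiv (derived A1) (derived A2) ->
  triangulated_equiv (derived A2) (derived A3) ->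
  triangulated_equiv (derived A1) (derived A3).
Proof.
move=> [F [phi [eF [iF dF]]]] [G [psi [eG [iG dG]]]].
pose a X := psi (F X) ∘ fmap G (phi X).
have aN (X Y : derived A1) (f : X ~> Y) :
    a Y ∘ fmap (functor_comp (functor_comp G F) (tshift _)) f ≈
    fmap (functor_comp (tshift _) (functor_comp G F)) f ∘ a X.
  transitivity (psi (F Y) ∘ (fmap G (phi Y) ∘
    fmap G (fmap (functor_comp F (tshift (derived A1))) f))).
    by symmetry; exact: (compA (c := derived_cat A3)).
  transitivity (psi (F Y) ∘ (fmap G (fmap (functor_comp (tshift (derived A2)) F) f) ∘
    fmap G (phi X))).
    apply: postcomp; transitivity (fmap G (phi Y ∘
      fmap (functor_comp F (tshift (derived A1))) f)).
      by symmetry; exact: (fmap_comp G).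
    transitivity (fmap G (fmap (functor_comp (tshift (derived A2)) F) f ∘ phi X)).
      by apply: (fmap_proper G); exact: (nt_nat phi).
    exact: (fmap_comp G).
  transitivity (psi (F Y) ∘ fmap (functor_comp G (tshift (derived A2))) (fmap F f) ∘
    fmap G (phi X)).
    exact: (compA (c := derived_cat A3)).
  transitivity (fmap (functor_comp (tshift (derived A3)) G) (fmap F f) ∘ psi (F X) ∘
    fmap G (phi X)).
    by apply: precomp; exact: (nt_nat psi).
  by symmetry; exact: (compA (c := derived_cat A3)).
exists (functor_comp G F), (@Build_NatTrans _ _
  (functor_comp (functor_comp G F) (tshift (derived A1)))
  (functor_comp (tshift (derived A3)) (functor_comp G F)) a aN); split; last split.
- exact: equivalence_comp.
- by move=> X; apply: is_iso_comp; [apply: iG | exact: (is_iso_fmap G (iF X))].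
- move=> X Y Z f g h /dF /dG.
  move=> [X' [Y' [u [b [c [d [Hiso [Ef Eg Eh]]]]]]]].
  (* The triangle obtained from [G] after [F] differs from the required one only by functoriality of
     [G] in the third map. *)
  exists X', Y', u, b, c, d; split=> //; split=> //.
  apply: transitivity Eh; apply: precomp.
  transitivity (psi (F X) ∘ (fmap G (phi X) ∘ fmap G (fmap F h))).
    by symmetry; exact: (compA (c := derived_cat A3)).
  by apply: postcomp; symmetry; exact: (fmap_comp G).
Qed.

(** * Functor categories *)

Section Pointwise.
Context {C : Category} {A : AbelianCat}.
Notation AC := (FunctorAb C A).

Program Definition eval_functor (c : C) : Functor AC A :=
  {| fob F := fob (F : Functor C A) c; fmap F G a := nt a c |}.
Next Obligation. by move=> c F G a b; apply. Qed.
Next Obligation. by move=> *; reflexivity. Qed.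
Next Obligation. by move=> *; reflexivity. Qed.

Lemma eval_additive (c : C) : additive (eval_functor c).
Proof. by move=> F G a b; reflexivity. Qed.

Notation ev c := (complex_functor (eval_additive c)).

Lemma is_iso_pointwise (F G : AC) (a : F ~> G) :
  is_iso a <-> forall c, is_iso (nt a c).
Proof.
split; last exact: nt_is_iso.
by move=> Ha c; exact: (is_iso_fmap (eval_functor c) Ha).
Qed.

(** Kernels and cokernels of functors are pointwise, hence so is cohomology. The homology objects
    compared here rest on different proofs that [d d] is zero, a difference that the criterion by
    elements does not see. *)
Lemma quasi_iso_pointwise (X Y : ComplexCat AC) (f : X ~> Y) :
  quasi_iso f <-> forall c, quasi_iso (fmap (ev c) f).
Proof.
pose hm c n := homology_map (cdd X n c) (cdd Y n c) (cm_comm f n c) (cm_comm f (isucc n) c).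
have E c n : nt (cohomology_map f n) c ≈ hm c n.
  apply: coker_epi; rewrite /= !coker_descK; apply: postcomp.
  by apply: ker_mono; rewrite /= !ker_liftK; reflexivity.
split.
  move=> H c; apply/quasi_isoP; split=> n.
    have /is_iso_pointwise/(_ c)/(is_iso_heq (E c n)) := H n.
    by move/homology_isoP => [].
  have /is_iso_pointwise/(_ c)/(is_iso_heq (E c n)) := H n.
  by move/homology_isoP => [].
move=> H n; apply/is_iso_pointwise => c; apply: is_iso_heq (symmetry (E c n)) _.
by apply/homology_isoP; have /quasi_isoP[Hi Hs] := H c; split; [apply: Hi|apply: Hs].
Qed.

(** Lifts chosen at the single objects form a natural transformation because joint injectivity makes
    them unique. *)
Lemma bicartesian_pointwise (X P Q R : AC) (i : X ~> P) (j : X ~> Q)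
    (p : P ~> R) (q : Q ~> R) :
  (forall c, bicartesian (nt i c) (nt j c) (nt p c) (nt q c)) -> bicartesian i j p q.
Proof.
move=> H; split.
- by move=> c; have [] := H c.
- by move=> V x Hi Hj c; have [_ M _ _] := H c; apply: M; [apply: Hi|apply: Hj].
- move=> V a b Eab.
  have L c : exists x : fob V c ~> fob X c, nt i c ∘ x ≈ nt a c /\ nt j c ∘ x ≈ nt b c.
    by have [_ _ + _] := H c; apply; apply: Eab.
  pose x c := constructive_indefinite_description _ (L c).
  have xN c d (f : c ~> d) : sval (x d) ∘ fmap V f ≈ fmap X f ∘ sval (x c).
    case: (x c) (x d) => y [/= yi yj] [z [/= zi zj]].
    have [_ M _ _] := H d; apply: hsub0; apply: M; rewrite comp_addr comp_oppr !compA.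
      by rewrite zi !nt_nat -compA yi haddNr; reflexivity.
    by rewrite zj !nt_nat -compA yj haddNr; reflexivity.
  by exists {| nt_nat := xN |}; split=> c /=; case: (x c) => y [].
- by move=> V h Hp Hq c; have [_ _ _] := H c; apply; [apply: Hp|apply: Hq].
Qed.

End Pointwise.

(** * Equivalent index categories *)

Section Zero.
Context {A B : AbelianCat}.

Program Definition zero_functor : Functor A B :=
  {| fob _ := zob B; fmap _ _ _ := 0 |}.
Next Obligation. by move=> *; reflexivity. Qed.
Next Obligation. by move=> *; symmetry; apply: zob_init. Qed.
Next Obligation. by move=> *; rewrite comp0l; reflexivity. Qed.

Lemma zero_functor_additive : additive zero_functor.
Proof. by move=> *; rewrite /= hadd0; reflexivity. Qed.

Lemma zero_is_iso (X Y : B) (f : X ~> Y) : idm X ≈ 0 -> idm Y ≈ 0 -> is_iso f.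
Proof.
move=> X0 Y0; exists 0; split; first by rewrite comp0l X0; reflexivity.
by rewrite comp0r Y0; reflexivity.
Qed.

Lemma zob0 : idm (zob B) ≈ 0.
Proof. exact: zob_init. Qed.

Lemma zero_functor_quasi_iso :
  preserves_quasi_iso (complex_functor zero_functor_additive).
Proof.
by move=> X Y s _; apply: iso_quasi_iso; apply: complex_iso => n; apply: zero_is_iso; apply: zob0.
Qed.

Program Definition zero_nat (F G : Functor A B) : NatTrans F G := {| nt X := 0 |}.
Next Obligation. by move=> *; rewrite comp0l comp0r; reflexivity. Qed.

End Zero.

Section Precomposition.
Context (A : AbelianCat).

Program Definition precomp_functor (C D : Category) (H : Functor C D) :
    Functor (FunctorAb D A) (FunctorAb C A) :=
  {| fob F := functor_comp (F : Functor D A) H; fmap F G a := whisker_right a H |}.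
Next Obligation. by move=> C D H F G a b E c; apply: E. Qed.
Next Obligation. by move=> C D H F c; reflexivity. Qed.
Next Obligation. by move=> C D H F G K b a c; reflexivity. Qed.

Lemma precomp_additive (C D : Category) (H : Functor C D) : additive (precomp_functor H).
Proof. by move=> F G a b c; reflexivity. Qed.

Lemma precomp_quasi_iso (C D : Category) (H : Functor C D) :
  preserves_quasi_iso (complex_functor (precomp_additive H)).
Proof.
move=> X Y s /quasi_iso_pointwise Hs; apply/quasi_iso_pointwise => c.
have /quasi_isoP[Hi Hj] := Hs (H c).
by apply/quasi_isoP; split=> n; [apply: Hi|apply: Hj].
Qed.

(** The case [T = S = 0] of [cone_triangulated_equiv], with [E] and [L] given by composition with
    [H] and with its inverse: the cone of a map out of zero is its target, and the squares
    degenerate to isomorphisms. *)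
Lemma derived_equiv_of_equivalence (C D : Category) (H : Functor C D) :
  is_equivalence H ->
  triangulated_equiv (derived (FunctorAb D A)) (derived (FunctorAb C A)).
Proof.
move=> [K [[a Ha] /nat_iso_inv[b Hb]]].
have bN (X : FunctorAb D A) c d (f : c ~> d) :
    fmap X (b d) ∘ fmap X f ≈ fmap X (fmap H (fmap K f)) ∘ fmap X (b c).
  by rewrite -!fmap_comp; apply: fmap_proper; exact: (nt_nat b f).
have aN (X : FunctorAb C A) c d (f : c ~> d) :
    fmap X (a d) ∘ fmap X (fmap K (fmap H f)) ≈ fmap X f ∘ fmap X (a c).
  by rewrite -!fmap_comp; apply: fmap_proper; exact: (nt_nat a f).
pose al (X : FunctorAb D A) : X ~> precomp_functor K (precomp_functor H X) :=
  Build_NatTrans (G := functor_comp (functor_comp X H) K) (@bN X).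
pose de (X : FunctorAb C A) : precomp_functor H (precomp_functor K X) ~> X :=
  Build_NatTrans (F := functor_comp (functor_comp X K) H) (@aN X).
have @alpha : NatTrans (functor_id _) (functor_comp (precomp_functor K) (precomp_functor H)).
  exists al => X Y f c; symmetry; exact: (nt_nat f).
have @delta : NatTrans (functor_comp (precomp_functor H) (precomp_functor K)) (functor_id _).
  exists de => X Y f c; symmetry; exact: (nt_nat f).
apply: (@cone_triangulated_equiv _ _ zero_functor (precomp_functor H) zero_functor
  (precomp_functor K) zero_functor_additive (precomp_additive H) zero_functor_additive
  (precomp_additive K) (zero_nat _ _) (zero_nat _ _) zero_functor_quasi_iso
  (@precomp_quasi_iso _ _ H) zero_functor_quasi_iso (@precomp_quasi_iso _ _ K)
  alpha (zero_nat _ _) _ _ (zero_nat _ _) delta).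
- by move=> X c; apply: zob0.
- move=> X; apply: bicartesian_iso.
  + by rewrite comp0l comp0r hadd0; reflexivity.
  + apply/is_iso_pointwise => c; exact: (is_iso_fmap X (Hb c)).
  + by apply: zero_is_iso; apply: zob0.
- by move=> X c; apply: zob0.
- move=> X; apply: bicartesian_sym; apply: bicartesian_iso.
  + by rewrite comp0l !comp0r hadd0; reflexivity.
  + by apply: zero_is_iso; apply: zob0.
  + apply/is_iso_pointwise => c; exact: (is_iso_fmap X (Ha c)).
Qed.

End Precomposition.

(** * Reflection at a source *)

Section PathCategory.
Context {I : Type} (a : I -> I -> bool).

Inductive qpath : I -> I -> Type :=
| qnil x : qpath x x
| qcons x y z : a y z -> qpath x y -> qpath x z.

Fixpoint qcat x y z (q : qpath y z) : qpath x y -> qpath x z :=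
  match q with
  | qnil _ => fun p => p
  | qcons _ _ _ h q => fun p => qcons h (qcat q p)
  end.

Lemma qcatA x y z w (r : qpath z w) (q : qpath y z) (p : qpath x y) :
  qcat r (qcat q p) = qcat (qcat r q) p.
Proof. by elim: r q => {z w} //= z' z w h r IH q; rewrite IH. Qed.

Lemma qcat_nil x y (q : qpath x y) : qcat q (qnil x) = q.
Proof. by elim: q => //= {x y} x y z h q ->. Qed.

(** The free category on the graph [a]: a functor is prescribed by arbitrary maps on the arrows
    ([rep]), and naturality is checked on arrows only ([path_nat]). *)
Program Definition PathCat : Category :=
  {| Ob := I; Hom := qpath; heq _ _ := eq; idm := qnil; comp := qcat |}.
Next Obligation. by move=> x y z q q' p p' -> ->. Qed.
Next Obligation. by []. Qed.
Next Obligation. exact: qcat_nil. Qed.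
Next Obligation. exact: qcatA. Qed.

Definition qarr x y (h : a x y) : Hom (c := PathCat) x y := qcons h (qnil x).

Section Representation.
Context {A : Category} (V : I -> A) (m : forall x y, a x y -> V x ~> V y).

Fixpoint rep_map x y (p : qpath x y) : V x ~> V y :=
  match p with
  | qnil x => idm (V x)
  | qcons _ _ _ h p => m h ∘ rep_map p
  end.

Program Definition rep : Functor PathCat A := {| fob := V : PathCat -> A; fmap := rep_map |}.
Next Obligation. by move=> x y p q E; rewrite (E : p = q :> qpath x y); reflexivity. Qed.
Next Obligation. by move=> x; reflexivity. Qed.
Next Obligation.
move=> x y z q; elim: q => {y z} [y|y y' z h q IH] p /=.
  by rewrite comp_idl; reflexivity.
by rewrite IH compA; reflexivity.
Qed.

Lemma rep_arr x y (h : a x y) : fmap rep (qarr h) ≈ m h.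
Proof. exact: comp_idr. Qed.

End Representation.

Section RepresentationNat.
Context {A : Category} (F G : Functor PathCat A) (n : forall x : I, F x ~> G x).
Hypothesis Hn : forall x y (h : a x y), n y ∘ fmap F (qarr h) ≈ fmap G (qarr h) ∘ n x.

Lemma path_nat_subproof (x y : PathCat) (p : x ~> y) : n y ∘ fmap F p ≈ fmap G p ∘ n x.
Proof.
elim: p => {x y} [x|x y z h p IH].
  rewrite !(fmap_id _ (x : PathCat)) comp_idl comp_idr; reflexivity.
transitivity (n z ∘ (fmap F (qarr h) ∘ fmap F (p : Hom (c := PathCat) x y))).
  by apply: postcomp; exact: (fmap_comp F (qarr h) p).
rewrite compA Hn -compA IH compA; apply: precomp.
by symmetry; exact: (fmap_comp G (qarr h) p).
Qed.

Definition path_nat : NatTrans F G := Build_NatTrans path_nat_subproof.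

End RepresentationNat.

Section Act.
Context {A : PreadditiveCat} (X : Functor PathCat A).

(** Extended by zero to pairs without an arrow, so that the maps to or from a sum over neighbours
    can be indexed by vertices without proofs of adjacency. *)
Definition act x y : X x ~> X y :=
  match Bool.bool_dec (a x y) true with
  | left h => fmap X (qarr h)
  | right _ => 0
  end.

Lemma actE x y (h : a x y) : act x y ≈ fmap X (qarr h).
Proof.
rewrite /act; case: Bool.bool_dec => // h'; rewrite (bool_irrelevance h h').
by reflexivity.
Qed.

End Act.

Lemma act_nat (A : PreadditiveCat) (X Y : Functor PathCat A) (f : NatTrans X Y) x y :
  f y ∘ act X x y ≈ act Y x y ∘ f x.
Proof.
rewrite /act; case: Bool.bool_dec => [h|_]; first exact: nt_nat.
by rewrite comp0l comp0r; reflexivity.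
Qed.

End PathCategory.

(** * Finite direct sums *)

Section DirectSum.
Context {A : AbelianCat} {I : eqType}.
Implicit Types (W X Y : I -> A) (s : seq I).

Fixpoint dsum W s : A :=
  if s is y :: s' then biprod (W y) (dsum W s') else zob A.

Fixpoint tup W (V : A) (f : forall y, V ~> W y) s : V ~> dsum W s :=
  if s is y :: s' then bp_pair _ (f y) (tup f s') else 0.

Fixpoint cotup W (V : A) (f : forall y, W y ~> V) s : dsum W s ~> V :=
  if s is y :: s' then f y ∘ bp_prl _ + cotup f s' ∘ bp_prr _ else 0.

Fixpoint dmap X Y (f : forall y, X y ~> Y y) s : dsum X s ~> dsum Y s :=
  if s is y :: s' then bp_pair _ (f y ∘ bp_prl _) (dmap f s' ∘ bp_prr _) else 0.

Lemma dmap_proper X Y (f g : forall y, X y ~> Y y) s :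
  (forall y, f y ≈ g y) -> dmap f s ≈ dmap g s.
Proof.
move=> E; elim: s => [|y s IH] /=; first by reflexivity.
by rewrite /bp_pair E IH; reflexivity.
Qed.

Lemma dmap_id X s : dmap (fun y => idm (X y)) s ≈ idm _.
Proof.
elim: s => [|y s IH] /=; first by symmetry; apply: zob_init.
by rewrite /bp_pair IH !comp_idl bp_sum; reflexivity.
Qed.

Lemma dmap_tup X Y (V : A) (f : forall y, X y ~> Y y) (g : forall y, V ~> X y) s :
  dmap f s ∘ tup g s ≈ tup (fun y => f y ∘ g y) s.
Proof.
elim: s => [|y s IH] /=; first by rewrite comp0l; reflexivity.
apply: bp_ext.
  by rewrite compA !bp_fst -compA bp_fst; reflexivity.
by rewrite compA !bp_snd -compA bp_snd IH; reflexivity.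
Qed.

Lemma cotup_dmap X Y (V : A) (f : forall y, X y ~> Y y) (g : forall y, Y y ~> V) s :
  cotup g s ∘ dmap f s ≈ cotup (fun y => g y ∘ f y) s.
Proof.
elim: s => [|y s IH] /=; first by rewrite comp0l; reflexivity.
by rewrite comp_addl -!compA bp_fst bp_snd !compA IH; reflexivity.
Qed.

Lemma dmap_comp X Y Z (g : forall y, Y y ~> Z y) (f : forall y, X y ~> Y y) s :
  dmap (fun y => g y ∘ f y) s ≈ dmap g s ∘ dmap f s.
Proof.
elim: s => [|y s IH] /=; first by rewrite comp0l; reflexivity.
apply: bp_ext.
  by rewrite compA !bp_fst -!compA bp_fst; reflexivity.
by rewrite compA !bp_snd -!compA bp_snd IH -!compA; reflexivity.
Qed.

Lemma dmap_add X Y (f g : forall y, X y ~> Y y) s :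
  dmap (fun y => f y + g y) s ≈ dmap f s + dmap g s.
Proof.
elim: s => [|y s IH] /=; first by rewrite hadd0; reflexivity.
by rewrite /bp_pair IH !comp_addl !comp_addr; abel.
Qed.

Lemma tup_proper W (V : A) (f g : forall y, V ~> W y) s :
  (forall y, y \in s -> f y ≈ g y) -> tup f s ≈ tup g s.
Proof.
elim: s => [|y s IH] E /=; first by reflexivity.
rewrite /bp_pair E ?mem_head // IH; first by reflexivity.
by move=> z zs; apply: E; rewrite inE zs orbT.
Qed.

Lemma cotup_proper W (V : A) (f g : forall y, W y ~> V) s :
  (forall y, y \in s -> f y ≈ g y) -> cotup f s ≈ cotup g s.
Proof.
elim: s => [|y s IH] E /=; first by reflexivity.
rewrite E ?mem_head // IH; first by reflexivity.
by move=> z zs; apply: E; rewrite inE zs orbT.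
Qed.

Lemma tup_comp W (V V' : A) (f : forall y, V ~> W y) (h : V' ~> V) s :
  tup f s ∘ h ≈ tup (fun y => f y ∘ h) s.
Proof.
elim: s => [|y s IH] /=; first exact: comp0l.
by rewrite /bp_pair comp_addl -!compA IH; reflexivity.
Qed.

Lemma cotup_comp W (V V' : A) (f : forall y, W y ~> V) (h : V ~> V') s :
  h ∘ cotup f s ≈ cotup (fun y => h ∘ f y) s.
Proof.
elim: s => [|y s IH] /=; first exact: comp0r.
by rewrite comp_addr !compA IH; reflexivity.
Qed.

Lemma dsum_zero W s : (forall y, idm (W y) ≈ 0) -> idm (dsum W s) ≈ 0.
Proof.
move=> W0; elim: s => [|y s IH] /=; first exact: zob_init.
apply: bp_ext; rewrite comp_idr comp0r.
  by rewrite -[X in X ≈ _]comp_idl W0 comp0l; reflexivity.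
by rewrite -[X in X ≈ _]comp_idl IH comp0l; reflexivity.
Qed.

Section Kronecker.
Context (W : I -> A).

(** The entries of the identity matrix; the match on the equality gives the diagonal entry its
    type. *)
Definition kronecker y z : W y ~> W z :=
  match @eqP _ y z with
  | ReflectT e => match e in _ = z return W y ~> W z with erefl => idm _ end
  | ReflectF _ => 0
  end.

Lemma kronecker_id y : kronecker y y ≈ idm _.
Proof. by rewrite /kronecker; case: eqP => // e; rewrite (eq_irrelevance e erefl); reflexivity. Qed.

Lemma kronecker_neq y z : y != z -> kronecker y z ≈ 0.
Proof. by rewrite /kronecker; case: eqP => // _ _; reflexivity. Qed.

(** A column of the identity matrix, and [pr] a row. For a repeated index it would be the diagonal
    into all its copies, hence the condition [uniq s] below. *)
Definition inc s y : W y ~> dsum W s := tup (kronecker y) s.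
Definition pr s y : dsum W s ~> W y := cotup (fun z => kronecker z y) s.

Lemma cotup0 (V : A) (f : forall y, W y ~> V) s :
  (forall y, y \in s -> f y ≈ 0) -> cotup f s ≈ 0.
Proof.
elim: s => [|y s IH] E /=; first by reflexivity.
rewrite E ?mem_head // IH; first by rewrite !comp0l hadd0; reflexivity.
by move=> z zs; apply: E; rewrite inE zs orbT.
Qed.

Lemma tup0 (V : A) (f : forall y, V ~> W y) s :
  (forall y, y \in s -> f y ≈ 0) -> tup f s ≈ 0.
Proof.
elim: s => [|y s IH] E /=; first by reflexivity.
rewrite /bp_pair E ?mem_head // IH; first by rewrite !comp0r hadd0; reflexivity.
by move=> z zs; apply: E; rewrite inE zs orbT.
Qed.

Lemma inc_head s z : z \notin s -> inc (z :: s) z ≈ bp_inl _.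
Proof.
move=> zs; rewrite /inc /= /bp_pair kronecker_id tup0.
  by rewrite comp0r comp_idr hadd0r; reflexivity.
by move=> y ys; apply: kronecker_neq; apply/eqP => E; move: zs; rewrite E ys.
Qed.

Lemma inc_tail s z y : y != z -> inc (z :: s) y ≈ bp_inr _ ∘ inc s y.
Proof.
by move=> ne; rewrite /inc /= /bp_pair (kronecker_neq ne) comp0r hadd0; reflexivity.
Qed.

Lemma pr_head s z : z \notin s -> pr (z :: s) z ≈ bp_prl _.
Proof.
move=> zs; rewrite /pr /= kronecker_id cotup0.
  by rewrite comp0l comp_idl hadd0r; reflexivity.
by move=> y ys; apply: kronecker_neq; apply/eqP => E; move: zs; rewrite -E ys.
Qed.

Lemma pr_tail s z y : z != y -> pr (z :: s) y ≈ pr s y ∘ bp_prr _.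
Proof.
by move=> ne; rewrite /pr /= (kronecker_neq ne) comp0l hadd0; reflexivity.
Qed.

Lemma pr_tup (V : A) (f : forall y, V ~> W y) s y :
  uniq s -> y \in s -> pr s y ∘ tup f s ≈ f y.
Proof.
elim: s => //= z s IH /andP[zs us]; rewrite inE; case: eqVneq => [-> _|ne /= ys].
  by rewrite pr_head // bp_fst; reflexivity.
by rewrite pr_tail 1?eq_sym // -compA bp_snd; exact: IH.
Qed.

Lemma cotup_inc (V : A) (f : forall y, W y ~> V) s y :
  uniq s -> y \in s -> cotup f s ∘ inc s y ≈ f y.
Proof.
elim: s => //= z s IH /andP[zs us]; rewrite inE; case: eqVneq => [-> _|ne /= ys].
  by rewrite inc_head // comp_addl -!compA bp_ll bp_rl comp0r comp_idr hadd0r; reflexivity.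
rewrite inc_tail // comp_addl -!compA bp_lrK bp_rrK comp0r hadd0; exact: IH.
Qed.

Lemma dsum_ext (V : A) s (h k : V ~> dsum W s) : uniq s ->
  (forall y, y \in s -> pr s y ∘ h ≈ pr s y ∘ k) -> h ≈ k.
Proof.
elim: s h k => [|z s IH] h k /=.
  by move=> _ _; rewrite (zob_term h) (zob_term k); reflexivity.
move=> /andP[zs us] E; apply: bp_ext.
  by rewrite -(pr_head zs); apply: E; rewrite mem_head.
apply: IH => // y ys; rewrite !compA -(pr_tail s (z := z)).
  by apply: E; rewrite inE ys orbT.
by apply/eqP => Ez; move: zs; rewrite Ez ys.
Qed.

Lemma dsum_coext (V : A) s (h k : dsum W s ~> V) : uniq s ->
  (forall y, y \in s -> h ∘ inc s y ≈ k ∘ inc s y) -> h ≈ k.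
Proof.
elim: s h k => [|z s IH] h k /=.
  by move=> _ _; rewrite (zob_init h) (zob_init k); reflexivity.
move=> /andP[zs us] E; apply: bp_coext.
  by rewrite -(inc_head zs); apply: E; rewrite mem_head.
apply: IH => // y ys; rewrite -!compA -(inc_tail s (z := z)).
  by apply: E; rewrite inE ys orbT.
by apply/eqP => Ez; move: zs; rewrite -Ez ys.
Qed.

Lemma cotup_inc_id s : uniq s -> cotup (inc s) s ≈ idm _.
Proof.
by move=> us; apply: dsum_coext => // y ys; rewrite cotup_inc // comp_idl; reflexivity.
Qed.

Lemma tup_pr_id s : uniq s -> tup (pr s) s ≈ idm _.
Proof.
by move=> us; apply: dsum_ext => // y ys; rewrite pr_tup // comp_idr; reflexivity.
Qed.

End Kronecker.

Lemma kronecker_nat X Y (f : forall y, X y ~> Y y) y z :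
  f z ∘ kronecker X y z ≈ kronecker Y y z ∘ f y.
Proof.
case: (eqVneq y z) => [<-|ne].
  by rewrite !kronecker_id comp_idl comp_idr; reflexivity.
by rewrite !kronecker_neq // comp0l comp0r; reflexivity.
Qed.

Lemma pr_nat X Y (f : forall y, X y ~> Y y) s y :
  pr Y s y ∘ dmap f s ≈ f y ∘ pr X s y.
Proof.
rewrite /pr cotup_dmap cotup_comp; apply: cotup_proper => z _.
by symmetry; exact: kronecker_nat.
Qed.

Lemma inc_nat X Y (f : forall y, X y ~> Y y) s y :
  dmap f s ∘ inc X s y ≈ inc Y s y ∘ f y.
Proof.
by rewrite /inc dmap_tup tup_comp; apply: tup_proper => z _; exact: kronecker_nat.
Qed.

Section Homology.
Context (X0 X1 X2 Y0 Y1 Y2 : I -> A).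
Context (dX : forall y, X0 y ~> X1 y) (dX' : forall y, X1 y ~> X2 y).
Context (dY : forall y, Y0 y ~> Y1 y) (dY' : forall y, Y1 y ~> Y2 y).
Context (f : forall y, X1 y ~> Y1 y).

(** Each summand requires its own refinement of the domain; as there are finitely many, the
    refinements are composed along the list. *)
Lemma dsum_homology_inj s : (forall y, homology_inj (dX y) (dX' y) (dY y) (f y)) ->
  homology_inj (dmap dX s) (dmap dX' s) (dmap dY s) (dmap f s).
Proof.
move=> H; elim: s => [|z s IH] V y x' /=.
  move=> _ _; exists V, (idm V), 0; split; first exact: epi_id.
  by rewrite (zob_term (0 ∘ 0)) (zob_term (y ∘ _)); reflexivity.
move=> dy Ey.
have [||W [e [x1 [He Ex1]]]] := H z _ (bp_prl _ ∘ y) (bp_prl _ ∘ x').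
- by have := postcomp (bp_prl _) dy; rewrite compA bp_fst -compA comp0r.
- by have := postcomp (bp_prl _) Ey; rewrite !compA !bp_fst -!compA.
have [||W' [e' [x2 [He' Ex2]]]] := IH _ (bp_prr _ ∘ (y ∘ e)) (bp_prr _ ∘ (x' ∘ e)).
- have := postcomp (bp_prr _) (precomp e dy).
  by rewrite -compA compA bp_snd -!compA comp0l comp0r.
- have := postcomp (bp_prr _) (precomp e Ey).
  by rewrite -!compA [bp_prr _ ∘ _]compA bp_snd [bp_prr _ ∘ (bp_pair _ _ _ ∘ _)]compA bp_snd -!compA.
exists W', (e ∘ e'), (bp_pair _ (x1 ∘ e') x2); split; first exact: epi_comp.
apply: bp_ext.
  by rewrite compA bp_fst -compA bp_fst compA Ex1 !compA; reflexivity.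
by rewrite compA bp_snd -compA bp_snd Ex2 !compA; reflexivity.
Qed.

Lemma dsum_homology_surj s : (forall y, homology_surj (dX' y) (dY y) (dY' y) (f y)) ->
  homology_surj (dmap dX' s) (dmap dY s) (dmap dY' s) (dmap f s).
Proof.
move=> H; elim: s => [|z s IH] V y /=.
  move=> _; exists V, (idm V), 0, 0; split; first exact: epi_id.
    by rewrite comp0l; reflexivity.
  by rewrite (zob_term (0 ∘ 0)) (zob_term (_ + _)); reflexivity.
move=> dy.
have [|W [e [x1 [y1 [He dx1 Ex1]]]]] := H z _ (bp_prl _ ∘ y).
  by have := postcomp (bp_prl _) dy; rewrite compA bp_fst -compA comp0r.
have [|W' [e' [x2 [y2 [He' dx2 Ex2]]]]] := IH _ (bp_prr _ ∘ (y ∘ e)).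
  have := postcomp (bp_prr _) (precomp e dy).
  by rewrite -compA compA bp_snd -!compA comp0l comp0r.
exists W', (e ∘ e'), (bp_pair _ (x1 ∘ e') x2), (bp_pair _ (y1 ∘ e') y2); split.
- exact: epi_comp.
- apply: bp_ext.
    by rewrite compA bp_fst -compA bp_fst compA dx1 comp0l comp0r; reflexivity.
  by rewrite compA bp_snd -compA bp_snd dx2 comp0r; reflexivity.
- apply: bp_ext.
    rewrite comp_addr !compA !bp_fst -!compA !bp_fst !compA Ex1; push.
    by reflexivity.
  rewrite comp_addr !compA !bp_snd -!compA !bp_snd Ex2; push.
  by reflexivity.
Qed.

End Homology.

End DirectSum.

(** * Exchange of a source and a sink in a finite graph *)

Section Reflection.
Context {U : finType} (nb : pred U) (r : rel U).

(* The vertex [None] is a source of [source_arrow] and a sink of [sink_arrow], with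
   the same neighbours [nb]; [r] are the arrows between the other vertices. *)
Definition source_arrow (x y : option U) : bool :=
  match x, y with
  | Some u, Some v => r u v
  | None, Some v => nb v
  | _, None => false
  end.

Definition sink_arrow (x y : option U) : bool :=
  match x, y with
  | Some u, Some v => r u v
  | Some u, None => nb u
  | None, _ => false
  end.

Context (A : AbelianCat).
Notation AP := (FunctorAb (PathCat source_arrow) A).
Notation AQ := (FunctorAb (PathCat sink_arrow) A).
Notation nbs := (enum nb).

Lemma mem_nbs u : (u \in nbs) = nb u. Proof. exact: mem_enum. Qed.
Lemma uniq_nbs : uniq nbs. Proof. exact: enum_uniq. Qed.

Section Skyscraper.
Context (a1 a2 : rel (option U)).
Notation A1 := (FunctorAb (PathCat a1) A).
Notation A2 := (FunctorAb (PathCat a2) A).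

Definition sky_ob (V : option U -> A) (x : option U) : A :=
  if x is Some _ then zob A else V None.

Definition sky_map (V W : option U -> A) (f : forall x, V x ~> W x) (x : option U) :
    sky_ob V x ~> sky_ob W x :=
  match x with Some _ => 0 | None => f None end.

Definition sky_rep (X : A1) : A2 :=
  rep (a := a2) (V := sky_ob (fob X)) (fun _ _ _ => 0).

Lemma sky_nat (X Y : A1) (f : X ~> Y) x y (h : a2 x y) :
  sky_map (nt f) y ∘ fmap (sky_rep X) (qarr h) ≈
  fmap (sky_rep Y) (qarr h) ∘ sky_map (nt f) x.
Proof. by rewrite !rep_arr comp0l comp0r; reflexivity. Qed.

(* The representation concentrated at [None]; its arrows all act by zero. *)
Program Definition sky : Functor A1 A2 :=
  {| fob := sky_rep; fmap X Y f := path_nat (F := sky_rep X) (G := sky_rep Y)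
     (n := sky_map (nt f)) (@sky_nat X Y f) |}.
Next Obligation. by move=> X Y f g E [u|] /=; [reflexivity|apply: E]. Qed.
Next Obligation.
by move=> X [u|] /=; [symmetry; apply: zob_init|reflexivity].
Qed.
Next Obligation.
by move=> X Y Z g f [u|] /=; [rewrite comp0l|]; reflexivity.
Qed.

Lemma sky_additive : additive sky.
Proof. by move=> X Y f g [u|] /=; [rewrite hadd0|]; reflexivity. Qed.

Lemma sky_quasi_iso : preserves_quasi_iso (complex_functor sky_additive).
Proof.
move=> X Y s /quasi_iso_pointwise Hs; apply/quasi_iso_pointwise => -[u|].
  by apply: iso_quasi_iso; apply: complex_iso => n; apply: zero_is_iso; apply: zob0.
have /quasi_isoP[Hi Hj] := Hs None.
by apply/quasi_isoP; split=> n; [apply: Hi|apply: Hj].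
Qed.

End Skyscraper.

Definition sum_ob (V : option U -> A) (x : option U) : A :=
  if x is Some u then V (Some u) else dsum (fun u => V (Some u)) nbs.

Definition sum_map (V W : option U -> A) (f : forall x, V x ~> W x) (x : option U) :
    sum_ob V x ~> sum_ob W x :=
  match x with Some u => f (Some u) | None => dmap (fun u => f (Some u)) nbs end.

Definition sum_sink_map (X : AP) x y : sink_arrow x y -> sum_ob (fob X) x ~> sum_ob (fob X) y :=
  match x, y with
  | Some u, Some v => fun h =>
      fmap X (qarr (h : source_arrow (Some u) (Some v)))
  | Some u, None => fun _ => inc (fun u => fob X (Some u)) nbs u
  | None, _ => fun _ => 0
  end.

Definition sum_source_map (Y : AQ) x y :
    source_arrow x y -> sum_ob (fob Y) x ~> sum_ob (fob Y) y :=
  match x, y with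
  | Some u, Some v => fun h => fmap Y (qarr (h : sink_arrow (Some u) (Some v)))
  | None, Some v => fun _ => pr (fun u => fob Y (Some u)) nbs v
  | _, None => fun _ => 0
  end.

Definition sum_sink_rep (X : AP) : AQ := rep (sum_sink_map X).
Definition sum_source_rep (Y : AQ) : AP := rep (sum_source_map Y).

Lemma sum_sink_nat (X Y : AP) (f : X ~> Y) x y (h : sink_arrow x y) :
  sum_map (nt f) y ∘ fmap (sum_sink_rep X) (qarr h) ≈
  fmap (sum_sink_rep Y) (qarr h) ∘ sum_map (nt f) x.
Proof.
rewrite !rep_arr; case: x y h => [u|] [v|] //= h; first exact: (nt_nat f).
exact: (inc_nat (fun u => nt f (Some u))).
Qed.

Lemma sum_source_nat (X Y : AQ) (f : X ~> Y) x y (h : source_arrow x y) :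
  sum_map (nt f) y ∘ fmap (sum_source_rep X) (qarr h) ≈
  fmap (sum_source_rep Y) (qarr h) ∘ sum_map (nt f) x.
Proof.
rewrite !rep_arr; case: x y h => [u|] [v|] //= h; first exact: (nt_nat f).
by symmetry; exact: (pr_nat (fun u => nt f (Some u))).
Qed.

Program Definition sum_sink : Functor AP AQ :=
  {| fob := sum_sink_rep; fmap X Y f := path_nat (F := sum_sink_rep X) (G := sum_sink_rep Y)
     (n := sum_map (nt f)) (@sum_sink_nat X Y f) |}.
Next Obligation. by move=> X Y f g E [u|] /=; [|apply: dmap_proper => u]; apply: E. Qed.
Next Obligation. by move=> X [u|] /=; [reflexivity|exact: dmap_id]. Qed.
Next Obligation. by move=> X Y Z g f [u|] /=; [reflexivity|exact: dmap_comp]. Qed.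

Program Definition sum_source : Functor AQ AP :=
  {| fob := sum_source_rep; fmap X Y f := path_nat (F := sum_source_rep X) (G := sum_source_rep Y)
     (n := sum_map (nt f)) (@sum_source_nat X Y f) |}.
Next Obligation. by move=> X Y f g E [u|] /=; [|apply: dmap_proper => u]; apply: E. Qed.
Next Obligation. by move=> X [u|] /=; [reflexivity|exact: dmap_id]. Qed.
Next Obligation. by move=> X Y Z g f [u|] /=; [reflexivity|exact: dmap_comp]. Qed.

Lemma sum_sink_additive : additive sum_sink.
Proof. by move=> X Y f g [u|] /=; [reflexivity|exact: dmap_add]. Qed.

Lemma sum_source_additive : additive sum_source.
Proof. by move=> X Y f g [u|] /=; [reflexivity|exact: dmap_add]. Qed.

Lemma sum_sink_quasi_iso : preserves_quasi_iso (complex_functor sum_sink_additive).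
Proof.
move=> X Y s /quasi_iso_pointwise Hs; apply/quasi_iso_pointwise => -[u|];
  apply/quasi_isoP; split=> n.
- by have /quasi_isoP[H _] := Hs (Some u); apply: H.
- by have /quasi_isoP[_ H] := Hs (Some u); apply: H.
- by apply: dsum_homology_inj => u; have /quasi_isoP[H _] := Hs (Some u); apply: H.
- by apply: dsum_homology_surj => u; have /quasi_isoP[_ H] := Hs (Some u); apply: H.
Qed.

Lemma sum_source_quasi_iso : preserves_quasi_iso (complex_functor sum_source_additive).
Proof.
move=> X Y s /quasi_iso_pointwise Hs; apply/quasi_iso_pointwise => -[u|];
  apply/quasi_isoP; split=> n.
- by have /quasi_isoP[H _] := Hs (Some u); apply: H.
- by have /quasi_isoP[_ H] := Hs (Some u); apply: H.
- by apply: dsum_homology_inj => u; have /quasi_isoP[H _] := Hs (Some u); apply: H.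
- by apply: dsum_homology_surj => u; have /quasi_isoP[_ H] := Hs (Some u); apply: H.
Qed.

Notation T := (sky source_arrow sink_arrow).
Notation S := (sky sink_arrow source_arrow).
Notation E := sum_sink.
Notation L := sum_source.

Definition fan_out (X : AP) : fob X None ~> dsum (fun u => fob X (Some u)) nbs :=
  tup (fun u => act X None (Some u)) nbs.

Definition fan_in (Y : AQ) : dsum (fun u => fob Y (Some u)) nbs ~> fob Y None :=
  cotup (fun u => act Y (Some u) None) nbs.

Lemma fan_out_nat (X Y : AP) (f : X ~> Y) :
  fan_out Y ∘ nt f None ≈ dmap (fun u => nt f (Some u)) nbs ∘ fan_out X.
Proof.
rewrite /fan_out tup_comp dmap_tup; apply: tup_proper => u _.
by symmetry; exact: act_nat.
Qed.

Lemma fan_in_nat (X Y : AQ) (f : X ~> Y) :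
  nt f None ∘ fan_in X ≈ fan_in Y ∘ dmap (fun u => nt f (Some u)) nbs.
Proof.
rewrite /fan_in cotup_comp cotup_dmap; apply: cotup_proper => u _.
exact: act_nat.
Qed.

Lemma pr_fan_out (X : AP) v (h : source_arrow None (Some v)) :
  pr _ nbs v ∘ fan_out X ≈ fmap X (qarr h).
Proof.
transitivity (act X None (Some v)); last exact: actE.
by apply: (pr_tup (fun u => act X None (Some u)) uniq_nbs); rewrite mem_nbs.
Qed.

Lemma fan_in_inc (Y : AQ) u (h : sink_arrow (Some u) None) :
  fan_in Y ∘ inc _ nbs u ≈ fmap Y (qarr h).
Proof.
transitivity (act Y (Some u) None); last exact: actE.
by apply: (cotup_inc (fun v => act Y (Some v) None) uniq_nbs); rewrite mem_nbs.
Qed.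

(** The arrows into the sink of [E X] act by the inclusions of the summands, which together form the
    identity matrix. This gives the square at [None] an invertible side. *)
Lemma fan_in_sum_sink (X : AP) : fan_in (E X) ≈ idm _.
Proof.
transitivity (cotup (inc (fun u => fob X (Some u)) nbs) nbs); last first.
  exact: (cotup_inc_id _ uniq_nbs).
apply: cotup_proper => u.
rewrite mem_nbs => h.
apply: (transitivity (actE (sum_sink_rep X) (h : sink_arrow (Some u) None))).
exact: (rep_arr (sum_sink_map X)).
Qed.

Lemma fan_out_sum_source (Y : AQ) : fan_out (L Y) ≈ idm _.
Proof.
transitivity (tup (pr (fun u => fob Y (Some u)) nbs) nbs); last first.
  exact: (tup_pr_id _ uniq_nbs).
apply: tup_proper => u.
rewrite mem_nbs => h.
apply: (transitivity (actE (sum_source_rep Y) (h : source_arrow None (Some u)))).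
exact: (rep_arr (sum_source_map Y)).
Qed.


Definition point_to_sum_map (X : AP) x : sky_ob (fob X) x ~> sum_ob (fob X) x :=
  match x with Some _ => 0 | None => fan_out X end.

Lemma point_to_sum_arr (X : AP) x y (h : sink_arrow x y) :
  point_to_sum_map X y ∘ fmap (T X) (qarr h) ≈ fmap (E X) (qarr h) ∘ point_to_sum_map X x.
Proof.
rewrite [fmap (T X) _]rep_arr comp0r; case: x h => [u|] //= h.
by rewrite comp0r; reflexivity.
Qed.

Program Definition point_to_sum : NatTrans T E :=
  {| nt X := path_nat (F := sky_rep _ X) (G := sum_sink_rep X) (@point_to_sum_arr X) |}.
Next Obligation.
move=> X Y f [u|] /=; first by rewrite comp0l comp0r; reflexivity.
exact: fan_out_nat.
Qed.

Definition sum_to_point_map (Y : AQ) x : sum_ob (fob Y) x ~> sky_ob (fob Y) x :=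
  match x with Some _ => 0 | None => fan_in Y end.

Lemma sum_to_point_arr (Y : AQ) x y (h : source_arrow x y) :
  sum_to_point_map Y y ∘ fmap (L Y) (qarr h) ≈ fmap (S Y) (qarr h) ∘ sum_to_point_map Y x.
Proof.
rewrite [fmap (S Y) _]rep_arr comp0l; case: x y h => [u|] [v|] //= h;
by rewrite comp0l; reflexivity.
Qed.

Program Definition sum_to_point : NatTrans L S :=
  {| nt Y := path_nat (F := sum_source_rep Y) (G := sky_rep _ Y) (@sum_to_point_arr Y) |}.
Next Obligation.
move=> X Y f [u|] /=; first by rewrite comp0l comp0r; reflexivity.
by symmetry; exact: fan_in_nat.
Qed.

Definition unit_sum_map (X : AP) x : fob X x ~> fob (L (E X)) x :=
  match x with Some u => idm _ | None => fan_out X end.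

Lemma unit_sum_arr (X : AP) x y (h : source_arrow x y) :
  unit_sum_map X y ∘ fmap X (qarr h) ≈ fmap (L (E X)) (qarr h) ∘ unit_sum_map X x.
Proof.
rewrite [fmap (L (E X)) _]rep_arr; case: x y h => [u|] [v|] //= h.
  rewrite comp_idl comp_idr; symmetry; exact: (@rep_arr _ _ _ _ (sum_sink_map X) (Some u) (Some v) h).
by rewrite comp_idl; symmetry; exact: pr_fan_out.
Qed.

Program Definition unit_sum : NatTrans (functor_id AP) (functor_comp L E) :=
  {| nt X := path_nat (F := X) (G := sum_source_rep (sum_sink_rep X)) (@unit_sum_arr X) |}.
Next Obligation.
move=> X Y f [u|] /=; first by rewrite comp_idl comp_idr; reflexivity.
exact: fan_out_nat.
Qed.

(** No arrow ends at a source, so the part of [X] at [None] is a quotient representation. The sign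
    makes the square with [unit_sum] anticommute, as [bicartesian] demands. *)
Definition unit_sky_map (X : AP) x : fob X x ~> fob (S (T X)) x :=
  match x with Some u => 0 | None => - idm _ end.

Lemma unit_sky_arr (X : AP) x y (h : source_arrow x y) :
  unit_sky_map X y ∘ fmap X (qarr h) ≈ fmap (S (T X)) (qarr h) ∘ unit_sky_map X x.
Proof.
rewrite [fmap (S (T X)) _]rep_arr comp0l; case: x y h => [u|] [v|] //= h;
by rewrite comp0l; reflexivity.
Qed.

Program Definition unit_sky : NatTrans (functor_id AP) (functor_comp S T) :=
  {| nt X := path_nat (F := X) (G := sky_rep _ (sky_rep _ X)) (@unit_sky_arr X) |}.
Next Obligation.
move=> X Y f [u|] /=; first by rewrite comp0l comp0r; reflexivity.
by rewrite comp_oppl comp_oppr comp_idl comp_idr; reflexivity.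
Qed.

(** Dually, no arrow starts at a sink, so the part of [Y] at [None] is a subrepresentation; the sign
    has the same purpose. *)
Definition counit_sky_map (Y : AQ) x : fob (T (S Y)) x ~> fob Y x :=
  match x with Some u => 0 | None => - idm _ end.

Lemma counit_sky_arr (Y : AQ) x y (h : sink_arrow x y) :
  counit_sky_map Y y ∘ fmap (T (S Y)) (qarr h) ≈ fmap Y (qarr h) ∘ counit_sky_map Y x.
Proof.
rewrite [fmap (T (S Y)) _]rep_arr comp0r; case: x y h => [u|] [v|] //= h;
by rewrite comp0r; reflexivity.
Qed.

Program Definition counit_sky : NatTrans (functor_comp T S) (functor_id AQ) :=
  {| nt Y := path_nat (F := sky_rep _ (sky_rep _ Y)) (G := Y) (@counit_sky_arr Y) |}.
Next Obligation.
move=> X Y f [u|] /=; first by rewrite comp0l comp0r; reflexivity.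
by rewrite comp_oppl comp_oppr comp_idl comp_idr; reflexivity.
Qed.

Definition counit_sum_map (Y : AQ) x : fob (E (L Y)) x ~> fob Y x :=
  match x with Some u => idm _ | None => fan_in Y end.

Lemma counit_sum_arr (Y : AQ) x y (h : sink_arrow x y) :
  counit_sum_map Y y ∘ fmap (E (L Y)) (qarr h) ≈ fmap Y (qarr h) ∘ counit_sum_map Y x.
Proof.
rewrite [fmap (E (L Y)) _]rep_arr; case: x y h => [u|] [v|] //= h.
  by rewrite comp_idl !comp_idr; reflexivity.
by rewrite comp_idr; exact: fan_in_inc.
Qed.

Program Definition counit_sum : NatTrans (functor_comp E L) (functor_id AQ) :=
  {| nt Y := path_nat (F := sum_sink_rep (sum_source_rep Y)) (G := Y) (@counit_sum_arr Y) |}.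
Next Obligation.
move=> X Y f [u|] /=; first by rewrite comp_idl comp_idr; reflexivity.
by symmetry; exact: fan_in_nat.
Qed.

Lemma is_iso_opp_id (V : A) : is_iso (- idm V).
Proof. by exists (- idm V); rewrite comp_oppl comp_oppr hoppK comp_idl; split; reflexivity. Qed.

(** [L T] and [E S] vanish because [L] and [E] read only the vertices other than [None], where
    skyscrapers are zero. In the squares, away from [None] one pair of opposite sides consists of an
    identity and a map between zero objects; at [None] it consists of [- idm _] and the fan of a
    sum, which is the identity. *)
Lemma reflection_equiv : triangulated_equiv (derived AP) (derived AQ).
Proof.
apply: (@cone_triangulated_equiv AP AQ T E S L (@sky_additive _ _) sum_sink_additive
  (@sky_additive _ _) sum_source_additive point_to_sum sum_to_point
  (@sky_quasi_iso _ _) sum_sink_quasi_iso (@sky_quasi_iso _ _) sum_source_quasi_iso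
  unit_sum unit_sky _ _ counit_sky counit_sum).
- move=> X [u|]; first exact: zob0.
  by apply: dsum_zero => u; apply: zob0.
- move=> X; apply: bicartesian_pointwise => -[u|].
    apply: bicartesian_iso; last by apply: zero_is_iso; apply: zob0.
      by apply: zob_term.
    exact: is_iso_id.
  apply: bicartesian_sym; apply: bicartesian_iso.
  + rewrite /= comp_oppr comp_idr.
    rewrite (fan_in_sum_sink X) comp_idl haddN; reflexivity.
  + exact: is_iso_opp_id.
  + by apply: is_iso_heq (symmetry (fan_in_sum_sink X)) _; apply: is_iso_id.
- move=> Y [u|]; first exact: zob0.
  by apply: dsum_zero => u; apply: zob0.
- move=> Y; apply: bicartesian_pointwise => -[u|].
    apply: bicartesian_sym; apply: bicartesian_iso.
    + by rewrite /= !comp0r hadd0; reflexivity.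
    + by apply: zero_is_iso; apply: zob0.
    + exact: is_iso_id.
  apply: bicartesian_iso.
  + rewrite /= comp_oppl comp_idl.
    rewrite (fan_out_sum_source Y) comp_idr haddNr; reflexivity.
  + by apply: is_iso_heq (symmetry (fan_out_sum_source Y)) _; apply: is_iso_id.
  + exact: is_iso_opp_id.
Qed.

End Reflection.

(** * Orientations of trees *)

Section Bridge.
Context (G : tree).
Implicit Types x y z : vertex G.

Definition remove_edge x y : rel (vertex G) :=
  [rel u v | edge u v && ~~ ((u == x) && (v == y) || (u == y) && (v == x))].

Lemma remove_edge_sym x y : symmetric (remove_edge x y).
Proof.
move=> u v; rewrite /remove_edge /= edge_sym; congr (_ && ~~ _).
by rewrite orbC; congr (_ || _); rewrite andbC.
Qed.

(** A simple path that avoids the edge is closed up by it to a cycle. Paths with one or two vertices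
    are excluded separately: they would mean a loop, or the removed edge itself. *)
Lemma bridge x y : edge x y -> ~~ connect (remove_edge x y) x y.
Proof.
move=> exy; apply/negP => /connectP[p0 p0P y_def]; case/shortenP: p0P y_def.
move=> p pP up _ y_def {p0}.
have cyc : cycle (@edge G) (x :: p).
  rewrite /= rcons_path -y_def edge_sym exy andbT.
  by apply: sub_path pP => u v /andP[].
case: p pP up y_def cyc => [|v [|w p]] /= pP up y_def cyc.
- by rewrite y_def edge_irr in exy.
- by move: pP; rewrite /remove_edge /= y_def !eqxx andbF.
- have /negP[] := @tree_acyclic G (x :: v :: w :: p) isT.
  by apply/andP; split.
Qed.

Context (o : orientation G).

Lemma arrow_irr x : o x x = false.
Proof. by apply/negP => /arrow_edge; rewrite edge_irr. Qed.

Lemma arrow_not_connect x y : o x y -> ~~ connect o y x.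
Proof.
move=> oxy; apply/negP => cyx.
have := @orientation_anti G o x y; rewrite (connect1 oxy) cyx => /(_ isT) E.
by move: oxy; rewrite E arrow_irr.
Qed.

(* An oriented path to [w] does not visit the vertices after [w]. *)
Lemma connect_remove_edge w x y z :
  o w z -> connect o x w -> connect (remove_edge y z) x w.
Proof.
move=> owz /connectP[p pP w_def].
apply/connectP; exists p => //.
have below v : connect o v w -> v != z.
  by move=> cvw; apply: contraTneq cvw => ->; exact: arrow_not_connect.
elim: p x pP w_def => //= v p IH x /andP[oxv pP] w_def.
have cvw : connect o v w by apply/connectP; exists p.
have cxw : connect o x w by apply: connect_trans cvw; apply: connect1.
rewrite /remove_edge /= (arrow_edge oxv) (negbTE (below _ cvw)).
by rewrite (negbTE (below _ cxw)) andbF /= IH.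
Qed.

(** Otherwise the walk from [y] back to [x], on to [y'] and then to [z] avoids the edge between [y]
    and [z], against [bridge]. Hence the last arrow of an oriented path is determined by its
    ends. *)
Lemma arrow_target_inj x y y' z :
  o y z -> o y' z -> connect o x y -> connect o x y' -> y = y'.
Proof.
move=> oyz oy'z cxy cxy'; apply/eqP/negPn/negP => ne.
have /negP[] := bridge (arrow_edge oyz).
have sym := sym_connect_sym (remove_edge_sym y z).
apply: (@connect_trans _ _ x); first by rewrite sym; exact: connect_remove_edge oyz cxy.
apply: (@connect_trans _ _ y').
  exact: connect_remove_edge oy'z cxy'.
apply: connect1; rewrite /remove_edge /= (arrow_edge oy'z) eq_sym (negbTE ne) /=.
apply/negP => /andP[_ /eqP E]; by move: oyz; rewrite E arrow_irr.
Qed.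

End Bridge.

(** * The poset of an oriented tree as a path category, with vertices relabelled by [I] *)

Section PathPresentation.
Context {G : tree} (o : orientation G) (I : eqType) (f : I -> vertex G) (g : vertex G -> I).
Context (fK : cancel f g) (gK : cancel g f) (a : I -> I -> bool).
Hypothesis ha : forall i j, a i j = o (f i) (f j).
Notation P := (poset_cat (orientation_poset o)).

Lemma qpath_connect i j : qpath a i j -> connect o (f i) (f j).
Proof.
elim=> {i j} [i|i j k h _ IH]; first exact: connect0.
by apply: connect_trans IH _; apply: connect1; rewrite -ha.
Qed.

Lemma connect_qpath v w : connect o v w -> exists _ : qpath a (g v) (g w), True.
Proof.
move=> /connectP[p]; elim/last_ind: p w => [|p u IH] w /=.
  by move=> _ ->; exists (qnil a _).
rewrite rcons_path last_rcons => /andP[pP ou] ->.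
have [q _] := IH _ pP erefl; unshelve eexists (qcons _ q) => //.
by rewrite ha !gK.
Qed.

Lemma qpath_inv i k (q : qpath a i k) :
  (exists e : i = k, q = ecast z (qpath a i z) e (qnil a i)) \/
  (exists j (h : a j k) (p : qpath a i j), q = qcons h p).
Proof.
case: q => [x|x y z h p]; first by left; exists erefl.
by right; exists y, h, p.
Qed.

Lemma qpath_nil_uniq i (q : qpath a i i) : q = qnil a i.
Proof.
case: (qpath_inv q) => [[e ->]|[j [h [p _]]]].
  by rewrite (eq_irrelevance e erefl).
have oji : o (f j) (f i) by rewrite -ha.
by have := arrow_not_connect oji; rewrite (qpath_connect p).
Qed.

(** By [arrow_target_inj] two paths with the same ends have the same last arrow, and a closed path
    is trivial by antisymmetry. All equations between morphisms of the path category follow. *)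
Lemma qpath_uniq i j (p q : qpath a i j) : p = q.
Proof.
elim: p q => {i j} [i|i j k h p IH] q; first by rewrite (qpath_nil_uniq q).
case: (qpath_inv q) => [[e _]|[j' [h' [q' ->]]]].
  case: k / e h q => h q.
  have oji : o (f j) (f i) by rewrite -ha.
  by have := arrow_not_connect oji; rewrite (qpath_connect p).
have E : j = j'.
  apply: (can_inj fK); apply: (@arrow_target_inj G o (f i) _ _ (f k)).
  - by rewrite -ha.
  - by rewrite -ha.
  - exact: qpath_connect.
  - exact: qpath_connect.
by case: j' / E h' q' => h' q'; rewrite (IH q') (bool_irrelevance h h').
Qed.

Definition path_to_poset : Functor (PathCat a) P.
Proof.
unshelve refine (@Build_Functor (PathCat a) P (fun i => f i)
  (fun i j p => qpath_connect p) _ _ _); by [].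
Defined.

(** The order relation only asserts that a path exists, while a functor needs the path itself;
    uniqueness makes the choice functorial. *)
Definition connect_choice v w (h : connect o v w) : qpath a (g v) (g w) :=
  sval (constructive_indefinite_description _ (connect_qpath h)).

Definition poset_to_path : Functor P (PathCat a).
Proof.
unshelve refine (@Build_Functor P (PathCat a) (fun v => g v)
  (fun v w h => connect_choice h) _ _ _); by move=> *; apply: qpath_uniq.
Defined.

Lemma path_to_poset_to_path :
  nat_iso (functor_comp poset_to_path path_to_poset) (functor_id (PathCat a)).
Proof.
have to i : qpath a (g (f i)) i by rewrite fK; exact: qnil.
have from i : qpath a i (g (f i)) by rewrite fK; exact: qnil.
unshelve eexists (@Build_NatTrans _ _ (functor_comp poset_to_path path_to_poset)
  (functor_id (PathCat a)) to _); first by move=> *; apply: qpath_uniq.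
by move=> i; exists (from i); split; apply: qpath_uniq.
Qed.

Lemma poset_to_path_to_poset :
  nat_iso (functor_comp path_to_poset poset_to_path) (functor_id P).
Proof.
have to v : connect o (f (g v)) v by rewrite gK; exact: connect0.
have from v : connect o v (f (g v)) by rewrite gK; exact: connect0.
unshelve eexists (@Build_NatTrans _ _ (functor_comp path_to_poset poset_to_path)
  (functor_id P) to _); first by [].
by move=> v; exists (from v).
Qed.

Lemma path_to_poset_equivalence : is_equivalence path_to_poset.
Proof.
exists poset_to_path; split.
  exact: path_to_poset_to_path.
exact: poset_to_path_to_poset.
Qed.

Lemma poset_to_path_equivalence : is_equivalence poset_to_path.
Proof.
exists path_to_poset; split.
  exact: poset_to_path_to_poset.
exact: path_to_poset_to_path.
Qed.

Lemma derived_poset_path (A : AbelianCat) :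
  triangulated_equiv (derived (FunctorAb P A)) (derived (FunctorAb (PathCat a) A)).
Proof. exact: derived_equiv_of_equivalence path_to_poset_equivalence. Qed.

Lemma derived_path_poset (A : AbelianCat) :
  triangulated_equiv (derived (FunctorAb (PathCat a) A)) (derived (FunctorAb P A)).
Proof. exact: derived_equiv_of_equivalence poset_to_path_equivalence. Qed.

End PathPresentation.

(** * Reversal of arrows across the boundary of a vertex set *)

Section Orientations.
Context {G : tree}.
Implicit Types (o : orientation G) (D : {set vertex G}) (x y z : vertex G).

Definition orient_equiv o o' :=
  universally_derived_equivalent (orientation_poset o) (orientation_poset o').

Lemma orient_equiv_trans o1 o2 o3 : orient_equiv o1 o2 -> orient_equiv o2 o3 -> orient_equiv o1 o3.
Proof. by move=> H12 H23 A; exact: derived_equiv_trans (H12 A) (H23 A). Qed.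

(** Orientations with pointwise equal arrows need not be equal as records; the path category of [o]
    presents both posets. *)
Lemma orient_equiv_eq o o' : arrow o =2 arrow o' -> orient_equiv o o'.
Proof.
move=> E A.
apply: (derived_equiv_trans (A2 := FunctorAb (PathCat o) A)).
  by apply: (@derived_poset_path G o (vertex G) id id).
by apply: (@derived_path_poset G o' (vertex G) id id).
Qed.

(* Reversal of the arrows that cross the boundary of [D]. *)
Definition flip_rel o D : rel (vertex G) :=
  fun x y => if (x \in D) (+) (y \in D) then o y x else o x y.

Lemma flip_edge o D x y : flip_rel o D x y -> edge x y.
Proof.
by rewrite /flip_rel; case: ifP => _ /arrow_edge //; rewrite edge_sym.
Qed.

Lemma flip_dir o D x y : edge x y -> flip_rel o D x y = ~~ flip_rel o D y x.
Proof.
rewrite /flip_rel addbC => e; case: ifP => _; last exact: arrow_dir.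
by apply: arrow_dir; rewrite edge_sym.
Qed.

Definition flip o D : orientation G :=
  {| arrow_edge := @flip_edge o D; arrow_dir := @flip_dir o D |}.

Lemma flip_source o s : (forall x, ~~ o x s) -> orient_equiv o (flip o [set s]).
Proof.
move=> source A.
(* [None] stands for [s], adjoined to the remaining vertices, which brings both orientations into
   the form required by the reflection. *)
pose U := {x : vertex G | x != s}.
pose f (i : option U) : vertex G := if i is Some u then val u else s.
pose g (x : vertex G) : option U := insub x.
have fK : cancel f g.
  case=> [u|] /=; first exact: valK.
  by rewrite /g insubF // eqxx.
have gK : cancel g f.
  by move=> x; rewrite /g; case: insubP => [u _ <- //|/negPn/eqP ->].
pose nb : pred U := fun u => o s (val u).
pose r : rel U := fun u v => o (val u) (val v).
have src0 x : o x s = false by exact: negbTE.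
have ha i j : source_arrow nb r i j = o (f i) (f j).
  by case: i j => [u|] [v|] //=; rewrite src0.
have hb i j : sink_arrow nb r i j = flip o [set s] (f i) (f j).
  rewrite /= /flip_rel !inE; case: i j => [u|] [v|] /=.
  - by rewrite (negbTE (valP u)) (negbTE (valP v)).
  - by rewrite (negbTE (valP u)) eqxx.
  - by rewrite (negbTE (valP v)) eqxx src0.
  - by rewrite eqxx src0.
apply: derived_equiv_trans (derived_poset_path fK gK ha A) _.
apply: derived_equiv_trans (derived_path_poset fK gK hb A).
exact: reflection_equiv.
Qed.

Lemma source_in o D x0 : x0 \in D -> (forall x y, y \in D -> o x y -> x \in D) ->
  exists2 s, s \in D & forall x, ~~ o x s.
Proof.
move=> x0D closed.
(* A vertex of [D] that is reached from the fewest vertices is a source: a predecessor would again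
   lie in [D] and be reached from strictly fewer, as [s] does not reach it. *)
case: (arg_minnP (fun x => #|[pred z | connect o z x]|) x0D) => s sD s_min.
exists s => // x; apply/negP => oxs.
have /s_min := closed _ _ sD oxs; rewrite leqNgt => /negP[].
apply: proper_card; apply/properP; split.
  by apply/subsetP => z; rewrite !inE => czx; apply: connect_trans czx (connect1 oxs).
by exists s; rewrite !inE ?connect0 //; exact: arrow_not_connect.
Qed.

(** Induction on the size of [D], removing one source at a time. [o'] is only required to agree
    pointwise, since the flip at [s] followed by the flip at [D :\ s] is the flip at [D] only up to
    pointwise equality. *)
Lemma flip_closed o D o' : (forall x y, y \in D -> o x y -> x \in D) ->
  arrow o' =2 flip_rel o D -> orient_equiv o o'.
Proof.
have [n] := ubnP #|D|; elim: n D o o' => // n IH D o o' /ltnSE Dn closed E.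
have [D0|[x0 x0D]] := set_0Vmem D.
  by apply: orient_equiv_eq => x y; rewrite E /flip_rel D0 !inE.
have [s sD source] := source_in x0D closed.
apply: orient_equiv_trans (flip_source source) _.
apply: (IH (D :\ s)).
- by rewrite (leq_trans _ Dn) // [X in _ < X](cardsD1 s) sD.
(* After the flip [s] is a sink, so no arrow from [s] enters the rest of [D], which therefore stays
   closed under predecessors. *)
- move=> x y; rewrite /= /flip_rel !inE => /andP[ys yD].
  case: (eqVneq x s) => [->|xs]; rewrite (negbTE ys) /= => oxy.
    by rewrite (negbTE (source _)) in oxy.
  exact: closed oxy.
- move=> x y; rewrite E /flip_rel /= /flip_rel !inE.
  case: (eqVneq x s) => [->|xs]; case: (eqVneq y s) => [->|ys] //=; rewrite ?sD //=.
    by case: (y \in D).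
  by case: (x \in D).
Qed.

End Orientations.

Theorem corollary1p8 (G : tree) (o1 o2 : orientation G) :
  universally_derived_equivalent (orientation_poset o1) (orientation_poset o2).
Proof.
(* The edges on which the two orientations disagree, each counted once through its arrow in [o];
   their number is the induction measure. *)
pose D o := [set p : vertex G * vertex G | o p.1 p.2 && o2 p.2 p.1].
have [n] := ubnP #|D o1|; elim: n o1 => // n IH o1 /ltnSE Dn.
have [D0|[[x y]]] := set_0Vmem (D o1).
  apply: orient_equiv_eq.
  have sub x y : o1 x y -> o2 x y.
    move=> oxy; rewrite (arrow_dir o2 (arrow_edge oxy)); apply/negP => oyx.
    by have := in_set0 (x, y); rewrite -D0 inE oxy oyx.
  move=> x y; apply/idP/idP; first exact: sub.
  move=> oxy; rewrite (arrow_dir o1 (arrow_edge oxy)); apply/negP => /sub.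
  by rewrite (arrow_dir o2 (y := x)) ?oxy // edge_sym (arrow_edge oxy).
rewrite inE /= => /andP[oxy oyx].
pose S := [set z | connect (remove_edge x y) x z].
have xS : x \in S by rewrite inE connect0.
have yS : y \notin S by rewrite inE bridge // (arrow_edge oxy).
have oyx0 : o1 y x = false.
  by apply/negbTE; rewrite -(arrow_dir o1 (arrow_edge oxy)).
(* [x -> y] is the only arrow across the boundary of [S] *)
have boundary u v : o1 u v -> (u \in S) (+) (v \in S) -> (u, v) = (x, y).
  move=> ouv; case: (boolP (remove_edge x y u v)) => [e|].
    have e' : remove_edge x y v u by rewrite remove_edge_sym.
    rewrite !inE; case: (boolP (connect _ x u)) => cu; case: (boolP (connect _ x v)) => cv //.
      by rewrite (connect_trans cu (connect1 e)) in cv.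
    by rewrite (connect_trans cv (connect1 e')) in cu.
  rewrite /remove_edge /= (arrow_edge ouv) /= negbK.
  case/orP=> /andP[/eqP Eu /eqP Ev] _; first by rewrite Eu Ev.
  by rewrite Eu Ev oyx0 in ouv.
apply: (orient_equiv_trans (o2 := flip o1 S)).
  (* [S] is closed under predecessors because the only arrow across its boundary leaves it. *)
  apply: (flip_closed (D := S)) => // u v vS ouv; apply/negPn/negP => uS.
  have := boundary u v ouv; rewrite (negbTE uS) vS => /(_ isT)[E _].
  by rewrite E xS in uS.
(* The flip reverses [x -> y] alone, which then agrees with [o2], so the set of disagreements loses
   [(x, y)] and gains nothing. *)
apply: IH; apply: leq_trans Dn; apply: proper_card; apply/properP; split.
  apply/subsetP => -[u v]; rewrite !inE /= /flip_rel; case: ifP => // b /andP[ovu ovu2].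
  move: b; rewrite addbC => /(boundary _ _ ovu)[E1 E2].
  move: ovu2; rewrite E1 E2 => oxy2.
  by have := arrow_dir o2 (arrow_edge oyx); rewrite oyx oxy2.
exists (x, y); first by rewrite inE /= oxy oyx.
by rewrite inE /= /flip_rel xS (negbTE yS) /= oyx0.
Qed.
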